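(* Let $\alpha,\beta\in(1,2]$ with $\alpha+\beta>3$, and let $\varepsilon>0$. Then there exist $\eta=\eta(\alpha,\beta,\varepsilon)>0$ and $\delta_0=\delta_0(\alpha,\beta,\varepsilon)>0$ such that the following holds for all $\delta\in2^{-\mathbb{N}}\cap(0,\delta_0]$: if $\mathbf{X}\subset\Omega$ is a Frostman $(\delta,\alpha,\beta,\delta^{-\eta})$-set, then $$\mathcal{I}^+_\delta(\mathbf{X})\ge\delta^{1+\varepsilon}|\mathbf{X}|^2.$$
   Context: $\mathbb{N}=\{0,1,2,\dots\}$, $|\cdot|$ of a finite set is cardinality. Phase space: $\Omega=[-1,1]^3$. For $u,v,w\in(0,1]$ and $(a,b,\sigma)\in\mathbb{R}^3$ let $$\mathbf{R}_{u\times v\times w}(a,b,\sigma)=\{(a+r_1,\;b+\sigma r_1+r_2,\;\sigma+r_3):(r_1,r_2,r_3)\in[-u,u]\times[-v,v]\times[-w,w]\}.$$ For $\alpha,\beta\ge0$, $\delta\in(0,1]$, $C>0$, a finite non-empty set $\mathbf{X}\subset\Omega$ is a Frostman $(\delta,\alpha,\beta,C)$-set if $|\mathbf{X}\cap\mathbf{R}_{u\times uw\times w}(a,b,\sigma)|\le C u^\alpha w^\beta|\mathbf{X}|$ for all $(a,b,\sigma)\in\mathbb{R}^3$ and all $u,w\in(0,1]$ with $uw\ge\delta$. For $\omega=(a,b,\sigma)\in\Omega$ write $z_\omega=(a,b)$ and $\ell^+_\omega=\{z_\omega+(r,\sigma r):r\ge0\}$. The ray incidences of a finite $\mathbf{X}\subset\Omega$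 at scale $\delta$ are $$\mathcal{I}^+_\delta(\mathbf{X})=|\{(\omega_1,\omega_2)\in\mathbf{X}\times\mathbf{X}:\mathrm{dist}(z_{\omega_2},\ell^+_{\omega_1})\le\delta\}|.$$ *)

(* Defs.v *)
From mathcomp Require Import all_boot all_order all_algebra finmap.
From mathcomp Require Import all_classical all_reals all_analysis.

Set Implicit Arguments.
Unset Strict Implicit.
Unset Printing Implicit Defensive.

Import Order.TTheory GRing.Theory Num.Theory.

Local Open Scope classical_set_scope.
Local Open Scope ring_scope.

(* A triple (a, b, sigma) is encoded as ((a, b), sigma); its plane point
   z = (a, b) is the first projection and its slope sigma the second. *)
Definition phase_space (R : realType) : set (R * R * R) :=
  `[-1, 1] `*` `[-1, 1] `*` `[-1, 1].

Definition rectangle (R : realType) (u v w a b sigma : R) : set (R * R * R) :=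
  (fun r : R * R * R =>
     (a + r.1.1, b + sigma * r.1.1 + r.1.2, sigma + r.2)) @`
  (`[- u, u] `*` `[- v, v] `*` `[- w, w]).

(* [fset_set] is only meaningful on finite sets; here, and in [ray_incidences],
   it is applied to subsets of X and of X * X.  The notion is meant for
   0 <= alpha, 0 <= beta, 0 < delta <= 1 and 0 < C. *)
Definition Frostman (R : realType) (delta alpha beta C : R)
    (X : {fset R * R * R}) : Prop :=
  [/\ X != fset0,
      [set` X] `<=` @phase_space R
    & forall a b sigma u w : R,
        0 < u <= 1 -> 0 < w <= 1 -> delta <= u * w ->
        #|` fset_set ([set` X] `&` rectangle u (u * w) w a b sigma)|%:R
          <= C * u `^ alpha * w `^ beta * #|` X|%:R].

(* The canonical norm on R * R is the max norm, so the Euclidean distance of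
   the plane is spelled out. *)
Definition eucl_dist (R : realType) (p q : R * R) : R :=
  Num.sqrt ((p.1 - q.1) ^+ 2 + (p.2 - q.2) ^+ 2).

(* [inf] is the genuine infimum whenever A is nonempty. *)
Definition dist_to_set (R : realType) (p : R * R) (A : set (R * R)) : R :=
  inf [set eucl_dist p q | q in A].

Definition forward_ray (R : realType) (omega : R * R * R) : set (R * R) :=
  [set (omega.1.1 + r, omega.1.2 + omega.2 * r) | r in [set r : R | 0 <= r]].

Definition ray_incidences (R : realType) (delta : R)
    (X : {fset R * R * R}) : nat :=
  #|` fset_set [set p : (R * R * R) * (R * R * R) |
        [/\ p.1 \in X, p.2 \in X
          & dist_to_set p.2.1 (forward_ray p.1) <= delta]]|.

(* Main.v *)
From mathcomp Require Import all_boot all_order all_algebra.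
From mathcomp Require Import zify ring lra.

(** Why the theorem is true.  An element [(a, b, sigma)] is a point with a
    direction.  After rounding to a fine grid it becomes a triple of natural
    numbers, and the boxes of the Frostman condition become tiles of the grid.
    Fix a small [D = 2 ^ - m] and write [delta] as about [D ^ N].  Up to small
    powers of [D], one may pass to a subset in which all nonempty tiles with
    abscissae spanning [D ^ i] and slopes spanning [D ^ j] have the same mass
    [D ^ (f i j)] ([uniform_subset], [profile_exists]).  The branching function
    [f] grows by at most [2] per step, and the Frostman condition says that it is
    at least [alpha * i + beta * j] ([profile_lipschitz], [profile_lower]).

    Two facts about lines are used.  First, in a tile [(B1, B2)] whose branching
    function is almost supermodular on the square of side [n], a member joins the
    earlier members of its thin tube to the points of its small box, and counting
    these triples gives about [D ^ (2 * f B1 B2 + n)] of all pairs as incidences at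
    relative scale [D ^ n], which is what one expects of a random set
    ([initial_incidences]).  Second, the high-low method compares incidences at
    two neighbouring scales ([high_low]): the expected proportion persists, unless
    the square of the number of incidences is bounded by the masses of tubes and
    boxes.  At relative scale [D ^ l] this exception is impossible as soon as
    [f (B1 + l) B2 + f B1 (B2 + l) - 2 * f B1 B2] exceeds [3 * l] by a fixed
    proportion ([descent_step]); this is where [alpha + beta > 3] enters.
    Descending from [D ^ n] to [delta] thus costs one factor [D] per step, up to
    constants, that is [delta] in total.

    It remains to find a tile with both properties at a depth bounded independently
    of [N], so that its own cost is negligible against [delta ^ epsilon]
    ([branching_good_scale]).  Take an affine function that supports [f] from
    below at some corner on a range [r], and minimise their difference plus a
    quadratic penalty that drives the minimiser to a prescribed place
    ([lax_oleinik]).  If the minimisers for three prescribed places all arrive,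
    [f] almost touches its support at three corners of a square, and lies above it
    at the fourth, which is supermodularity.  If one of them stops early, then
    [f] has at that point a support that is better by a fixed amount for the
    potential [M * (al + be) + al ^+ 2], on a range shorter by a fixed factor
    ([improvement_at_minimum]).  The potential is bounded, so this happens a
    bounded number of times. *)

Set Implicit Arguments.
Unset Strict Implicit.
Unset Printing Implicit Defensive.

Import Order.TTheory GRing.Theory Num.Theory.

Local Open Scope ring_scope.

(** * Branching functions: a corner that is almost supermodular *)

(** [s ^+ 2 / t] is the perspective of the square, so it is linear along rays
    and the error of its first order expansion is again a perspective square.
    At a minimiser this error is all that is lost. *)
Lemma perspective_identity (R : realFieldType) (s t h g : R) :
  t != 0 -> t - g != 0 ->
  (s + h) ^+ 2 / (t - g) = s ^+ 2 / t + 2 * (s / t) * h + (s / t) ^+ 2 * g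
     + (h + g * (s / t)) ^+ 2 / (t - g).
Proof. by move=> t0 tg0; field; rewrite t0 tg0. Qed.

(** A discrete Hopf-Lax minimisation.  [A1, A2] minimises [k] plus a quadratic
    penalty that sends [v1 - mu * v2] to [target] as [v2] tends to [Te + n],
    minus [eps0 * v2], which rewards late points.  Comparing the minimum with
    its neighbours shows that [k] lies above an affine function up to a
    quadratic error: along [v1 - mu * v2] its slope is the momentum
    [- (M / 2) * z], and along [v2] it gains [eps0] and loses the kinetic energy
    [M / 4 * z ^+ 2]. *)
Lemma lax_oleinik (R : realFieldType) (k : nat -> nat -> R) (X Te n : nat)
    (M mu eps0 target : R) :
  (0 < n)%N -> 0 <= eps0 ->
  exists A1 A2 : nat, let sigma := A1%:R - mu * A2%:R - target in
    let tau := (Te + n - A2)%:R in let z := sigma / tau in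
    [/\ (A1 <= X)%N, (A2 <= Te)%N,
      k A1 A2 + M / 4 * (sigma ^+ 2 / tau)
        <= k 0%N 0%N + M / 4 * (target ^+ 2 / (Te + n)%:R) + eps0 * Te%:R &
      forall v1 v2 : nat, (A1 + v1 <= X)%N -> (A2 + v2 <= Te)%N ->
        k A1 A2 + (- (M / 2) * z) * (v1%:R - mu * v2%:R)
           + (eps0 - M / 4 * z ^+ 2) * v2%:R
           - M / 4 * ((v1%:R - mu * v2%:R + v2%:R * z) ^+ 2
                      / (Te + n - (A2 + v2))%:R)
        <= k (A1 + v1)%N (A2 + v2)%N].
Proof.
move=> n0 eps0_ge0.
pose phi (v : 'I_X.+1 * 'I_Te.+1) : R :=
  k v.1 v.2 + M / 4 * ((v.1%:R - mu * v.2%:R - target) ^+ 2 / (Te + n - v.2)%:R)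
  - eps0 * v.2%:R.
have [[A1 A2] _ Amin] := @Order.TotalTheory.arg_minP _ _ _
   ((ord0, ord0) : 'I_X.+1 * 'I_Te.+1) xpredT phi isT.
have A1X : (A1 <= X)%N by rewrite -ltnS.
have A2T : (A2 <= Te)%N by rewrite -ltnS.
exists A1, A2 => /=; split => //.
  have := Amin (ord0, ord0) isT; rewrite /phi /= subn0 mulr0 subr0 sub0r sqrrN.
  rewrite mulr0 subr0 => H.
  have e0 : eps0 * A2%:R <= eps0 * Te%:R by rewrite ler_wpM2l // ler_nat.
  by move: H; set P := _ / _; set P' := _ / _; lra.
move=> v1 v2 h1 h2.
have l1 : (A1 + v1 < X.+1)%N by [].
have l2 : (A2 + v2 < Te.+1)%N by [].
have := Amin (Ordinal l1, Ordinal l2) isT; rewrite /phi /=.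
set sg := (_ - target); set t := (Te + n - A2)%:R.
have tE : (Te + n - (A2 + v2))%:R = t - v2%:R :> R.
  rewrite /t -natrB; last by lia.
  by congr (_%:R); lia.
rewrite tE.
have t0 : t != 0 by rewrite pnatr_eq0; lia.
have tg0 : t - v2%:R != 0 by rewrite -tE pnatr_eq0; lia.
have -> : (A1 + v1)%:R - mu * (A2 + v2)%:R - target
    = sg + (v1%:R - mu * v2%:R) :> R by rewrite /sg !natrD; ring.
rewrite perspective_identity // !natrD.
set z := sg / t.
set E := (_ ^+ 2 / (t - v2%:R)).
move=> H; set Sg := sg ^+2 / t in H; clearbody E; lra.
Qed.


Section Branching.
Variables (R : realFieldType) (f : nat -> nat -> R) (N : nat) (p M : R).

(** [f i j] is the exponent [x] for which a tile whose abscissae span [D ^ i] and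
    whose slopes span [D ^ j] has relative mass [D ^ x].  A refinement by [D] in
    one direction splits a tile into [D ^ - 2] tiles; [p] bounds the errors. *)
Definition branching_lipschitz := forall i j, (i + j < N)%N ->
  f i j - p / 100 <= f i.+1 j <= f i j + (2 + p / 100) /\
  f i j - p / 100 <= f i j.+1 <= f i j + (2 + p / 100).

Definition spread l i j := f (i + l)%N j + f i (j + l)%N - 2 * f i j.

(** An affine support of [f] at [(B1, B2)], valid up to distance [r].  The second
    clause carries the bound on [spread] at the lengths that the support does not
    reach, and is stable under small moves of the corner.  The last inequality
    places [(al, be)] above a level of the potential [M * (al + be) + al ^+ 2],
    which every improvement of the support raises. *)
Definition supported (B1 B2 r : nat) (al be : R) :=
  [/\ forall v1 v2, (v1 + v2 <= r)%N ->
        al * v1%:R + be * v2%:R <= f (B1 + v1)%N (B2 + v2)%N - f B1 B2,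
      forall v1 v2 l, 100 * (v1 + v2)%:R <= p * r%:R -> (r <= 2 * l)%N ->
        (B1 + v1 + (B2 + v2) + l <= N)%N ->
        (3 + p) * l%:R <= spread l (B1 + v1)%N (B2 + v2)%N,
      0 <= al /\ M * (3 + 2 * p) <= M * (al + be) + al ^+ 2 &
      (B1 + B2 + 2 * r <= N)%N].

(** Supermodularity up to an error is what a count of triples needs in order to
    yield the expected number of incidences at scale [n].  The second inequality
    says that a short piece of a thin tube is a small part of it, and the bound on
    [spread] is what every later scale needs. *)
Definition good_scale (n B1 B2 : nat) :=
  [/\ f (B1 + n)%N B2 + f B1 (B2 + n)%N
        <= f B1 B2 + f (B1 + n)%N (B2 + n)%N + p / 8 * n%:R,
      (1 + p / 4) * n%:R <= f (B1 + n)%N (B2 + n)%N - f B1 (B2 + n)%N &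
      forall l, (n <= l)%N -> (B1 + B2 + l <= N)%N ->
        (3 + p) * l%:R <= spread l B1 B2].

Definition improvable (qn rho : nat) (gain : R) (B1 B2 : nat) (al be : R) :=
  exists A1 A2 al' be', [/\ (A1 + A2 <= 10 * qn)%N,
    supported (B1 + A1) (B2 + A2) rho al' be' &
    M * (al + be) + al ^+ 2 + gain <= M * (al' + be') + al' ^+ 2].

Definition excess (B1 B2 : nat) (al be : R) v1 v2 :=
  f (B1 + v1)%N (B2 + v2)%N - f B1 B2 - (al * v1%:R + be * v2%:R).
End Branching.

(** The lengths satisfy [rho << lc << n << qn << r], with ratios that are large
    powers of [1 / p]: [r] is the radius of the current support, [qn] the range of
    the minimisation, [n] the scale looked for, [lc] the tolerance for a contact
    point, [rho] the radius of an improved support. *)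
Record scales (R : realFieldType) (p M Q : R) (qn r n lc rho : nat) : Prop := Scales {
  p_gt0 : 0 < p; p_small : p <= 1 / 100; Mp : M * p = 10;
  rho_gt0 : (0 < rho)%N; rho_lc : (rho <= lc)%N; lc_n : (10 * lc <= n)%N;
  n_qn : (10 * n <= qn)%N; qn_r : (100 * qn <= r)%N;
  Q_gt0 : 0 < Q; qnE : qn%:R = Q * n%:R;
  qn_rR : 1000 * (10 * qn)%:R <= p * r%:R;
  lc_nR : lc%:R <= p ^+ 2 * n%:R / 1000 :> R;
  rho_lcR : 18 * Q ^+ 2 * rho%:R <= lc%:R;
  MnQ_n : M * (n%:R / Q) <= p * n%:R / (100 * 100);
  MnQ_lc : M * (n%:R / Q) <= p * lc%:R / (100 * 100);
  invQ : 8 / Q <= (p ^+ 2 / 1000) ^+ 2 }.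

Definition eps0 (R : realFieldType) (M Q : R) := M / (3 * Q ^+ 2).

Section BranchingLemmas.
Variables (R : realFieldType).
Implicit Types (f : nat -> nat -> R) (N : nat) (p M : R).

Lemma branching_increments f N p i j a b : branching_lipschitz f N p -> (i + a + (j + b) <= N)%N ->
  f i j - p / 100 * (a + b)%:R <= f (i + a)%N (j + b)%N
    <= f i j + (2 + p / 100) * (a + b)%:R.
Proof.
move=> L; elim: a => [|a IH] in i *.
  rewrite addn0 add0n; elim: b => [|b IH] h; first by rewrite addn0 !mulr0 subr0 addr0 lexx.
  have /andP[h1 h2] := IH ltac:(lia).
  have [_ /andP[h3 h4]] := L i (j + b)%N ltac:(lia).
  rewrite addnS -[b.+1]addn1 natrD; apply/andP; split; lra.
move=> h; have /andP[h1 h2] := IH i ltac:(lia).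
have [/andP[h3 h4] _] := L (i + a)%N (j + b)%N ltac:(lia).
rewrite addnS addSn -[(a + b).+1]addn1 natrD; apply/andP; split; lra.
Qed.

Lemma state_bounds f N p M B1 B2 r al be :
  0 < p <= 1 / 100 -> M * p = 10 -> branching_lipschitz f N p ->
  (0 < r)%N -> supported f N p M B1 B2 r al be ->
  [/\ 1 <= al <= 2 + p / 100, 1 <= be <= 2 + p / 100 & 3 + 3 / 2 * p <= al + be].
Proof.
move=> /andP[p0 p1] Mp L r0 [ha _ [al0 hc] hd].
have rR : 0 < r%:R :> R by rewrite ltr0n.
have a2 : al <= 2 + p / 100.
  have := ha r 0%N ltac:(lia); have /andP[_] := @branching_increments f N p B1 B2 r 0 L ltac:(lia).
  rewrite !addn0 mulr0 addr0 => h1 h2.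
  by rewrite -(ler_pM2r rR); lra.
have b2 : be <= 2 + p / 100.
  have := ha 0%N r ltac:(lia); have /andP[_] := @branching_increments f N p B1 B2 0 r L ltac:(lia).
  rewrite !add0n !addn0 mulr0 add0r => h1 h2.
  by rewrite -(ler_pM2r rR); lra.
have M0 : 0 < M by rewrite -(pmulr_lgt0 _ p0) Mp.
have al5 : al ^+ 2 <= 5 by rewrite expr2; nra.
have s1 : 3 + 3 / 2 * p <= al + be.
  rewrite -(ler_pM2l M0); move: hc; rewrite !mulrDr.
  rewrite !(mulrCA M) Mp; lra.
by split=> //; lra.
Qed.

Lemma norm_le_sqr (x y : R) : 0 <= y -> x ^+ 2 <= y ^+ 2 -> `|x| <= y.
Proof. by move=> y0; rewrite -[x ^+ 2]real_normK ?num_real // ler_sqr ?nnegrE. Qed.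

Section Scaled.
Variables (p M Q : R) (qn r n lc rho : nat).
Hypothesis sc : scales p M Q qn r n lc rho.

Let n0N : (0 < n)%N.
Proof. by move: (rho_gt0 sc) (rho_lc sc) (lc_n sc); clear; lia. Qed.
Let n_gt0 : 0 < n%:R :> R. Proof. by rewrite ltr0n. Qed.
Let M_gt0 : 0 < M.
Proof. by have p0 := p_gt0 sc; rewrite -(pmulr_lgt0 _ p0) (Mp sc). Qed.
Let eps0_ge0 : 0 <= eps0 M Q.
Proof. by apply: divr_ge0; [exact: ltW|rewrite mulr_ge0 ?ler0n ?sqr_ge0]. Qed.

(** The value at the origin bounds the minimum: the reward [eps0] is too small to
    pay for a large excess or for a large momentum. *)
Lemma minimum_bounds (target sg kA : R) (A2 Te : nat) :
  `|target| <= 2 * n%:R -> (qn <= Te <= 3 * qn)%N -> (A2 <= Te)%N ->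
  0 <= kA ->
  kA + M / 4 * (sg ^+ 2 / (Te + n - A2)%:R)
     <= M / 4 * (target ^+ 2 / (Te + n)%:R) + eps0 M Q * Te%:R ->
  [/\ kA <= 2 * (M * (n%:R / Q)), sg ^+ 2 <= 8 * (n%:R / Q) * (Te + n - A2)%:R &
      `|sg / (Te + n - A2)%:R| <= p ^+ 2 / 1000].
Proof.
have Q0 := Q_gt0 sc.
move=> tb /andP[Te1 Te2] A2Te kA0 hk.
set t := (Te + n - A2)%:R in hk *.
have tn : n%:R <= t by rewrite ler_nat; move: A2Te; clear; lia.
have t0 : 0 < t by apply: lt_le_trans tn.
have hval : M / 4 * (target ^+ 2 / (Te + n)%:R) + eps0 M Q * Te%:R <= 2 * (M * (n%:R / Q)).
  have h1 : target ^+ 2 <= 4 * n%:R ^+ 2.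
    rewrite -real_normK ?num_real // (_ : 4 * _ = (2 * n%:R) ^+ 2); last by ring.
    by rewrite ler_sqr ?nnegrE // mulr_ge0.
  have h2 : target ^+ 2 / (Te + n)%:R <= 4 * (n%:R / Q).
    rewrite ler_pdivrMr ?ltr0n ?addn_gt0 ?n0N ?orbT //.
    apply: le_trans h1 _.
    have -> : 4 * (n%:R / Q) * (Te + n)%:R = 4 * n%:R * ((Te + n)%:R / Q) :> R by ring.
    rewrite expr2 mulrA ler_wpM2l ?mulr_ge0 //.
    rewrite ler_pdivlMr // mulrC -(qnE sc) ler_nat.
    by move: Te1; clear; lia.
  have h3 : eps0 M Q * Te%:R <= M * (n%:R / Q).
    rewrite /eps0 mulrAC ler_pdivrMr; last by rewrite mulr_gt0 ?exprn_gt0.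
    have -> : M * (n%:R / Q) * (3 * Q ^+ 2) = M * (3 * qn)%:R :> R.
      by rewrite natrM (qnE sc); field; rewrite lt0r_neq0.
    by rewrite ler_pM2l // ler_nat.
  have : M / 4 * (target ^+ 2 / (Te + n)%:R) <= M / 4 * (4 * (n%:R / Q)).
    by rewrite ler_pM2l // divr_gt0.
  by move: h3; lra.
have sgt0 : 0 <= M / 4 * (sg ^+ 2 / t).
  apply: mulr_ge0; first by rewrite divr_ge0 // ltW.
  by rewrite divr_ge0 ?sqr_ge0 // ltW.
have sg2 : sg ^+ 2 / t <= 8 * (n%:R / Q).
  have : M * (sg ^+ 2 / t) <= M * (8 * (n%:R / Q)).
    by move: hk hval kA0; set x := n%:R / Q; set y := sg ^+2 / t; lra.
  by rewrite ler_pM2l.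
split.
- by move: hk hval sgt0; lra.
- by rewrite -ler_pdivrMr.
apply: norm_le_sqr.
  by have p0 := p_gt0 sc; rewrite divr_ge0 ?exprn_ge0 // ltW.
apply: le_trans (invQ sc).
have -> : (sg / t) ^+ 2 = (sg ^+ 2 / t) / t by field; rewrite lt0r_neq0.
rewrite ler_pdivrMr //; apply: le_trans sg2 _.
by rewrite mulrA mulrAC ler_wpM2l // divr_ge0 // ltW.
Qed.

Lemma abscissa_bound (target sg mu : R) (A1 A2 Te : nat) :
  `|target| <= 2 * n%:R -> (qn <= Te <= 3 * qn)%N -> (A2 <= Te)%N ->
  1 <= mu <= 3 / 2 ->
  sg ^+ 2 <= 8 * (n%:R / Q) * (Te + n - A2)%:R ->
  A1%:R = sg + target + mu * A2%:R -> (A1 <= 6 * qn)%N.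
Proof.
have Q0 := Q_gt0 sc.
move=> tb /andP[Te1 Te2] A2Te /andP[mu1 mu2] sg2 e.
rewrite -(ler_nat R) e.
have sg6 : `|sg| <= 6 * n%:R.
  apply: norm_le_sqr; first by rewrite mulr_ge0.
  apply: le_trans sg2 _.
  have tb' : (Te + n - A2)%:R <= 4 * qn%:R :> R.
    by rewrite -natrM ler_nat; move: (n_qn sc) Te2; clear; lia.
  have : 8 * (n%:R / Q) * (Te + n - A2)%:R <= 8 * (n%:R / Q) * (4 * qn%:R).
    by rewrite ler_wpM2l // mulr_ge0 // divr_ge0 // ltW.
  have -> : 8 * (n%:R / Q) * (4 * qn%:R) = 32 * n%:R ^+ 2 :> R.
    by rewrite (qnE sc); field; rewrite lt0r_neq0.
  move=> /le_trans; apply; rewrite exprMn.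
  by rewrite ler_wpM2r ?sqr_ge0 //; lra.
have h1 : mu * A2%:R <= 3 / 2 * (3 * qn%:R).
  apply: ler_pM => //; first by move: mu1; lra.
  by rewrite -natrM ler_nat; move: A2Te Te2; clear; lia.
have h2 : 10 * n%:R <= qn%:R :> R by rewrite -natrM ler_nat; exact: n_qn sc.
have h3 : sg <= 6 * n%:R by apply: le_trans sg6; rewrite ler_norm.
have h4 : target <= 2 * n%:R by apply: le_trans tb; rewrite ler_norm.
rewrite natrM; move: h1 h2 h3 h4 n_gt0; lra.
Qed.


End Scaled.
End BranchingLemmas.

(** The new support has slopes [al + theta - eps1] and
    [be - mu * theta + eps0 - theta ^+ 2 / M - eps1].  As [M * mu] is
    [M + 2 * al], the terms in [theta] and in [theta ^+ 2] cancel in the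
    potential, whose growth is [M * eps0] up to a multiple of [M * eps1]; here
    [eps1] absorbs the quadratic error on the radius [rho]. *)
Lemma improvement_at_minimum (R : realFieldType) (f : nat -> nat -> R) N
    (p M Q : R) qn r n lc rho B1 B2 al be (A1 A2 : nat) (theta mu : R) :
  scales p M Q qn r n lc rho -> branching_lipschitz f N p ->
  supported f N p M B1 B2 r al be -> (A1 <= 6 * qn)%N -> (A2 <= 3 * qn)%N ->
  M * mu = M + 2 * al -> 1 <= mu <= 3 / 2 -> `|theta| <= p / 100 ->
  excess f B1 B2 al be A1 A2 <= p * lc%:R / 1000 ->
  (forall v1 v2, (v1 + v2 <= 2 * lc)%N ->
    excess f B1 B2 al be A1 A2 + theta * (v1%:R - mu * v2%:R)
      + (eps0 M Q - theta ^+ 2 / M) * v2%:R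
      - M / n%:R * (v1 + v2)%:R ^+ 2 <= excess f B1 B2 al be (A1 + v1)%N (A2 + v2)%N) ->
  improvable f N p M qn rho (M * eps0 M Q / 2) B1 B2 al be.
Proof.
case=> p0 p1 Mp rho0 rholc lcn nqn qnr Q0 qnE qnrR lcnR rholcR _ _ _ L st A16 A23
  muE /andP[mu1 mu2] thb.
set k := excess f B1 B2 al be => kA hmin.
have n0N : (0 < n)%N by clear -rho0 rholc lcn; lia.
have n0 : 0 < n%:R :> R by rewrite ltr0n.
have M0 : 0 < M by rewrite -(pmulr_lgt0 _ p0) Mp.
have M_ge0 := ltW M0.
have r0 : (0 < r)%N by clear -n0N nqn qnr; lia.
have p01 : 0 < p <= 1 / 100 by rewrite p0 p1.
have [/andP[al1 al2] /andP[be1 be2] s1] := state_bounds p01 Mp L r0 st.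
have [ha hb [al0 hc] hd] := st.
have kge0 v1 v2 : (v1 + v2 <= r)%N -> 0 <= k v1 v2.
  by move=> hv; rewrite /k /excess subr_ge0; apply: ha.
pose eps1 := M * rho%:R / n%:R.
have eps1_ge0 : 0 <= eps1 by apply: divr_ge0 => //; apply: mulr_ge0.
have /andP[thn1 thn2] : - (p / 100) <= theta <= p / 100 by rewrite -ler_norml.
have M1000 : 1000 <= M.
  have : M * p <= M * (1 / 100) by rewrite ler_pM2l.
  by rewrite Mp; clear; lra.
have /andP[th20 th21] : 0 <= theta ^+ 2 / M <= p / 100.
  rewrite divr_ge0 ?sqr_ge0 //= ler_pdivrMr //.
  rewrite -real_normK ?num_real // expr2.
  have tM : `|theta| <= M by apply: le_trans thb _; clear -p1 M1000; lra.
  by rewrite ler_pM.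
have rho_n : rho%:R <= p * n%:R / 1000 :> R.
  apply: (@le_trans _ _ lc%:R); first by rewrite ler_nat.
  apply: le_trans lcnR _; rewrite ler_pM2r ?invr_gt0 // ler_pM2r // expr2.
  by rewrite ler_piMr ?(ltW p0) //; clear -p1; lra.
have eps1_small : eps1 <= 1 / 100.
  rewrite /eps1 ler_pdivrMr //.
  have : M * rho%:R <= M * (p * n%:R / 1000) by rewrite ler_pM2l.
  have -> : M * (p * n%:R / 1000) = M * p * n%:R / 1000 by ring.
  by rewrite Mp; clear; lra.
have eps01 : 6 * eps1 <= eps0 M Q.
  rewrite /eps1 /eps0 ler_pdivlMr ?mulr_gt0 ?exprn_gt0 //.
  have -> : 6 * (M * rho%:R / n%:R) * (3 * Q ^+ 2) = M * (18 * Q ^+ 2 * rho%:R / n%:R) by ring.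
  rewrite -[leRHS]mulr1 ler_pM2l // ler_pdivrMr // mul1r.
  apply: le_trans rholcR _; rewrite ler_nat.
  by clear -lcn; lia.
have eps00 : 0 <= eps0 M Q by clear -eps01 eps1_ge0; lra.
exists A1, A2, (al + theta - eps1), (be - mu * theta + eps0 M Q - theta ^+ 2 / M - eps1).
have gain : M * (al + be) + al ^+ 2 + M * eps0 M Q / 2 <=
   M * (al + theta - eps1 + (be - mu * theta + eps0 M Q - theta ^+ 2 / M - eps1)) +
   (al + theta - eps1) ^+ 2.
  have -> : M * (al + theta - eps1 + (be - mu * theta + eps0 M Q - theta ^+ 2 / M - eps1))
     = M * (al + be) + M * theta - M * mu * theta + M * eps0 M Q - theta ^+ 2 - 2 * M * eps1.
    by field; rewrite lt0r_neq0.
  rewrite muE.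
  have e1 : M * (6 * eps1) <= M * eps0 M Q by rewrite ler_pM2l.
  have e2 : (al + theta) * eps1 <= M / 10 * eps1.
    by rewrite ler_wpM2r //; clear -al2 thn2 p1 M1000; lra.
  have e3 : 0 <= eps1 ^+ 2 by rewrite sqr_ge0.
  have e4 : 0 <= M * eps1 by rewrite mulr_ge0.
  rewrite (_ : (al + theta - eps1) ^+ 2 = al ^+ 2 + 2 * al * theta + theta ^+ 2
     - 2 * ((al + theta) * eps1) + eps1 ^+ 2); last by ring.
  clear -e1 e2 e3 e4; lra.
split=> //; first by clear -A16 A23; lia.
split.
- move=> v1 v2 hv.
  have hv' : (v1 + v2 <= 2 * lc)%N by clear -hv rholc; lia.
  have hm := hmin v1 v2 hv'.
  have hq : M / n%:R * (v1 + v2)%:R ^+ 2 <= eps1 * (v1%:R + v2%:R).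
    rewrite -natrD /eps1 expr2 mulrA ler_wpM2r // mulrAC ler_wpM2r ?invr_ge0 //.
    by rewrite ler_wpM2l // ler_nat.
  move: hm hq; rewrite /k /excess !addnA !natrD; set m := theta ^+ 2 / M.
  set q := _ * _ ^+ 2; clear; lra.
- move=> v1 v2 l hv hl hN.
  have hl' : rho%:R <= 2 * l%:R :> R by rewrite -natrM ler_nat.
  have vl : 50 * (v1 + v2)%:R <= p * l%:R.
    have : p * rho%:R <= p * (2 * l%:R) by rewrite ler_pM2l.
    by clear -hv; lra.
  have vl10 : (10 * (v1 + v2) <= l)%N.
    rewrite -(ler_nat R) natrM; have h : p * l%:R <= 1 * l%:R.
      by rewrite ler_wpM2r //; clear -p1; lra.
    have h' : 0 <= (v1 + v2)%:R :> R by [].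
    by clear -vl h h'; lra.
  have vl1 : (v1 + v2 <= l)%N by clear -vl10; lia.
  have [lr|lr] := leqP r (2 * l).
    have := hb (A1 + v1)%N (A2 + v2)%N l; rewrite !addnA; apply=> //; last first.
      by move: hN; rewrite !addnA.
    have -> : (A1 + v1 + A2 + v2 = (A1 + A2) + (v1 + v2))%N by clear; lia.
    rewrite natrD.
    have h1 : (A1 + A2)%:R <= (9 * qn)%:R :> R by rewrite ler_nat; clear -A16 A23; lia.
    have hh : rho%:R <= (10 * qn)%:R :> R.
      by rewrite ler_nat; clear -rholc lcn nqn; lia.
    have h3 : p * rho%:R <= 1 / 100 * rho%:R by rewrite ler_wpM2r.
    rewrite !natrM in qnrR hh h1; have h4 : 0 <= qn%:R :> R by [].
    clear -qnrR h1 hv hh h3 h4.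
    by move: h4 qnrR h1 hv hh h3; set x := _ * r%:R; set y := qn%:R; set w := p * _; lra.
  have hN' : (B1 + A1 + v1 + (B2 + A2 + v2) <= N)%N by clear -hN; lia.
  have /andP[_ lipv] := branching_increments L hN'.
  have kv : k (A1 + v1)%N (A2 + v2)%N <= k A1 A2 + 2 * (v1 + v2)%:R.
    move: lipv; rewrite /k /excess !addnA !natrD => lipv.
    have g1 : v1%:R <= al * v1%:R by rewrite ler_peMl.
    have g2 : v2%:R <= be * v2%:R by rewrite ler_peMl.
    have g3 : p / 100 * (v1%:R + v2%:R) <= 1 * (v1%:R + v2%:R).
      by rewrite ler_wpM2r ?addr_ge0 //; clear -p1; lra.
    by clear -lipv g1 g2 g3; lra.
  have spreadE : spread f l (B1 + A1 + v1)%N (B2 + A2 + v2)%N =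
     (al + be) * l%:R + k (A1 + (v1 + l))%N (A2 + v2)%N
      + k (A1 + v1)%N (A2 + (v2 + l))%N - 2 * k (A1 + v1)%N (A2 + v2)%N.
    by rewrite /spread /k /excess !addnA !natrD; ring.
  rewrite spreadE.
  have s1l : (3 + 3 / 2 * p) * l%:R <= (al + be) * l%:R by rewrite ler_wpM2r.
  have l0 : 0 <= l%:R :> R by [].
  have pl0 : 0 <= p * l%:R by rewrite mulr_ge0 // ltW.
  have [lcl|llc] := leqP lc l.
    have k1 : 0 <= k (A1 + (v1 + l))%N (A2 + v2)%N.
      by apply: kge0; clear -A16 A23 vl10 lr n0N nqn qnr; lia.
    have k2 : 0 <= k (A1 + v1)%N (A2 + (v2 + l))%N.
      by apply: kge0; clear -A16 A23 vl10 lr n0N nqn qnr; lia.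
    have h : p * lc%:R <= p * l%:R by rewrite ler_pM2l // ler_nat.
    by clear -k1 k2 h kv vl kA s1l pl0; lra.
  have h1 := hmin (v1 + l)%N v2 ltac:(clear -vl1 llc; lia).
  have h2 := hmin v1 (v2 + l)%N ltac:(clear -vl1 llc; lia).
  have tl x : `|x| <= 4 * l%:R -> - (p * l%:R / 25) <= theta * x.
    move=> hx; have : `|theta * x| <= p / 100 * (4 * l%:R) by rewrite normrM ler_pM.
    by rewrite ler_norml => /andP[h _]; clear -h; lra.
  have ql (x : nat) : (x <= 2 * l)%N -> M / n%:R * x%:R ^+ 2 <= p * l%:R / 25.
    move=> hx; have hx2 : x%:R <= 2 * l%:R :> R by rewrite -natrM ler_nat.
    have h : x%:R ^+ 2 <= (2 * l%:R) * (2 * lc%:R) :> R.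
      rewrite expr2; apply: ler_pM => //.
      by rewrite -natrM ler_nat; clear -llc hx; lia.
    have : M / n%:R * x%:R ^+ 2 <= M / n%:R * (2 * l%:R * (2 * (p ^+ 2 * n%:R / 1000))).
      apply: ler_wpM2l; first exact: divr_ge0.
      apply: le_trans h _; apply: ler_wpM2l; first by rewrite mulr_ge0.
      by rewrite ler_pM2l.
    have -> : M / n%:R * (2 * l%:R * (2 * (p ^+ 2 * n%:R / 1000)))
       = M * p * (4 * p * l%:R / 1000) by field; rewrite lt0r_neq0.
    by rewrite Mp; clear -pl0; lra.
  have v1l : v1%:R <= l%:R :> R by rewrite ler_nat; clear -vl1; lia.
  have v2l : v2%:R <= l%:R :> R by rewrite ler_nat; clear -vl1; lia.
  have v10 : 0 <= v1%:R :> R by [].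
  have v20 : 0 <= v2%:R :> R by [].
  have mv : 0 <= mu * v2%:R <= 3 / 2 * l%:R.
    by apply/andP; split; [apply: mulr_ge0 => //; clear -mu1; lra|apply: ler_pM => //; clear -mu1; lra].
  have ml : 0 <= mu * l%:R <= 3 / 2 * l%:R.
    by apply/andP; split; [apply: mulr_ge0 => //; clear -mu1; lra|rewrite ler_wpM2r].
  have t1 := @tl ((v1 + l)%:R - mu * v2%:R).
  have t2 := @tl (v1%:R - mu * (v2 + l)%:R).
  have {}t1 : - (p * l%:R / 25) <= theta * ((v1 + l)%:R - mu * v2%:R).
    by apply: t1; rewrite ler_norml natrD; clear -mv v10 v1l l0; apply/andP; split; lra.
  have {}t2 : - (p * l%:R / 25) <= theta * (v1%:R - mu * (v2 + l)%:R).
    by apply: t2; rewrite ler_norml natrD mulrDr; clear -mv ml v10 v1l l0; apply/andP; split; lra.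
  have q1 := @ql (v1 + l + v2)%N ltac:(clear -vl1; lia).
  have q2 := @ql (v1 + (v2 + l))%N ltac:(clear -vl1; lia).
  have et w : w <= 2 * l%:R -> 0 <= w -> - (p * l%:R / 50) <= (eps0 M Q - theta ^+ 2 / M) * w.
    move=> w2 w0; rewrite mulrBl.
    have h3 : 0 <= eps0 M Q * w by apply: mulr_ge0.
    have h4 : theta ^+ 2 / M * w <= p / 100 * (2 * l%:R) by apply: ler_pM.
    by clear -h3 h4; lra.
  have e1 := @et v2%:R ltac:(clear -v2l l0; lra) v20.
  have e2 := @et (v2 + l)%:R ltac:(rewrite natrD; clear -v2l l0; lra) ltac:(by []).
  have h6 : (3 + p) * l%:R = 3 * l%:R + p * l%:R by ring.
  have h7 : (3 + 3 / 2 * p) * l%:R = 3 * l%:R + 3 / 2 * (p * l%:R) by ring.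
  rewrite h6; rewrite h7 in s1l.
  clear -h1 h2 t1 t2 q1 q2 e1 e2 kv vl pl0 s1l kA; lra.
- split=> //; first by clear -al1 thn1 p1 eps1_small; lra.
  apply: le_trans hc _; apply: le_trans gain; rewrite lerDl.
  by apply: divr_ge0 => //; apply: mulr_ge0.
by clear -A16 A23 rholc lcn nqn qnr hd; lia.
Qed.

(** If the minimum is reached well before the end [Te], it has room on all sides
    and yields a better support.  Otherwise it is a point of small excess, and the
    penalty forces it close to the prescribed place. *)
Lemma contact_or_improvable (R : realFieldType) (f : nat -> nat -> R) N
    (p M Q : R) qn r n lc rho B1 B2 al be (target : R) Te :
  let mu := 1 + 2 * al / M in
  scales p M Q qn r n lc rho -> branching_lipschitz f N p ->
  supported f N p M B1 B2 r al be ->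
  `|target| <= 2 * n%:R -> (qn <= Te <= 3 * qn)%N ->
  improvable f N p M qn rho (M * eps0 M Q / 2) B1 B2 al be \/
  exists A1 A2 : nat,
    [/\ (A1 <= 6 * qn)%N, (A2 <= Te < A2 + 2 * lc)%N,
       excess f B1 B2 al be A1 A2 <= p * lc%:R / 1000 &
       `|A1%:R - mu * A2%:R - target| <= p * n%:R / 1000].
Proof.
move=> mu sc L st tb /andP[Te1 Te2].
have [p0 p1 Mp rho0 rholc lcn nqn qnr Q0 qnE qnrR lcnR rholcR _ MnQlc iQ] := sc.
have n0N : (0 < n)%N by clear -rho0 rholc lcn; lia.
have n0 : 0 < n%:R :> R by rewrite ltr0n.
have M0 : 0 < M by rewrite -(pmulr_lgt0 _ p0) Mp.
have M_ge0 := ltW M0.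
have r0 : (0 < r)%N by clear -n0N nqn qnr; lia.
have p01 : 0 < p <= 1 / 100 by rewrite p0 p1.
have [/andP[al1 al2] _ _] := state_bounds p01 Mp L r0 st.
have [ha _ _ _] := st.
set k := excess f B1 B2 al be.
have k00 : k 0%N 0%N = 0.
  by rewrite /k /excess !addn0 !mulr0 addr0 subr0 subrr.
have kge0 v1 v2 : (v1 + v2 <= r)%N -> 0 <= k v1 v2.
  by move=> hv; rewrite /k /excess subr_ge0; apply: ha.
have muE : M * mu = M + 2 * al by rewrite /mu; field; rewrite lt0r_neq0.
have /andP[mu1 mu2] : 1 <= mu <= 3 / 2.
  have e : 2 * al / M <= 1 / 2.
    rewrite ler_pdivrMr //.
    have h : M * p <= M * (1 / 100) by rewrite ler_pM2l.
    by move: h; rewrite Mp; clear -al2 p1; lra.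
  have e0 : 0 <= 2 * al / M.
    by apply: divr_ge0 => //; apply: mulr_ge0 => //; clear -al1; lra.
  by rewrite /mu; apply/andP; split; clear -e e0; lra.
have eps00 : 0 <= eps0 M Q.
  by apply: divr_ge0 => //; apply: mulr_ge0 => //; rewrite sqr_ge0.
have [A1 [A2 []]] := @lax_oleinik R k (7 * qn)%N Te n M mu (eps0 M Q) target n0N eps00.
set sg := _ - target; set z := sg / _.
rewrite k00 add0r => A1X A2T hk hmin.
have knn : 0 <= k A1 A2 by apply: kge0; clear -A1X A2T Te2 qnr; lia.
have Te12 : (qn <= Te <= 3 * qn)%N by rewrite Te1.
have mu12 : 1 <= mu <= 3 / 2 by rewrite mu1.
have [kA sg2 zb] := minimum_bounds sc tb Te12 A2T knn hk.
rewrite -/z in zb.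
have A16 : (A1 <= 6 * qn)%N.
  by apply: (abscissa_bound sc tb Te12 A2T mu12 sg2); rewrite /sg; ring.
have kA' : k A1 A2 <= p * lc%:R / 1000.
  have h : 0 <= p * lc%:R by rewrite mulr_ge0 // ltW.
  by clear -kA MnQlc h; lra.
have [late|early] := ltnP Te (A2 + 2 * lc); [right|left].
  exists A1, A2; split=> //; first by rewrite A2T.
  apply: norm_le_sqr; first by rewrite divr_ge0 ?mulr_ge0 // ltW.
  have t2n : (Te + n - A2)%:R <= 2 * n%:R :> R.
    by rewrite -natrM ler_nat; clear -late lcn; lia.
  apply: (@le_trans _ _ (8 / Q * (2 * n%:R ^+ 2))).
    have -> : 8 / Q * (2 * n%:R ^+ 2) = 8 * (n%:R / Q) * (2 * n%:R).
      by field; rewrite lt0r_neq0.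
    apply: le_trans sg2 _; apply: ler_wpM2l => //.
    by rewrite mulr_ge0 // divr_ge0 // ltW.
  apply: (@le_trans _ _ ((p ^+ 2 / 1000) ^+ 2 * (2 * n%:R ^+ 2))).
    by apply: ler_wpM2r => //; rewrite mulr_ge0 ?sqr_ge0.
  have -> : (p ^+ 2 / 1000) ^+ 2 * (2 * n%:R ^+ 2) = 2 * p ^+ 2 * (p * n%:R / 1000) ^+ 2 by field.
  rewrite ler_piMl ?sqr_ge0 //.
  by rewrite expr2; clear -p0 p1; nra.
have thb : `|- (M / 2) * z| <= p / 100.
  rewrite normrM normrN (ger0_norm (divr_ge0 M_ge0 (ler0n _ 2))).
  apply: (@le_trans _ _ (M / 2 * (p ^+ 2 / 1000))).
    by apply: ler_wpM2l => //; apply: divr_ge0.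
  have -> : M / 2 * (p ^+ 2 / 1000) = M * p * (p / 2000) by field.
  by rewrite Mp; clear -p0; lra.
have A23 : (A2 <= 3 * qn)%N by apply: leq_trans A2T Te2.
apply: (improvement_at_minimum sc L st A16 A23 muE mu12 thb kA').
move=> v1 v2 hv.
have hm := hmin v1 v2 ltac:(clear -A16 hv lcn nqn; lia) ltac:(clear -hv early; lia).
have zE : (- (M / 2) * z) ^+ 2 / M = M / 4 * z ^+ 2 by field; rewrite lt0r_neq0.
rewrite zE; apply: le_trans hm; rewrite lerD2l lerN2.
have den : n%:R <= (Te + n - (A2 + v2))%:R :> R by rewrite ler_nat; clear -hv early; lia.
have v10 : 0 <= v1%:R :> R by [].
have v20 : 0 <= v2%:R :> R by [].
have /andP[z1 z2] : - (1 / 4) <= z <= 1 / 4.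
  rewrite -ler_norml; apply: le_trans zb _; rewrite expr2.
  by clear -p0 p1; nra.
have hb : (v1%:R - mu * v2%:R + v2%:R * z) ^+ 2 <= (2 * (v1 + v2)%:R) ^+ 2.
  rewrite -[_ ^+ 2]real_normK ?num_real // ler_sqr ?nnegrE ?mulr_ge0 // ler_norml natrD.
  have h1 : mu * v2%:R <= 3 / 2 * v2%:R by apply: ler_wpM2r.
  have h2 : v2%:R <= mu * v2%:R by apply: ler_peMl.
  have h3 : v2%:R * z <= v2%:R * (1 / 4) by apply: ler_wpM2l.
  have h4 : v2%:R * (- (1 / 4)) <= v2%:R * z by apply: ler_wpM2l.
  by clear -h1 h2 h3 h4 v10 v20; apply/andP; split; lra.
have -> : M / n%:R * (v1 + v2)%:R ^+ 2 = M / 4 * ((2 * (v1 + v2)%:R) ^+ 2 / n%:R).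
  by field; rewrite lt0r_neq0.
apply: ler_wpM2l; first exact: divr_ge0.
apply: ler_pM; [exact: sqr_ge0|by rewrite invr_ge0|exact: hb|].
by rewrite lef_pV2 ?posrE // (lt_le_trans n0).
Qed.

(** Three minimisations with different targets yield contacts near a point [A],
    near [A + (n, 0)] and near [A + (0, n)].  The excess is nonnegative at
    [A + (n, n)], so that supermodularity at [A] follows up to an error. *)
Lemma good_or_improvable (R : realFieldType) (f : nat -> nat -> R) N
    (p M Q : R) qn r n lc rho B1 B2 al be :
  scales p M Q qn r n lc rho -> branching_lipschitz f N p ->
  supported f N p M B1 B2 r al be ->
  improvable f N p M qn rho (M * eps0 M Q / 2) B1 B2 al be \/
  exists A1 A2 : nat, (A1 + A2 <= 10 * qn)%N /\
    good_scale f N p n (B1 + A1) (B2 + A2).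
Proof.
move=> sc L st.
have [p0 p1 Mp rho0 rholc lcn nqn qnr Q0 qnE qnrR lcnR rholcR _ MnQlc iQ] := sc.
have n0N : (0 < n)%N by clear -rho0 rholc lcn; lia.
have n0 : 0 < n%:R :> R by rewrite ltr0n.
have r0 : (0 < r)%N by clear -n0N nqn qnr; lia.
have M0 : 0 < M by rewrite -(pmulr_lgt0 _ p0) Mp.
have p01 : 0 < p <= 1 / 100 by rewrite p0 p1.
have [/andP[al1 al2] /andP[be1 be2] s1] := state_bounds p01 Mp L r0 st.
have [ha hb _ hd] := st.
pose k := excess f B1 B2 al be; pose mu := 1 + 2 * al / M.
have kge0 v1 v2 : (v1 + v2 <= r)%N -> 0 <= k v1 v2.
  by move=> hv; rewrite /k /excess subr_ge0; apply: ha.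
have /andP[mu1 mu2] : 1 <= mu <= 3 / 2.
  have e : 2 * al / M <= 1 / 2.
    rewrite ler_pdivrMr //.
    have h : M * p <= M * (1 / 100) by rewrite ler_pM2l.
    by move: h; rewrite Mp; clear -al2 p1; lra.
  have e0 : 0 <= 2 * al / M.
    by apply: divr_ge0; [apply: mulr_ge0 => //; clear -al1; lra|exact: ltW].
  by rewrite /mu; apply/andP; split; clear -e e0; lra.
have pn : 0 <= p * n%:R <= n%:R.
  by rewrite mulr_ge0 ?(ltW p0) //= ler_piMl //; clear -p1; lra.
(* k is Lipschitz in both directions, so contacts may be moved slightly. *)
have klip u1 u2 a b : (B1 + u1 + a + (B2 + u2 + b) <= N)%N ->
    `|k (u1 + a)%N (u2 + b)%N - k u1 u2| <= 3 * (a + b)%:R.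
  move=> h; have /andP[] := @branching_increments R f N p (B1 + u1) (B2 + u2) a b L h.
  rewrite ler_norml /k /excess !addnA !natrD => l1 l2.
  have a0 : 0 <= a%:R :> R by [].
  have b0 : 0 <= b%:R :> R by [].
  have g1 : 1 * a%:R <= al * a%:R by apply: ler_wpM2r.
  have g2 : 1 * b%:R <= be * b%:R by apply: ler_wpM2r.
  have g3 : al * a%:R <= (2 + 1 / 100) * a%:R.
    by apply: ler_wpM2r => //; clear -al2 p1; lra.
  have g4 : be * b%:R <= (2 + 1 / 100) * b%:R.
    by apply: ler_wpM2r => //; clear -be2 p1; lra.
  have g5 : p / 100 * (a%:R + b%:R) <= 1 / 100 * (a%:R + b%:R).
    by apply: ler_wpM2r; [apply: addr_ge0|clear -p1; lra].
  by clear -l1 l2 g1 g2 g3 g4 g5 a0 b0; apply/andP; split; lra.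
have klip2 u1 u2 w1 w2 : (u1 + u2 <= r)%N -> (w1 + w2 <= r)%N ->
    k u1 u2 <= k w1 w2 + 3 * (`|u1%:R - w1%:R| + `|u2%:R - w2%:R|).
  move=> hu hw.
  have h1 := @klip (minn u1 w1) (minn u2 w2) (u1 - minn u1 w1)%N (u2 - minn u2 w2)%N
    ltac:(clear -hu hd; lia).
  have h2 := @klip (minn u1 w1) (minn u2 w2) (w1 - minn u1 w1)%N (w2 - minn u2 w2)%N
    ltac:(clear -hw hd; lia).
  rewrite !subnKC ?geq_minl ?geq_minr // in h1 h2.
  have e x y : ((x - minn x y) + (y - minn x y))%:R = `|x%:R - y%:R| :> R.
    have [xy|xy] := leqP x y.
      by rewrite subnn add0n natrB // distrC ger0_norm // subr_ge0 ler_nat.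
    by rewrite subnn addn0 natrB 1?ltnW // ger0_norm // subr_ge0 ler_nat ltnW.
  rewrite -!e !natrD; move: h1 h2; rewrite !ler_norml !natrD.
  by clear; move=> /andP[h1 h2] /andP[h3 h4]; lra.
have nqnR : 10 * n%:R <= qn%:R :> R by rewrite -natrM ler_nat.
have plc : 0 <= p * lc%:R by rewrite mulr_ge0 ?(ltW p0).
have plc1 : p * lc%:R <= p * n%:R / 10.
  rewrite -mulrA ler_pM2l // ler_pdivlMr // mulrC -natrM ler_nat //.
have lcp : lc%:R <= p * n%:R / 1000 :> R.
  apply: le_trans lcnR _; rewrite ler_pM2r ?invr_gt0 // ler_pM2r // expr2.
  by rewrite ler_piMr ?(ltW p0) //; clear -p1; lra.
have [|[A1 [A2 [A16 /andP[A2T TA2] kA sA]]]] := @contact_or_improvable R f N p M Q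
   qn r n lc rho B1 B2 al be 0 (2 * qn)%N sc L st ltac:(by rewrite normr0 mulr_ge0)
   ltac:(clear; lia).
  by left.
rewrite subr0 -/mu in sA.
have /andP[sA1 sA2] : - (p * n%:R / 1000) <= A1%:R - mu * A2%:R <= p * n%:R / 1000.
  by rewrite -ler_norml.
have nearby (d1 d2 : nat) : (d1 + d2 = n)%N ->
    improvable f N p M qn rho (M * eps0 M Q / 2) B1 B2 al be \/
    k (A1 + d1)%N (A2 + d2)%N <= p * n%:R / 20.
  move=> dn.
  have d1n : 0 <= (d1%:R : R) <= n%:R by rewrite ler0n ler_nat; clear -dn; lia.
  have d2n : 0 <= (d2%:R : R) <= n%:R by rewrite ler0n ler_nat; clear -dn; lia.
  have /andP[d10 d11] := d1n; have /andP[d20 d21] := d2n; have /andP[pn0 pn1] := pn.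
  pose s := (A1 + d1)%:R - mu * (A2 + d2)%:R.
  have ds : d1%:R + d2%:R = n%:R :> R by rewrite -natrD dn.
  have md : 0 <= mu * d2%:R <= 3 / 2 * d2%:R.
    by rewrite mulr_ge0 ?ler_wpM2r //; clear -mu1; lra.
  have sb : `|s| <= 2 * n%:R.
    rewrite /s !natrD mulrDr ler_norml; have /andP[md1 md2] := md.
    by clear -sA1 sA2 md1 md2 d10 d20 ds pn1 n0; apply/andP; split; lra.
  have [|[a1 [a2 [a16 /andP[a2T Ta2] ka sa]]]] := @contact_or_improvable R f N p M Q
     qn r n lc rho B1 B2 al be s (A2 + d2)%N sc L st sb
     ltac:(clear -A2T TA2 dn nqn lcn; lia); first by left.
  right; rewrite -/mu -/k in sa ka.
  apply: (le_trans (@klip2 (A1 + d1)%N (A2 + d2)%N a1 a2 ltac:(clear -A16 A2T dn nqn qnr; lia)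
    ltac:(clear -a16 a2T A2T dn nqn qnr; lia))).
  have h2 : `|(A2 + d2)%:R - a2%:R| <= 2 * lc%:R :> R.
    rewrite ger0_norm ?subr_ge0 ?ler_nat // lerBlDr -natrM -natrD ler_nat.
    by clear -Ta2; lia.
  have h1 : `|(A1 + d1)%:R - a1%:R| <= 3 * lc%:R + p * n%:R / 1000.
    have -> : (A1 + d1)%:R - a1%:R = mu * ((A2 + d2)%:R - a2%:R) - (a1%:R - mu * a2%:R - s).
      by rewrite /s; ring.
    apply: le_trans (ler_normB _ _) _; apply: lerD => //.
    rewrite normrM ger0_norm; last by clear -mu1; lra.
    apply: (@le_trans _ _ (3 / 2 * (2 * lc%:R))); last by clear; lra.
    by apply: ler_pM => //; clear -mu1; lra.
  by clear -h1 h2 ka lcp plc1 pn0; lra.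
have [|kx] := @nearby n 0%N ltac:(by rewrite addn0); first by left.
have [|ky] := @nearby 0%N n ltac:(by []); first by left.
rewrite !addn0 in kx ky.
right; exists A1, A2; split; first by clear -A16 A2T; lia.
have kz : 0 <= k (A1 + n)%N (A2 + n)%N by apply: kge0; clear -A16 A2T nqn qnr; lia.
have kAA : 0 <= k A1 A2 by apply: kge0; clear -A16 A2T nqn qnr; lia.
have al1p : 1 + 3 / 4 * p <= al by clear -s1 be2 p0; lra.
have /andP[pn0 _] := pn.
split.
- move: kx ky kz kAA; rewrite /k /excess !addnA !natrD; clear -pn0; lra.
- have h : (1 + 3 / 4 * p) * n%:R <= al * n%:R by apply: ler_wpM2r.
  move: ky kz; rewrite /k /excess !addnA !natrD; clear -pn0 h; lra.
move=> l nl lN.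
have nlR : n%:R <= l%:R :> R by rewrite ler_nat.
have [lr|lr] := leqP r (2 * l).
  apply: hb => //.
  have h : (A1 + A2)%:R <= (10 * qn)%:R :> R by rewrite ler_nat; clear -A16 A2T; lia.
  have h0 : 0 <= (A1 + A2)%:R :> R by [].
  by clear -h h0 qnrR; lra.
have s1l : (3 + 3 / 2 * p) * l%:R <= (al + be) * l%:R by apply: ler_wpM2r.
have k1 : 0 <= k (A1 + l)%N A2 by apply: kge0; clear -A16 A2T lr qnr nqn n0N; lia.
have k2 : 0 <= k A1 (A2 + l)%N by apply: kge0; clear -A16 A2T lr qnr nqn n0N; lia.
have h : p * n%:R <= p * l%:R by rewrite ler_pM2l.
have kA' : k A1 A2 <= p * lc%:R / 1000 by [].
move: k1 k2 kA'; rewrite /spread /k /excess !addnA !natrD.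
by clear -s1l h pn0 plc1 plc; lra.
Qed.

(** The exponents balance as follows: [Q] must beat [p ^ - 9] so that the penalty
    [M * n / Q] is small against [p * lc], while [lc] is about [p ^ 4 * n]. *)
Lemma exists_scales (R : archiRealFieldType) (p M : R) :
  0 < p -> p <= 1 / 100 -> M * p = 10 ->
  exists Q c1 c2 c3 : nat, [/\ (0 < c1 * c2 * c3)%N, 0 < Q%:R :> R &
    forall rho, (0 < rho)%N ->
    let lc := (c2 * rho)%N in let n := (c1 * lc)%N in
    scales p M Q%:R (Q * n) (c3 * n) n lc rho].
Proof.
move=> p0 p1 Mp.
have expp a b : (b <= a)%N -> p ^+ a <= p ^+ b / 100 ^+ (a - b).
  move=> ab; rewrite -{1}(subnKC ab) exprD -exprVn.
  apply: ler_wpM2l; first by rewrite exprn_ge0 // ltW.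
  by rewrite lerXn2r ?nnegrE ?invr_ge0 ?(ltW p0) //; clear -p1; lra.
have arch (x : R) : exists k : nat, x <= k%:R.
  exists (Num.bound `|x|); apply/ltW/(le_lt_trans (ler_norm x)).
  exact: archi_boundP (normr_ge0 x).
have M0 : 0 < M by rewrite -(pmulr_lgt0 _ p0) Mp.
have pk k : 0 < p ^+ k by rewrite exprn_gt0.
have [Q hQ0] := arch ((p ^+ 9)^-1).
have hQ : 1 <= p ^+ 9 * Q%:R by rewrite mulrC -ler_pdivrMr // div1r.
pose c1 := (Num.truncn (p ^+ 4)^-1).+1.
have hc1 : 1 <= p ^+ 4 * c1%:R <= 2.
  have h0 : 0 <= (p ^+ 4)^-1 by rewrite invr_ge0 ltW.
  have h1 := truncnS_gt (p ^+ 4)^-1; have h2 := truncn_le (p ^+ 4)^-1.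
  rewrite h0 in h2.
  apply/andP; split; first by rewrite mulrC -ler_pdivrMr // div1r ltW.
  rewrite mulrC -ler_pdivlMr // /c1 -addn1 natrD.
  have : 1 <= (p ^+ 4)^-1.
    by rewrite invf_ge1 // exprn_ile1 ?(ltW p0) //; clear -p1; lra.
  by move: h2; set w := _^-1; set y := _%:R; clear; lra.
have [c3 hc30] := arch (Q%:R / p ^+ 3).
have hc3 : Q%:R <= p ^+ 3 * c3%:R by rewrite mulrC -ler_pdivrMr.
pose c2 := (18 * (Q * Q))%N.
have Q1 : 1000 <= Q%:R :> R.
  have := @expp 9 0 isT; rewrite expr0 subn0 => h.
  have h1 : 1 <= Q%:R / 100 ^+ 9 :> R.
    by apply: le_trans hQ _; rewrite [_ / _]mulrC ler_wpM2r // -div1r.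
  have h2 : 100 ^+ 9 <= Q%:R :> R by move: h1; rewrite ler_pdivlMr ?mul1r // exprn_gt0.
  apply: le_trans h2; apply: (@le_trans _ _ (100 ^+ 2)); first by clear; lra.
  by rewrite ler_eXn2l //; clear; lra.
have Q0 : 0 < Q%:R :> R by clear -Q1; lra.
have Q0N : (0 < Q)%N by rewrite -(ltr0n R).
have c2Q : (10 <= c2)%N by rewrite /c2; clear -Q0N; lia.
have c1R : 1000 <= c1%:R :> R.
  have /andP[h _] := hc1; have := @expp 4 0 isT; rewrite expr0 subn0 => h1.
  have h2 : 1 <= c1%:R / 100 ^+ 4 :> R.
    by apply: le_trans h _; rewrite [_ / _]mulrC ler_wpM2r // -div1r.
  have h3 : 100 ^+ 4 <= c1%:R :> R by move: h2; rewrite ler_pdivlMr ?mul1r // exprn_gt0.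
  apply: le_trans h3; apply: (@le_trans _ _ (100 ^+ 2)); first by clear; lra.
  by rewrite ler_eXn2l //; clear; lra.
have c110 : (10 <= c1)%N by rewrite -(ler_nat R); clear -c1R; lra.
have c3Q : 100 * Q%:R <= c3%:R :> R.
  have h := @expp 3 0 isT; rewrite expr0 subn0 in h.
  have h3 : p ^+ 3 * c3%:R <= 1 / 100 * c3%:R.
    apply: ler_wpM2r => //; apply: le_trans h _.
    by rewrite ler_pM2l // lef_pV2 ?posrE ?exprn_gt0 //; clear; lra.
  by clear -hc3 h3; lra.
have c3QN : (100 * Q <= c3)%N by rewrite -(ler_nat R) natrM.
exists Q, c1, c2, c3; split=> //.
  by rewrite !muln_gt0; clear -c110 c2Q c3QN Q0N; lia.
move=> rho rho0 lc n.
have rhoR : 0 < rho%:R :> R by rewrite ltr0n.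
have lc0N : (0 < lc)%N by rewrite /lc muln_gt0 rho0 (leq_trans _ c2Q).
have n0N : (0 < n)%N by rewrite /n muln_gt0 lc0N (leq_trans _ c110).
have n0 : 0 < n%:R :> R by rewrite ltr0n.
have lc0 : 0 < lc%:R :> R by rewrite ltr0n.
have lcn : lc%:R <= p ^+ 4 * n%:R :> R.
  by rewrite /n natrM mulrA -[X in X <= _]mul1r ler_wpM2r //; have /andP[] := hc1.
have nlc : p ^+ 4 * n%:R <= 2 * lc%:R :> R.
  by rewrite /n natrM mulrA ler_wpM2r //; have /andP[] := hc1.
have h : M * (n%:R / Q%:R) <= 10 * p ^+ 8 * n%:R.
  rewrite mulrA ler_pdivrMr // -(ler_pM2r p0) mulrAC Mp.
  have -> : 10 * p ^+ 8 * n%:R * Q%:R * p = 10 * n%:R * (p ^+ 9 * Q%:R) by ring.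
  by rewrite -[X in X <= _]mulr1 ler_pM2l // mulr_gt0.
have p3 : p ^+ 4 <= p / 100 ^+ 3 by apply: (@expp 4 1 isT).
have h1 : M * (n%:R / Q%:R) <= p * lc%:R / (100 * 100).
  apply: le_trans h _.
  have -> : 10 * p ^+ 8 * n%:R = 10 * (p ^+ 4 * (p ^+ 4 * n%:R)) by ring.
  have e1 : p ^+ 4 * (p ^+ 4 * n%:R) <= p / 100 ^+ 3 * (2 * lc%:R).
    by rewrite ler_pM // ?mulr_ge0 // ltW.
  have e2 : 0 <= p * lc%:R by rewrite mulr_ge0 // ltW.
  by rewrite !exprS expr0 in e1; clear -e1 e2; lra.
split=> //.
- by rewrite /lc leq_pmull // (leq_trans _ c2Q).
- by rewrite /n leq_mul2r c110 orbT.
- rewrite leq_mul2r (_ : 10 <= Q)%N ?orbT //.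
  by rewrite -(ler_nat R); clear -Q1; lra.
- by rewrite mulnA leq_mul2r c3QN orbT.
- by rewrite natrM.
- have e1 : Q%:R * n%:R <= p ^+ 3 * (c3 * n)%:R.
    by rewrite natrM mulrA ler_wpM2r // ltW.
  have e2 : p ^+ 3 * (c3 * n)%:R <= p / 100 ^+ 2 * (c3 * n)%:R.
    by rewrite ler_wpM2r //; apply: (@expp 3 1 isT).
  rewrite 2!natrM; move: e2; rewrite expr2.
  by set w := p * (c3 * n)%:R; rewrite [p / _ * _]mulrAC -/w; clear -e1; lra.
- apply: le_trans lcn _; rewrite [p ^+ 2 * _ / _]mulrAC ler_pM2r //.
  apply: le_trans (@expp 4 2 isT) _.
  by rewrite ler_pM2l // lef_pV2 ?posrE ?exprn_gt0 //; clear; lra.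
- rewrite /lc /c2 !natrM; clear; lra.
- apply: le_trans h1 _.
  apply: ler_wpM2r; first by rewrite invr_ge0 mulr_ge0.
  apply: ler_wpM2l; first exact: ltW.
  by rewrite ler_nat /n leq_pmull // (leq_trans _ c110).
rewrite ler_pdivrMr //.
have e3 := @expp 9 4 isT.
have e2 : 1 <= p ^+ 4 / 100 ^+ 5 * Q%:R.
  by apply: le_trans hQ _; rewrite ler_wpM2r // ltW.
have -> : (p ^+ 2 / 1000) ^+ 2 * Q%:R = 100 * 100 * (p ^+ 4 / 100 ^+ 5 * Q%:R) by field.
by move: e2; set w := _ * Q%:R; clear; lra.
Qed.

(** The slopes are at most [2 + p / 100], so the potential is at most [6 * M].  An
    improvement adds [gain] to it and divides the radius by [K], so at most [S]
    of them are possible; [nmax] depends on [p] and [nmin] only. *)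
Lemma branching_good_scale (R : archiRealFieldType) (p : R) (nmin : nat) :
  0 < p <= 1 / 100 ->
  exists nmax : nat, forall N (f : nat -> nat -> R) (al be : R),
    (nmax <= N)%N -> branching_lipschitz f N p -> 0 <= al -> 3 + 2 * p <= al + be ->
    (forall i j, (i + j <= N)%N -> al * i%:R + be * j%:R <= f i j - f 0%N 0%N) ->
    exists n B1 B2, [/\ (nmin <= n <= nmax)%N, (B1 + B2 <= nmax)%N & good_scale f N p n B1 B2].
Proof.
move=> /andP[p0 p1].
pose M := 10 / p; have Mp : M * p = 10 by rewrite /M divfK // lt0r_neq0.
have M0 : 0 < M by rewrite -(pmulr_lgt0 _ p0) Mp.
have [Q [c1 [c2 [c3 [c0 Q0 hs]]]]] := exists_scales p0 p1 Mp.
pose K := (c3 * (c1 * c2))%N.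
have K0 : (0 < K)%N by rewrite /K mulnC.
pose gain := M * eps0 M Q%:R / 2.
have gain0 : 0 < gain.
  by rewrite /gain /eps0 divr_gt0 // mulr_gt0 // divr_gt0 // mulr_gt0 // exprn_gt0.
pose S := Num.bound (6 * M / gain).
have hS : 6 * M <= S%:R * gain.
  rewrite -ler_pdivrMr //; apply/ltW/archi_boundP.
  by apply: divr_ge0; [rewrite mulr_ge0 // ltW|exact: ltW].
pose r0 := nmin.+1.
exists ((S + 2) * (K ^ S * r0))%N => N f al be nN L al0 s0 hf.
have stages s (r : nat) B1 B2 a b : r = (K ^ s * r0)%N ->
    supported f N p M B1 B2 r a b -> 6 * M <= s%:R * gain + (M * (a + b) + a ^+ 2) ->
    exists n A1 A2, [/\ (nmin <= n <= r)%N, (A1 + A2 <= s * r)%N &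
      good_scale f N p n (B1 + A1) (B2 + A2)].
  (* [s] improvements are left; with none left the potential would be too large *)
  elim: s r B1 B2 a b => [|s IH] r B1 B2 a b rE st hpsi.
    exfalso; have rp : (0 < r)%N by rewrite rE.
    have p01 : 0 < p <= 1 / 100 by rewrite p0 p1.
    have [/andP[a1 a2] /andP[b1 b2] _] := state_bounds p01 Mp L rp st.
    have M1000 : 1000 <= M.
      have : M * p <= M * (1 / 100) by rewrite ler_pM2l.
      by rewrite Mp; clear; lra.
    have e1 : a ^+ 2 <= 9 by rewrite expr2; clear -a1 a2 p1; nra.
    have e2 : M * (a + b) <= M * 5 by rewrite ler_pM2l //; clear -a2 b2 p1; lra.
    by clear -hpsi e1 e2 M1000; lra.
  have rho0 : (0 < K ^ s * r0)%N by rewrite muln_gt0 expn_gt0 K0.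
  have := hs _ rho0; set rho := (K ^ s * r0)%N; set lc := (c2 * rho)%N; set n := (c1 * lc)%N.
  move=> sc.
  have rE' : r = (c3 * n)%N by rewrite rE expnS /n /lc /rho /K; lia.
  rewrite rE' in st.
  have rr : (10 * (Q * n) <= r)%N.
    by rewrite rE'; apply: leq_trans (qn_r sc); rewrite leq_mul2r orbT.
  have rhor : (rho <= r)%N.
    by rewrite rE expnS -mulnA leq_pmull.
  have [[A1 [A2 [a' [b' [hA st' hg]]]]]|[A1 [A2 [hA hg]]]] := good_or_improvable sc L st.
    have hpsi' : 6 * M <= s%:R * gain + (M * (a' + b') + a' ^+ 2).
      move: hpsi hg; rewrite -addn1 natrD mulrDl mul1r -/gain; clear; lra.
    have [n' [C1 [C2 [hn hC hgood]]]] := IH rho _ _ _ _ erefl st' hpsi'.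
    exists n', (A1 + C1)%N, (A2 + C2)%N; split.
    - by clear -hn rhor; lia.
    - have : (s * rho <= s * r)%N by rewrite leq_mul2l rhor orbT.
      by rewrite mulSn; clear -hC hA rr; lia.
    - by rewrite !addnA.
  exists n, A1, A2; split=> //; last by rewrite mulSn; clear -hA rr; lia.
  have h1 : (rho <= n)%N.
    by apply: leq_trans (rho_lc sc) _; have := lc_n sc; rewrite -/lc -/n; clear; lia.
  have h2 : (n <= r)%N by have := qn_r sc; have := n_qn sc; rewrite -/n -rE'; clear; lia.
  have h3 : (nmin <= rho)%N.
    by rewrite /rho /r0 (leq_trans (leqnSn _)) // leq_pmull // expn_gt0 K0.
  by rewrite (leq_trans h3 h1).
pose r := (K ^ S * r0)%N.
have rN : (2 * r <= N)%N.
  by apply: leq_trans nN; rewrite -/r leq_mul2r; apply/orP; right; lia.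
have st0 : supported f N p M 0 0 r al be.
  split.
  - by move=> v1 v2 hv; apply: hf; clear -hv rN; lia.
  - move=> v1 v2 l hv rl lN; rewrite !add0n in lN *.
    have h1 := hf (v1 + l)%N v2 ltac:(clear -lN; lia).
    have h2 := hf v1 (v2 + l)%N ltac:(clear -lN; lia).
    have /andP[_ h3] := @branching_increments R f N p 0 0 v1 v2 L ltac:(clear -lN; lia).
    rewrite !add0n in h3; rewrite /spread.
    have rlR : r%:R <= 2 * l%:R :> R by rewrite -natrM ler_nat.
    have h4 : p * r%:R <= p * (2 * l%:R) by rewrite ler_pM2l.
    have h5 : p / 100 * (v1 + v2)%:R <= 1 / 100 * (v1 + v2)%:R.
      by rewrite ler_wpM2r //; clear -p1; lra.
    have h6 : (3 + 2 * p) * l%:R <= (al + be) * l%:R by rewrite ler_wpM2r.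
    have h7 : 0 <= (al) * v1%:R by rewrite mulr_ge0.
    have be0 : 0 <= be.
      have g1 := @hf 0%N r ltac:(clear -rN; lia).
      have g2 := @hf r 0%N ltac:(clear -rN; lia).
      have /andP[_ g3] := @branching_increments R f N p 0 0 r 0 L ltac:(clear -rN; lia).
      rewrite !add0n !addn0 mulr0 addr0 in g2 g3.
      have rp : 0 < r%:R :> R by rewrite ltr0n /r muln_gt0 expn_gt0 K0.
      have : al <= 2 + p / 100.
        by rewrite -(ler_pM2r rp); clear -g2 g3; lra.
      by clear -s0 p1 p0; lra.
    have h8 : 0 <= be * v2%:R by rewrite mulr_ge0.
    have h9 : 0 <= p * l%:R by rewrite mulr_ge0 // ltW.
    have h10 : 0 <= (v1 + v2)%:R :> R by [].
    move: h1 h2; rewrite !natrD => h1 h2; rewrite natrD in h3 h5 hv h10.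
    clear -h1 h2 h3 h4 h5 h6 h7 h8 h9 hv h10; lra.
  - split=> //; rewrite -[leLHS]addr0 lerD ?sqr_ge0 // ler_pM2l //.
  - by [].
have hpsi0 : 6 * M <= S%:R * gain + (M * (al + be) + al ^+ 2).
  apply: le_trans hS _; rewrite lerDl addr_ge0 ?sqr_ge0 // mulr_ge0 ?(ltW M0) //.
  by clear -s0 p0; lra.
have [n [B1 [B2 [/andP[hn1 hn2] hB hg]]]] := stages S r 0%N 0%N al be erefl st0 hpsi0.
rewrite !add0n in hg.
exists n, B1, B2; split=> //.
  rewrite hn1 /=; apply: leq_trans hn2 _; rewrite -/r leq_pmull //; lia.
by apply: leq_trans hB _; rewrite -/r leq_mul2r; apply/orP; right; lia.
Qed.

Local Open Scope nat_scope.

(** * The high-low inequality for lines and points of a grid *)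

Lemma Cauchy_Schwarz_sum (R : realDomainType) (T : finType) (a b : T -> R) :
  ((\sum_x a x * b x) ^+ 2 <= (\sum_x a x ^+ 2) * (\sum_x b x ^+ 2))%R.
Proof.
set AB := (\sum_x _)%R; set AA := (\sum_x a x ^+ 2)%R; set BB := (\sum_x _)%R.
have BB0 : (0 <= BB)%R by apply: sumr_ge0 => x _; exact: sqr_ge0.
have [BBpos|BBn] := ltrP 0%R BB; last first.
  have BBz : BB = 0%R by apply/le_anti/andP.
  have b0 x : b x = 0%R.
    have /psumr_eq0P := BBz => /(_ (fun x _ => sqr_ge0 (b x))) /(_ x isT) /eqP.
    by rewrite sqrf_eq0 => /eqP.
  by rewrite /AB big1 ?expr0n ?BBz ?mulr0 // => x _; rewrite b0 mulr0.
rewrite -subr_ge0 -(pmulr_rge0 _ BBpos).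
have -> : (BB * (AA * BB - AB ^+ 2) = \sum_x (BB * a x - AB * b x) ^+ 2)%R.
  transitivity (\sum_x (BB ^+ 2 * (a x ^+ 2) + (- (2 * AB * BB)) * (a x * b x)
      + AB ^+ 2 * (b x ^+ 2)))%R; last by apply: eq_bigr => x _; ring.
  by rewrite !big_split /= -!mulr_sumr -/AA -/BB -/AB; ring.
by apply: sumr_ge0 => x _; exact: sqr_ge0.
Qed.

Lemma card_diam (X k : nat) (A : pred 'I_X) :
  (forall x y, A x -> A y -> x <= y + k) -> #|A| <= k.+1.
Proof.
move=> h; have [x Ax|A0] := pickP A; last by rewrite eq_card0.
pose x0 := [arg min_(x' < x | A x') x' : nat].
have [Ax0 x0min] : A x0 /\ forall y, A y -> x0 <= y.
  by rewrite /x0; case: arg_minnP.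
rewrite -(card_ord k.+1).
have fP (y : 'I_X) : y - x0 < k.+1 \/ ~~ A y.
  case Ay : (A y); [left|by right].
  by rewrite ltnS leq_subLR addnC addnC; have := h y x0 Ay Ax0; lia.
pose f (y : 'I_X) : 'I_k.+1 := inord (y - x0).
rewrite -(card_in_image (f := f)); first exact: max_card.
move=> y z Ay Az /(congr1 val); rewrite /f /= !inordK; last first.
- by have := h y x0 Ay Ax0; lia.
- by have := h z x0 Az Ax0; lia.
by move=> e; apply: val_inj => /=; have := x0min _ Ay; have := x0min _ Az; lia.
Qed.

Lemma sum_window (Y v n : nat) (F : nat -> nat) : v + n <= Y ->
  \sum_(y < Y) (v <= y < v + n) * F y = \sum_(e < n) F (v + e).
Proof.
move=> h; rewrite -(big_mkord xpredT (fun y => (v <= y < v + n) * F y)).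
rewrite (@big_cat_nat _ _ _ v) //=; last by lia.
rewrite [X in X + _ = _]big_nat_cond big1 ?add0n; last first.
  by move=> y /andP[/andP[_ hy] _]; rewrite leqNgt hy.
rewrite (@big_cat_nat _ _ _ (v + n)) //=; last by lia.
rewrite [X in _ + X = _](_ : _ = 0) ?addn0; last first.
  rewrite big_nat_cond big1 // => y /andP[/andP[hy _] _].
  by rewrite [y < _]ltnNge hy andbF.
rewrite -{1}[v]addn0 addnC big_addn addKn -(big_mkord xpredT (fun e => F (v + e))).
rewrite [LHS]big_nat_cond [RHS]big_nat_cond; apply: eq_bigr => y /andP[/andP[_ hy] _].
by rewrite addnC leq_addr ltn_add2l hy mul1n.
Qed.

Definition hits (X th u v n : nat) := \sum_(x < X) (u + th * x <= v < u + th * x + n).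

Lemma hitsE X th u v n : hits X th u v n = #|[pred x : 'I_X | u + th * x <= v < u + th * x + n]|.
Proof.
rewrite /hits -sum1_card [RHS]big_mkcond; apply: eq_bigr => x _.
by rewrite inE; case: (_ && _).
Qed.

Lemma hits_le X th u v n : 0 < th -> hits X th u v n <= (n %/ th).+1.
Proof.
move=> th0; rewrite hitsE; apply: card_diam => x y /= /andP[h1 h2] /andP[h3 h4].
have h : th * x < th * y + n by lia.
have [xy|xy] := leqP x y; first by rewrite (leq_trans xy) ?leq_addr.
have e : th * (x - y) < n by rewrite mulnBr; lia.
have : x - y <= n %/ th by rewrite leq_divRL // mulnC ltnW.
by rewrite leq_subLR.
Qed.

Lemma hits_ge X th u v n : 0 < th -> u + n <= v -> v < u + th * X ->
  n %/ th <= hits X th u v n.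
Proof.
move=> th0 uv vX; set m := n %/ th.
have mn : m * th <= n by rewrite leq_divM.
pose x0 := (v - u) %/ th.
have x0lt : x0 < X by rewrite ltn_divLR // mulnC; lia.
have mx : m <= x0.
  by rewrite leq_divRL //; lia.
have lo : x0 * th <= v - u by rewrite leq_divM.
have hi : v - u < x0.+1 * th by rewrite ltn_ceil.
have fP (e : 'I_m) : x0 - e < X by lia.
pose f (e : 'I_m) : 'I_X := Ordinal (fP e).
rewrite hitsE -{1}(card_ord m) -(card_imset (f := f)) //; last first.
  by move=> e e' /(congr1 val) /= h; apply: val_inj => /=; have := ltn_ord e; have := ltn_ord e'; lia.
apply: subset_leq_card; apply/subsetP => _ /imsetP[e _ ->]; rewrite inE /=.
have em := ltn_ord e.
have h1 : th * (x0 - e) = th * x0 - th * e by rewrite mulnBr.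
have h2 : th * e <= th * x0 by rewrite leq_mul2l; lia.
have h3 : th * e + th <= th * m by rewrite addnC -mulnS leq_mul2l em orbT.
by rewrite h1; apply/andP; split; lia.
Qed.

Lemma hits_le_X X th u v n : hits X th u v n <= X.
Proof. by rewrite hitsE (leq_trans (max_card _)) ?card_ord. Qed.

Lemma hits_eq0 X th u v n :
  (forall x, x < X -> u + th * x <= v -> v < u + th * x + n -> False) ->
  hits X th u v n = 0.
Proof.
move=> h; rewrite /hits big1 // => x _.
by case: andP => // -[h1 h2]; case: (h x (ltn_ord x) h1 h2).
Qed.

Definition nat_near w x y := (x <= y + w) && (y <= x + w).

(** [b] and [b'] are the heights of two lines above the left end of a range of [X]
    abscissae, [th] the difference of their slopes.  Lines far apart at both ends
    either do not meet in the range, and all four counts vanish, or cross well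
    inside it, and then every count is [n %/ th] up to [1], whatever the vertical
    offsets [m * n] and [c * n]. *)
Lemma hits_pair X th b b' n c m e K :
  e < n -> m < c + K -> c < m + K ->
  ~~ nat_near (K * n) b b' -> ~~ nat_near (K * n) (b + th * X) b' ->
  hits X th (b + m * n) (b' + m * n + e) n + hits X th (b + c * n) (b' + c * n + e) n
  <= hits X th (b + m * n) (b' + c * n + e) n + hits X th (b + c * n) (b' + m * n + e) n + 2.
Proof.
move=> en mc cm; rewrite /nat_near !negb_and -!ltnNge => f1 f2.
have K0 : 0 < K by lia.
have Kn : n <= K * n by rewrite leq_pmull.
have mcn : m * n + n <= c * n + K * n by rewrite -mulnDl -mulSnr leq_mul2r mc orbT.
have cmn : c * n + n <= m * n + K * n by rewrite -mulnDl -mulSnr leq_mul2r cm orbT.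
have [b1|b1] := ltnP (b' + K * n) b.
  by rewrite !hits_eq0 // => x _; lia.
have {}f1 : b + K * n < b' by move: f1; rewrite ltnNge b1.
have [b2|b2] := ltnP (b' + K * n) (b + th * X); last first.
  have {}f2 : b + th * X + K * n < b' by move: f2; rewrite ltnNge b2.
  have thx x : x < X -> th * x <= th * X by move=> xX; rewrite leq_mul2l ltnW ?orbT.
  by rewrite !hits_eq0 // => x /thx; lia.
have th0 : 0 < th by case: (th) b2 => // ; rewrite mul0n; lia.
have u1 := @hits_le X th (b + m * n) (b' + m * n + e) n th0.
have u2 := @hits_le X th (b + c * n) (b' + c * n + e) n th0.
have l1 := @hits_ge X th (b + m * n) (b' + c * n + e) n th0 ltac:(lia) ltac:(lia).
have l2 := @hits_ge X th (b + c * n) (b' + m * n + e) n th0 ltac:(lia) ltac:(lia).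
set q := n %/ th in u1 u2 l1 l2; lia.
Qed.

Lemma PoszE k : Posz k = (k%:R)%R.
Proof. by rewrite -natz. Qed.

Section HighLow.
Variables (I : finType) (A B S : I -> nat) (q g t : nat).
Let n := q * g * t.
Let Z := 2 * q * t.

Definition height i p := B i + S i * (p - A i).

Lemma heightD i p x : A i <= p -> height i (p + x) = height i p + S i * x.
Proof.
move=> h; rewrite /height (_ : p + x - A i = (p - A i) + x); last by lia.
by rewrite mulnDr addnA.
Qed.

Definition strip tau m i p y :=
  (A i + tau <= p) && (height i p + m * n <= y < height i p + m * n + n).

Variable Y : nat.

Definition meet tau m m' i i' :=
  \sum_(p < Z) \sum_(y < Y) strip tau m i p y * strip tau m' i' p y.

Lemma meetC tau m m' i i' : meet tau m m' i i' = meet tau m' m i' i.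
Proof. by apply: eq_bigr => p _; apply: eq_bigr => y _; rewrite mulnC. Qed.

(** Above an abscissa two strips overlap when the difference of the heights, an
    arithmetic progression, falls into a window. *)
Lemma meetE tau m m' i i' :
  S i' <= S i ->
  (forall p, p < Z -> height i' p + m' * n + n <= Y) ->
  let p0 := maxn (A i) (A i') + tau in
  meet tau m m' i i' = \sum_(e < n)
    hits (Z - p0) (S i - S i') (height i p0 + m * n) (height i' p0 + m' * n + e) n.
Proof.
move=> SS hY p0.
have [pZ|Zp] := leqP p0 Z; last first.
  rewrite [RHS]big1 => [|e _]; last by rewrite (_ : Z - p0 = 0) ?/hits ?big_ord0 //; lia.
  rewrite /meet big1 // => p _; rewrite big1 // => y _; rewrite /strip.
  by have := ltn_ord p; case: leqP => // h1; case: leqP => // h2; lia.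
pose F p := \sum_(y < Y) (height i p + m * n <= y < height i p + m * n + n) *
   (height i' p + m' * n <= y < height i' p + m' * n + n).
rewrite /meet (eq_bigr (fun p : 'I_Z => (p0 <= p < p0 + (Z - p0)) * F p)); last first.
  move=> p _; rewrite subnKC // ltn_ord andbT /F /strip.
  rewrite big_distrr /=; apply: eq_bigr => y _.
  rewrite /p0 addn_maxl geq_max.
  by do 2 case: (_ <= p) => //=; rewrite ?mul0n ?muln0 ?mul1n.
rewrite (sum_window F); last by rewrite subnKC.
rewrite /hits [RHS]exchange_big /=; apply: eq_bigr => x _.
have xZ : p0 + x < Z by have := ltn_ord x; lia.
have Ap : A i <= p0 by rewrite /p0; lia.
have Ap' : A i' <= p0 by rewrite /p0; lia.
pose G y : nat := height i (p0 + x) + m * n <= y < height i (p0 + x) + m * n + n.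
transitivity (\sum_(y < Y)
    (height i' (p0 + x) + m' * n <= y < height i' (p0 + x) + m' * n + n) * G y).
  by apply: eq_bigr => y _; rewrite mulnC.
rewrite (sum_window G (hY _ xZ)) /G.
apply: eq_bigr => e _; rewrite (heightD x Ap) (heightD x Ap').
have -> : S i * x = S i' * x + (S i - S i') * x by rewrite -mulnDl subnKC.
by congr (nat_of_bool (_ && _)); lia.
Qed.

Hypotheses (q_gt0 : 0 < q) (g_gt0 : 0 < g) (t_gt0 : 0 < t).

Definition cell_dist i i' := (S i - S i' + (S i' - S i)) %/ g.
(** Up to the factor [n], the area in which the strips of two lines can overlap
    when their slopes differ by [e] cells of size [g]. *)
Definition weight e := (2 * Z) %/ e.+1.

Lemma cell_distC i i' : cell_dist i i' = cell_dist i' i.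
Proof. by rewrite /cell_dist addnC. Qed.

Lemma hits_weight X i i' u v : S i' <= S i -> S i < g * t -> X <= Z ->
  hits X (S i - S i') u v n <= weight (cell_dist i i').
Proof.
move=> SS St XZ; rewrite /weight /cell_dist.
rewrite (_ : S i' - S i = 0) ?addn0; last by lia.
set th := S i - S i'; set d := th %/ g.
rewrite leq_divRL // mulnC.
have dt : d < t by rewrite /d ltn_divLR // mulnC; lia.
have [d0|d0] := posnP d.
  by rewrite d0 mul1n (leq_trans (hits_le_X _ _ _ _ _)) //; lia.
have dg : d * g <= th by rewrite leq_divM.
have th0 : 0 < th by apply: leq_trans dg; rewrite muln_gt0 d0.
apply: (@leq_trans (d.+1 * (n %/ th).+1)); first by rewrite leq_mul2l hits_le ?orbT.
set k := n %/ th.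
have kth : k * th <= n by rewrite leq_divM.
have kd : k * d <= q * t.
  rewrite -(leq_pmul2r g_gt0) -mulnA (leq_trans _ (_ : k * th <= _)) ?leq_mul2l ?dg ?orbT //.
  by rewrite (leq_trans kth) // /n; lia.
have k1 : k <= q * t by apply: leq_trans kd; rewrite leq_pmulr.
have tq : t <= q * t by rewrite leq_pmull.
rewrite /Z; move: kd k1 tq dt; rewrite -mulnA; set x := q * t.
by move=> ????; rewrite mulSn mulnS; lia.
Qed.

Lemma nat_near_addl w x y z : nat_near w (z + x) (z + y) = nat_near w x y.
Proof. by rewrite /nat_near -!addnA !leq_add2l. Qed.

Lemma meet_self_le tau m i i' : S i' <= S i -> S i < g * t ->
  (forall p, p < Z -> height i' p + m * n + n <= Y) ->
  meet tau m m i i' <= n * weight (cell_dist i i').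
Proof.
move=> SS St hY; rewrite meetE //.
apply: (@leq_trans (\sum_(e < n) weight (cell_dist i i'))).
  by apply: leq_sum => e _; apply: hits_weight => //; rewrite leq_subr.
by rewrite sum_nat_const card_ord.
Qed.

Lemma meet_eq0 tau m m' i i' : Z < maxn (A i) (A i') + tau -> meet tau m m' i i' = 0.
Proof.
move=> h; rewrite /meet big1 // => p _; rewrite big1 // => y _; rewrite /strip.
by have := ltn_ord p; case: leqP => // h1; case: leqP => // h2; lia.
Qed.

(** Pairs of lines that are close at an end of their common range, where the
    cancellation of [hits_pair] fails. *)
Let badpair K tau i i' :=
  ((maxn (A i) (A i') + tau <= Z) &&
    nat_near (K * n) (height i (maxn (A i) (A i') + tau)) (height i' (maxn (A i) (A i') + tau)))
  + nat_near (K * n) (height i Z) (height i' Z).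

(** The left side minus the two mixed terms is the pairing of the differences of
    the indicators of strips at offsets [m] and [c].  It is bounded by [2 * n]
    unless the pair is bad: this cancellation is the gain of the high frequency
    part. *)
Lemma meet_pair tau m c K i i' :
  m < c + K -> c < m + K -> S i < g * t -> S i' < g * t ->
  A i <= Z -> A i' <= Z ->
  (forall j p, p < Z -> (j == i) || (j == i') ->
     height j p + m * n + n <= Y /\ height j p + c * n + n <= Y) ->
  meet tau m m i i' + meet tau c c i i' <=
  meet tau m c i i' + meet tau c m i i' + 2 * n
   + badpair K tau i i' * (2 * n * weight (cell_dist i i')).
Proof.
wlog SS : i i' / S i' <= S i.
  move=> H; have [h|h] := leqP (S i') (S i); first exact: H.
  move=> mc cm Si Si' Ai Ai' hY.
  have := H i' i (ltnW h) mc cm Si' Si Ai' Ai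
    (fun j p pZ hj => hY j p pZ ltac:(by rewrite orbC)).
  rewrite !(meetC tau _ _ i' i) (cell_distC i') [badpair K tau i' i](_ : _ = badpair K tau i i').
    by rewrite (addnC (meet tau c m i i')).
  by rewrite /badpair maxnC /nat_near ![in LHS](andbC (height i' _ <= _)).
move=> mc cm Si Si' Ai Ai' hY.
set p0 := maxn (A i) (A i') + tau.
have hm p : p < Z -> height i' p + m * n + n <= Y by move=> pZ; case: (hY i' p pZ) => //; rewrite eqxx orbT.
have hc p : p < Z -> height i' p + c * n + n <= Y by move=> pZ; case: (hY i' p pZ) => //; rewrite eqxx orbT.
have [pZ|pZ] := leqP p0 Z; last by rewrite !meet_eq0.
have [bad|good] := posnP (badpair K tau i i'); last first.
  have := meet_self_le tau SS Si hm; have := meet_self_le tau SS Si hc.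
  set w := weight _; move=> h1 h2.
  have : 1 * (2 * n * w) <= badpair K tau i i' * (2 * n * w) by rewrite leq_mul2r good orbT.
  by lia.
rewrite bad mul0n addn0.
move: bad; rewrite /badpair -/p0 pZ /= => /eqP; rewrite addn_eq0 !eqb0 => /andP[f1 f2].
have Ap : A i <= p0 by rewrite /p0; lia.
have Ap' : A i' <= p0 by rewrite /p0; lia.
have {}f2 : ~~ nat_near (K * n) (height i p0 + (S i - S i') * (Z - p0)) (height i' p0).
  have hZ j : A j <= p0 -> height j Z = height j p0 + S j * (Z - p0).
    by move=> /heightD <-; rewrite subnKC.
  move: f2; rewrite (hZ _ Ap) (hZ _ Ap').
  have -> : S i * (Z - p0) = S i' * (Z - p0) + (S i - S i') * (Z - p0).
    by rewrite -mulnDl subnKC.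
  by rewrite addnCA [height i' p0 + _]addnC nat_near_addl.
rewrite !meetE // -/p0 -!big_split /=.
have -> : 2 * n = \sum_(e < n) 2 by rewrite sum_nat_const card_ord mulnC.
rewrite -big_split /=; apply: leq_sum => e _.
by apply: (hits_pair (ltn_ord e) mc cm f1 f2).
Qed.

(** A harmonic sum, by dyadic blocks. *)
Lemma sum_weight a : \sum_(e < 2 ^ a) weight e <= 2 * Z * a.+1.
Proof.
elim: a => [|a IH]; first by rewrite big_ord1 /weight divn1 muln1.
rewrite expnS mul2n -addnn big_split_ord /= mulnS addnC leq_add //.
apply: (@leq_trans (\sum_(e < 2 ^ a) (2 * Z) %/ 2 ^ a)).
  by apply: leq_sum => e _; rewrite /weight leq_div2l ?expn_gt0 //; lia.
by rewrite sum_nat_const card_ord mulnC leq_divM.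
Qed.

Variables (L P : {set I}) (ML MP a : nat).
Hypothesis t2a : t = 2 ^ a.
Hypothesis hAL : forall i, i \in L -> A i < q * t.
Hypothesis hAP : forall i, i \in P -> A i < q * t.
Hypothesis hS : forall i, i \in L -> S i < g * t.
Hypothesis hML : forall p s y, p <= Z ->
  #|[set i in L | [&& A i <= p, s <= S i < s + g & y <= height i p < y + n]]| <= ML.
Hypothesis hMP : forall x y,
  #|[set j in P | (x <= A j < x + q) && (y <= B j < y + n)]| <= MP.

Let n_gt0 : 0 < n. Proof. by rewrite !muln_gt0 q_gt0 g_gt0. Qed.

Lemma near_window K h h0 : nat_near (K * n) h h0 ->
  exists k : 'I_(2 * K + 1), h0 - K * n + k * n <= h < h0 - K * n + k * n + n.
Proof.
rewrite /nat_near => /andP[h1 h2]; set y0 := h0 - K * n.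
have y0h : y0 <= h by rewrite /y0; lia.
have kb : (h - y0) %/ n < 2 * K + 1.
  rewrite ltn_divLR // (_ : (2 * K + 1) * n = K * n + K * n + n); last by rewrite mulnDl mul1n mul2n -addnn mulnDl.
  by have := n_gt0; rewrite /y0; clear -h1 h2; lia.
exists (Ordinal kb) => /=.
have := leq_divM (h - y0) n; have := ltn_ceil (h - y0) n_gt0.
rewrite mulSnr; set k := (h - y0) %/ n * n; lia.
Qed.

Lemma slope_window s s0 e : (s - s0 + (s0 - s)) %/ g = e ->
  exists b : bool, let c := if b then s0 + e * g else s0 + 1 - e.+1 * g in c <= s < c + g.
Proof.
move=> de; have h1 := leq_divM (s - s0 + (s0 - s)) g.
have h2 := ltn_ceil (s - s0 + (s0 - s)) g_gt0.
rewrite de mulSnr in h1 h2.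
exists (s0 <= s) => /=; case: (leqP s0 s) => h; first by lia.
by rewrite mulSnr; lia.
Qed.

Lemma near_count K p h0 s0 e : p <= Z ->
  \sum_(i in L) ((A i <= p) && nat_near (K * n) (height i p) h0 &&
      ((S i - s0 + (s0 - S i)) %/ g == e)) <= 2 * (2 * K + 1) * ML.
Proof.
move=> pZ.
pose c (b : bool) := if b then s0 + e * g else s0 + 1 - e.+1 * g.
pose y (k : nat) := h0 - K * n + k * n.
apply: (@leq_trans (\sum_(i in L) \sum_(k < 2 * K + 1) \sum_(b : bool)
    [&& A i <= p, c b <= S i < c b + g & y k <= height i p < y k + n])).
  apply: leq_sum => i _.
  case: andP => // -[/andP[hp /near_window[k hk]] /eqP /slope_window[b hb]].
  rewrite (bigD1 k) //= (bigD1 b) //=; rewrite hp hk.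
  by move: hb; rewrite -/(c b) => ->.
rewrite exchange_big /=.
apply: (@leq_trans (\sum_(k < 2 * K + 1) 2 * ML)); last first.
  by rewrite sum_nat_const card_ord; lia.
apply: leq_sum => k _; rewrite exchange_big /=.
apply: (@leq_trans (\sum_(b : bool) ML)); last by rewrite sum_nat_const card_bool.
apply: leq_sum => b _; apply: leq_trans (hML (c b) (y k) pZ).
rewrite -sum1_card [leqRHS](eq_bigl (fun i => (i \in L) &&
  [&& A i <= p, c b <= S i < c b + g & y k <= height i p < y k + n])).
  by rewrite -big_mkcondr /= leq_eqVlt; apply/orP; left; apply/eqP; rewrite big_mkcondr /=;
     apply: eq_bigr => i _; case: ifP.
by move=> i; rewrite inE.
Qed.

(** The lines that pass close to one point, sorted by the cell of their slope:
    [ML] bounds a cell and the weights sum to a logarithm. *)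
Lemma near_weight K p h0 s0 : p <= Z -> s0 < g * t ->
  \sum_(i in L) ((A i <= p) && nat_near (K * n) (height i p) h0)
       * weight ((S i - s0 + (s0 - S i)) %/ g)
   <= 2 * (2 * K + 1) * ML * (2 * Z * a.+1).
Proof.
move=> pZ s0t.
apply: (@leq_trans (\sum_(i in L) \sum_(e < t) ((A i <= p) && nat_near (K * n) (height i p) h0 &&
      ((S i - s0 + (s0 - S i)) %/ g == e)) * weight e)).
  apply: leq_sum => i iL; case: (_ && _) => //; rewrite mul1n.
  have dt : (S i - s0 + (s0 - S i)) %/ g < t.
    by rewrite ltn_divLR // mulnC; have := hS iL; lia.
  by rewrite (bigD1 (Ordinal dt)) //= eqxx mul1n leq_addr.
rewrite exchange_big /=.
apply: (@leq_trans (\sum_(e < t) 2 * (2 * K + 1) * ML * weight e)).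
  by apply: leq_sum => e _; rewrite -big_distrl leq_mul2r near_count ?orbT.
by rewrite -big_distrr leq_mul2l t2a sum_weight orbT.
Qed.

(** A bad pair is close at the start of the line that starts last, or at the right
    end [Z]; either way one of its members fixes the point that the other passes
    by. *)
Lemma badpair_weight K tau :
  \sum_(i in L) \sum_(i' in L) badpair K tau i i' * weight (cell_dist i i')
   <= #|L| * (3 * (2 * (2 * K + 1) * ML * (2 * Z * a.+1))).
Proof.
set W := 2 * (2 * K + 1) * ML * (2 * Z * a.+1).
pose early i i' := (A i' + tau <= Z) *
   (((A i <= A i' + tau) && nat_near (K * n) (height i (A i' + tau)) (height i' (A i' + tau)))
      * weight (cell_dist i i')).
have early_le i' : i' \in L -> \sum_(i in L) early i i' <= W.
  move=> hi'; rewrite -big_distrr /=; case: (leqP (_ + tau) Z) => /= h; rewrite ?mul0n ?mul1n //.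
  by apply: near_weight => //; exact: hS.
have AZ i : i \in L -> A i <= Z by move=> /hAL; rewrite /Z; lia.
apply: (@leq_trans (\sum_(i in L) \sum_(i' in L) (early i i' + (early i' i +
   ((A i <= Z) && nat_near (K * n) (height i Z) (height i' Z)) * weight (cell_dist i i'))))).
  apply: leq_sum => i iL; apply: leq_sum => i' i'L.
  rewrite /badpair mulnDl addnA; apply: leq_add; last by rewrite AZ.
  have [h|h] := leqP (A i') (A i).
    apply: leq_trans (leq_addl _ _).
    rewrite /early cell_distC (leq_trans h (leq_addr _ _)) /=.
    rewrite (_ : nat_near _ (height i' _) _ = nat_near (K * n) (height i (A i + tau)) (height i' (A i + tau))).
      by case: (_ <= Z); rewrite /= ?mul0n ?mul1n.
    by rewrite /nat_near andbC.
  apply: leq_trans (leq_addr _ _).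
  rewrite /early (leq_trans (ltnW h) (leq_addr _ _)) /=.
  by case: (_ <= Z); rewrite /= ?mul0n ?mul1n.
under eq_bigr => i _ do rewrite !big_split /=.
rewrite !big_split /= (_ : #|L| * (3 * W) = #|L| * W + (#|L| * W + #|L| * W)); last by lia.
have const_sum : #|L| * W = \sum_(i in L) W by rewrite sum_nat_const.
rewrite const_sum; apply: leq_add; last apply: leq_add.
- by rewrite exchange_big /=; apply: leq_sum => i' /early_le.
- by apply: leq_sum => i' /early_le.
rewrite exchange_big /=; apply: leq_sum => i' hi'.
by apply: near_weight => //; exact: hS.
Qed.

Variable K : nat.
Hypothesis hYL : forall i p m, i \in L -> p < Z -> m < 2 * K + 4 ->
  height i p + m * n + n <= Y.
Hypothesis hYP : forall j, j \in P -> B j + (K + 2) * n + n <= Y.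

(** The box at a point is lifted by [K + 2] strips, so that the strips at the
    offsets [m < 2 * K + 4] surround a line on both sides without negative
    offsets; [c := K + 2] is the central one. *)
Definition box j p y := (A j <= p < A j + q) && (B j + (K + 2) * n <= y < B j + (K + 2) * n + n).

Lemma box_area j : j \in P -> \sum_(p < Z) \sum_(y < Y) box j p y = q * n.
Proof.
move=> jP; have AZ : A j + q <= Z by have := hAP jP; rewrite /Z -mulnA mul2n -addnn;
  have : q <= q * t by [rewrite leq_pmulr]; lia.
transitivity (\sum_(p < Z) (A j <= p < A j + q) * n).
  apply: eq_bigr => p _.
  transitivity (\sum_(y < Y) (B j + (K + 2) * n <= y < B j + (K + 2) * n + n) * (A j <= p < A j + q)).
    by apply: eq_bigr => y _; rewrite /box mulnb andbC.
  rewrite (sum_window (fun _ => nat_of_bool (A j <= p < A j + q)) (hYP jP)).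
  by rewrite sum_nat_const card_ord mulnC.
by rewrite (sum_window (fun _ => n) AZ) sum_nat_const card_ord.
Qed.

Definition cross tau m := \sum_(i in L) \sum_(j in P)
  \sum_(p < Z) \sum_(y < Y) strip tau m i p y * box j p y.

Definition incidences w tau := \sum_(i in L) \sum_(j in P)
  ((A i + tau <= A j) && nat_near w (B j) (height i (A j))).

(** An incidence at width [K * n] puts the whole box of the point into the strips
    of the line, since the line rises by at most [n] above a box. *)
Lemma cross_lower : q * n * incidences (K * n) (2 * q) <= \sum_(m < 2 * K + 4) cross (2 * q) m.
Proof.
rewrite /cross [leqRHS]exchange_big /incidences big_distrr /=; apply: leq_sum => i iL.
rewrite [leqRHS]exchange_big big_distrr /=; apply: leq_sum => j jP.
case: andP => [[Aij nr]|_]; last by rewrite muln0.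
rewrite muln1 -(box_area jP) [leqRHS]exchange_big /=; apply: leq_sum => p _.
rewrite [leqRHS]exchange_big /=; apply: leq_sum => y _.
rewrite -big_distrl /=; case bx : (box j p y); rewrite ?muln1 //.
move: bx; rewrite /box => /andP[/andP[p1 p2] /andP[y1 y2]].
have Aip : A i <= A j by lia.
have hp : height i p = height i (A j) + S i * (p - A j).
  by rewrite -(heightD _ Aip) subnKC.
have Sp : S i * (p - A j) <= n.
  apply: (@leq_trans (g * t * q)); last by rewrite /n; lia.
  by apply: leq_mul; [have := hS iL; lia | lia].
move: nr; rewrite /nat_near => /andP[n1 n2].
rewrite mulnDl mul2n -addnn in y1 y2.
have kn : (2 * K + 4) * n = K * n + K * n + n + n + n + n.
  by rewrite mulnDl mul2n -addnn mulnDl !mulSn mul0n addn0 !addnA.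
have low : height i p <= y by rewrite hp; lia.
have mb : (y - height i p) %/ n < 2 * K + 4.
  rewrite ltn_divLR // kn hp; have := n_gt0; move: n1 y2 Sp.
  by clear; move: (K * n) (S i * _) (height _ _) => x1 x2 x3; lia.
rewrite (bigD1 (Ordinal mb)) //= /strip.
have h1 := leq_divM (y - height i p) n; have h2 := ltn_ceil (y - height i p) n_gt0.
rewrite mulSnr in h2.
rewrite (_ : _ && _ = true) //; apply/andP; split; first by lia.
by move: h1 h2; set k := (_ %/ n * n); lia.
Qed.

(** The central strip meets the box only if the incidence holds at width
    [2 * n]; the later start [2 * q] pays for the width [q] of the box. *)
Lemma cross_center : cross (2 * q) (K + 2) <= q * n * incidences (2 * n) q.
Proof.
rewrite /cross /incidences big_distrr /=; apply: leq_sum => i iL.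
rewrite big_distrr /=; apply: leq_sum => j jP.
have [ok|nok] := boolP ((A i + q <= A j) && nat_near (2 * n) (B j) (height i (A j))).
  rewrite muln1 -(box_area jP); apply: leq_sum => p _; apply: leq_sum => y _.
  by case: (strip _ _ _ _ _); rewrite ?mul1n ?mul0n.
rewrite muln0 leqn0; apply/eqP; rewrite big1 // => p _; rewrite big1 // => y _.
apply/eqP; rewrite muln_eq0 !eqb0 -negb_and; apply: contra nok.
rewrite /strip /box => /andP[/andP[h1 /andP[h2 h3]] /andP[/andP[p1 p2] /andP[y1 y2]]].
have Aij : A i + q <= A j by lia.
have Aip : A i <= A j by lia.
have hp : height i p = height i (A j) + S i * (p - A j).
  by rewrite -(heightD _ Aip) subnKC.
have Sp : S i * (p - A j) <= n.
  apply: (@leq_trans (g * t * q)); last by rewrite /n; lia.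
  by apply: leq_mul; [have := hS iL; lia | lia].
rewrite Aij /nat_near /= mul2n -addnn.
move: h2 h3 y1 y2 Sp; rewrite hp; clear.
by move: ((K + 2) * n) (S i * _) (height _ _) => x1 x2 x3 *; apply/andP; split; lia.
Qed.

(** The corners of the boxes that meet a given one lie in four windows of the size
    of a box. *)
Lemma box_energy :
  \sum_(p < Z) \sum_(y < Y) (\sum_(j in P) box j p y) ^ 2 <= #|P| * (4 * MP) * (q * n).
Proof.
apply: (@leq_trans (\sum_(j in P) \sum_(j' in P) q * n *
   ((A j < A j' + q) && (A j' < A j + q) && ((B j < B j' + n) && (B j' < B j + n))))).
  have -> : \sum_(p < Z) \sum_(y < Y) (\sum_(j in P) box j p y) ^ 2 =
     \sum_(j in P) \sum_(j' in P) \sum_(p < Z) \sum_(y < Y) box j p y * box j' p y.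
    transitivity (\sum_(p < Z) \sum_(j in P) \sum_(j' in P) \sum_(y < Y) box j p y * box j' p y).
      apply: eq_bigr => p _.
      transitivity (\sum_(y < Y) \sum_(j in P) \sum_(j' in P) box j p y * box j' p y).
        by apply: eq_bigr => y _; rewrite -mulnn big_distrlr.
      by rewrite exchange_big /=; apply: eq_bigr => j _; rewrite exchange_big.
    by rewrite exchange_big /=; apply: eq_bigr => j _; rewrite exchange_big.
  apply: leq_sum => j jP; apply: leq_sum => j' j'P.
  case: (boolP (_ && _)) => [_|nok].
    rewrite muln1 -(box_area jP); apply: leq_sum => p _; apply: leq_sum => y _.
    by case: (box j' p y); rewrite ?muln1 ?muln0.
  rewrite muln0 leqn0; apply/eqP; rewrite big1 // => p _; rewrite big1 // => y _.
  apply/eqP; rewrite muln_eq0 !eqb0 -negb_and; apply: contra nok.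
  by rewrite /box => /andP[/andP[/andP[? ?] /andP[? ?]] /andP[/andP[? ?] /andP[? ?]]];
    apply/andP; split; apply/andP; split; lia.
under eq_bigr => j _ do rewrite -big_distrr /=.
rewrite -big_distrr /= mulnC leq_mul2r; apply/orP; right.
rewrite -sum_nat_const; apply: leq_sum => j jP.
pose cx (b : bool) := if b then A j else A j + 1 - q.
pose cy (b : bool) := if b then B j else B j + 1 - n.
apply: (@leq_trans (\sum_(j' in P) \sum_(b : bool) \sum_(b' : bool)
   ((cx b <= A j' < cx b + q) && (cy b' <= B j' < cy b' + n)))).
  apply: leq_sum => j' j'P; case: andP => // -[/andP[x1 x2] /andP[y1 y2]].
  rewrite (bigD1 (A j <= A j')) //= (bigD1 (B j <= B j')) //= (_ : _ && _ = true) //.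
  rewrite /cx /cy; case: (leqP (A j) (A j')) => h; case: (leqP (B j) (B j')) => h' /=;
    by apply/andP; split; apply/andP; split; move: q_gt0 n_gt0; lia.
rewrite exchange_big /=.
apply: (@leq_trans (\sum_(b : bool) \sum_(b' : bool) MP)); last first.
  by rewrite !sum_nat_const card_bool; lia.
apply: leq_sum => b _; rewrite exchange_big /=; apply: leq_sum => b' _.
apply: leq_trans (hMP (cx b) (cy b')).
rewrite -sum1_card big_mkcond [leqRHS]big_mkcond /=; apply: leq_sum => j' _.
by rewrite inE; case: (_ \in P) => //=; case: (_ && _).
Qed.

Local Notation c := (K + 2).
Let W := 2 * (2 * (K + 3) + 1) * ML * (2 * Z * a.+1).

(** Expanding the square gives one [meet_pair] for each pair of lines: every pair
    costs [2 * n] and the bad ones their weight in addition. *)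
Lemma strip_energy tau m : m < 2 * K + 4 ->
  (\sum_(p < Z) \sum_(y < Y)
     (\sum_(i in L) ((strip tau m i p y)%:Z - (strip tau c i p y)%:Z)) ^+ 2
   <= (2 * n * (#|L| * #|L| + #|L| * (3 * W)))%:Z)%R.
Proof.
move=> mK; set e := fun i p y => ((strip tau m i p y)%:Z - (strip tau c i p y)%:Z)%R.
have AZ i : i \in L -> A i <= Z by move=> /hAL; rewrite /Z; lia.
have -> : (\sum_(p < Z) \sum_(y < Y) (\sum_(i in L) e i p y) ^+ 2 =
    \sum_(i in L) \sum_(i' in L) \sum_(p < Z) \sum_(y < Y) e i p y * e i' p y)%R.
  transitivity ((\sum_(p < Z) \sum_(i in L) \sum_(i' in L) \sum_(y < Y) e i p y * e i' p y)%R).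
    apply: eq_bigr => p _.
    transitivity ((\sum_(y < Y) \sum_(i in L) \sum_(i' in L) e i p y * e i' p y)%R).
      by apply: eq_bigr => y _; rewrite expr2 big_distrlr.
    by rewrite exchange_big /=; apply: eq_bigr => i _; rewrite exchange_big.
  by rewrite exchange_big /=; apply: eq_bigr => i _; rewrite exchange_big.
have -> : 2 * n * (#|L| * #|L| + #|L| * (3 * W)) =
    \sum_(i in L) \sum_(i' in L) 2 * n + 2 * n * (#|L| * (3 * W)).
  by rewrite sum_nat_const sum_nat_const mulnDr; lia.
apply: (@le_trans _ _ (Posz (\sum_(i in L) \sum_(i' in L) 2 * n +
   2 * n * \sum_(i in L) \sum_(i' in L)
     badpair (K + 3) tau i i' * weight (cell_dist i i')))); last first.
  by rewrite lez_nat leq_add2l leq_mul2l badpair_weight orbT.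
rewrite big_distrr -big_split /= PoszE natr_sum; apply: ler_sum => i iL.
rewrite big_distrr -big_split /= natr_sum; apply: ler_sum => i' i'L.
have mp := @meet_pair tau m c (K + 3) i i' ltac:(lia) ltac:(lia) (hS iL) (hS i'L)
  (AZ _ iL) (AZ _ i'L).
have {}mp : meet tau m m i i' + meet tau c c i i' <=
  meet tau m c i i' + meet tau c m i i' + 2 * n
   + badpair (K + 3) tau i i' * (2 * n * weight (cell_dist i i')).
  apply: mp => j p pZ hj; have jL : j \in L by case/orP: hj => /eqP ->.
  by split; apply: hYL => //; lia.
have -> : (\sum_(p < Z) \sum_(y < Y) e i p y * e i' p y =
   (meet tau m m i i')%:Z + (meet tau c c i i')%:Z
    - (meet tau m c i i')%:Z - (meet tau c m i i')%:Z)%R.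
  rewrite /meet !PoszE !natr_sum -big_split /= -!sumrB; apply: eq_bigr => p _.
  rewrite !natr_sum -big_split /= -!sumrB; apply: eq_bigr => y _.
  by rewrite /e !natrM; ring.
rewrite mulnCA in mp.
by move: mp; set x1 := meet _ _ _ _ _; set x2 := meet _ _ _ _ _; set x3 := meet _ _ _ _ _;
   set x4 := meet _ _ _ _ _; set x5 := (2 * n * _); set x6 := 2 * n; clear; lia.
Qed.

Hypothesis LZ : #|L| <= Z.

(** Some strip at an offset [m] carries an average share of [cross].  Either the
    central strip carries a comparable share, which is the low frequency case, or
    the difference of the two is large, and Cauchy-Schwarz bounds it by the
    energies of the strips and of the boxes. *)
Lemma high_low_aux :
  incidences (K * n) (2 * q) <= 4 * (K + 2) * incidences (2 * n) q \/
  incidences (K * n) (2 * q) ^ 2 <=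
    (100 * 100) * (K + 3) ^ 3 * (#|L| * #|P| * ML * MP) * (t * a.+1).
Proof.
set J := incidences (K * n) (2 * q); set J2 := incidences (2 * n) q.
have [->|J0] := posnP J; first by left.
have [L0|[i0 i0L]] := set_0Vmem L.
  by move: J0; rewrite /J /incidences L0 big_set0.
have ML0 : 0 < ML.
  apply: leq_trans (hML (S i0) (height i0 Z) (leqnn Z)).
  rewrite card_gt0; apply/set0Pn; exists i0; rewrite inE i0L.
  by rewrite !leqnn /= -{1}[S i0]addn0 -{1}[height i0 Z]addn0 !ltn_add2l g_gt0 n_gt0 andbT;
     have := hAL i0L; rewrite /Z; lia.
have [small|big] := leqP J (4 * (K + 2) * J2); [by left|right].
have lo := cross_lower; have ce := cross_center.
rewrite -/J in lo; rewrite -/J2 in ce.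
have qn0 : 0 < q * n by rewrite muln_gt0 q_gt0.
have [m mK hm] : exists2 m, m < 2 * K + 4 & q * n * J <= (2 * K + 4) * cross (2 * q) m.
  have [[m hm]|no] := altP (@existsP _ (fun m : 'I_(2 * K + 4) => q * n * J <= (2 * K + 4) * cross (2 * q) m)).
    by exists m.
  exfalso; move: no; rewrite negb_exists => /forallP no.
  have : \sum_(m < 2 * K + 4) ((2 * K + 4) * cross (2 * q) m + 1) <= \sum_(m < 2 * K + 4) q * n * J.
    by apply: leq_sum => m _; have := no m; rewrite -ltnNge addn1.
  rewrite big_split /= -big_distrr /= !sum_nat_const card_ord muln1.
  have : (2 * K + 4) * (q * n * J) <= (2 * K + 4) * \sum_(m < 2 * K + 4) cross (2 * q) m.
    by rewrite leq_mul2l lo orbT.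
  by move=> h1 h2; have := leq_trans h2 h1; rewrite -[leqRHS]addn0 leq_add2l; lia.
pose ea (x : 'I_Z * 'I_Y) : int :=
  (\sum_(i in L) ((strip (2 * q) m i x.1 x.2)%:Z - (strip (2 * q) c i x.1 x.2)%:Z))%R.
pose eb (x : 'I_Z * 'I_Y) : int := Posz (\sum_(j in P) box j x.1 x.2).
have CS := Cauchy_Schwarz_sum ea eb.
have sumab : (\sum_x ea x * eb x = (cross (2 * q) m)%:Z - (cross (2 * q) c)%:Z)%R.
  have crossE k : ((cross (2 * q) k)%:Z = \sum_(x : 'I_Z * 'I_Y)
     (\sum_(i in L) (strip (2 * q) k i x.1 x.2)%:Z) * eb x)%R.
    rewrite -(pair_bigA _ (fun (p : 'I_Z) (y : 'I_Y) => (\sum_(i in L) (strip (2 * q) k i p y)%:Z)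
       * (Posz (\sum_(j in P) box j p y)))%R) /=.
    rewrite -[RHS](_ : Posz (\sum_(p < Z) \sum_(y < Y)
       (\sum_(i in L) strip (2 * q) k i p y) * (\sum_(j in P) box j p y)) = _); last first.
      rewrite PoszE natr_sum; apply: eq_bigr => p _; rewrite natr_sum; apply: eq_bigr => y _.
      rewrite natrM -!PoszE; congr (_ * _)%R; rewrite PoszE natr_sum.
      by apply: eq_bigr => i _; rewrite PoszE.
    congr Posz; rewrite /cross.
    transitivity (\sum_(p < Z) \sum_(i in L) \sum_(j in P) \sum_(y < Y) strip (2 * q) k i p y * box j p y).
      rewrite [RHS]exchange_big /=; apply: eq_bigr => i _; rewrite exchange_big //=.
    apply: eq_bigr => p _.
    transitivity (\sum_(y < Y) \sum_(i in L) \sum_(j in P) strip (2 * q) k i p y * box j p y).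
      rewrite [RHS]exchange_big /=; apply: eq_bigr => i _; rewrite exchange_big //=.
    by apply: eq_bigr => y _; rewrite big_distrlr.
  rewrite !crossE -sumrB; apply: eq_bigr => x _; rewrite -mulrBl; congr (_ * _)%R.
  by rewrite /ea sumrB.
have EA : (\sum_x ea x ^+ 2 <= (2 * n * (#|L| * #|L| + #|L| * (3 * W)))%:Z)%R.
  apply: le_trans (strip_energy (2 * q) mK).
  by rewrite (pair_bigA _ (fun (p : 'I_Z) (y : 'I_Y) =>
     (\sum_(i in L) ((strip (2 * q) m i p y)%:Z - (strip (2 * q) c i p y)%:Z)) ^+ 2)%R).
have EB : (\sum_x eb x ^+ 2 <= (#|P| * (4 * MP) * (q * n))%:Z)%R.
  apply: (@le_trans _ _ (Posz (\sum_(p < Z) \sum_(y < Y) (\sum_(j in P) box j p y) ^ 2)));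
    last by rewrite lez_nat box_energy.
  rewrite PoszE natr_sum.
  rewrite -(pair_bigA _ (fun (p : 'I_Z) (y : 'I_Y) => (Posz (\sum_(j in P) box j p y)) ^+ 2)%R) /=.
  apply: ler_sum => p _; rewrite natr_sum; apply: ler_sum => y _.
  by rewrite natrX -PoszE.
have EAB : ((\sum_x ea x ^+ 2) * (\sum_x eb x ^+ 2) <=
   (2 * n * (#|L| * #|L| + #|L| * (3 * W)))%:Z * (#|P| * (4 * MP) * (q * n))%:Z)%R.
  by apply: ler_pM => //; apply: sumr_ge0 => x _; exact: sqr_ge0.
have {CS EAB} CS := le_trans CS EAB; rewrite sumab in CS.
have hD : q * n * J + 2 * (2 * K + 4) * cross (2 * q) c <= 2 * (2 * K + 4) * cross (2 * q) m.
  have h1 : 2 * (2 * K + 4) * cross (2 * q) c <= q * n * (4 * (K + 2) * J2).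
    rewrite (_ : 2 * (2 * K + 4) = 4 * (K + 2)); last by clear; lia.
    by rewrite mulnCA leq_mul2l ce orbT.
  have h2 : q * n * (4 * (K + 2) * J2) <= q * n * J by rewrite leq_mul2l ltnW ?orbT.
  by move: hm h1 h2; rewrite -!mulnA; clear; lia.
have ca : cross (2 * q) c <= cross (2 * q) m.
  have : 2 * (2 * K + 4) * cross (2 * q) c <= 2 * (2 * K + 4) * cross (2 * q) m.
    by apply: leq_trans hD; rewrite leq_addl.
  by rewrite leq_pmul2l // muln_gt0 addn_gt0 orbT.
set D := cross (2 * q) m - cross (2 * q) c.
have hD' : q * n * J <= 2 * (2 * K + 4) * D by rewrite /D mulnBr; clear -hD; lia.
move: CS; rewrite (subzn ca) -/D -PoszM !PoszE -natrX ler_nat => CS.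
set l := #|L| in CS *; set pp := #|P| in CS *.
have LZ' : l <= Z := LZ.
have hX : l * l + l * (3 * W) <= 29 * (K + 3) * (l * ML * Z * a.+1).
  have h1 : l * l <= l * ML * Z * a.+1.
    rewrite -[l * ML * Z * _]mulnA -mulnA leq_mul2l; apply/orP; right.
    by apply: leq_trans LZ' _; rewrite mulnCA leq_pmulr // muln_gt0 ML0.
  have h2 : l * (3 * W) = 12 * (2 * K + 7) * (l * ML * Z * a.+1) by rewrite /W; clear; lia.
  rewrite h2; set x := l * ML * Z * a.+1 in h1 *.
  apply: (@leq_trans ((1 + 12 * (2 * K + 7)) * x)); first by rewrite mulnDl mul1n leq_add2r.
  by rewrite leq_mul2r; apply/orP; right; clear; lia.
have hsq : (q * n * J) ^ 2 <= (2 * (2 * K + 4)) ^ 2 * D ^ 2 by rewrite -expnMn leq_exp2r.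
have hfin : (q * n) ^ 2 * J ^ 2 <= (q * n) ^ 2 *
   (100 * 100 * (K + 3) ^ 3 * (l * pp * ML * MP) * (t * a.+1)).
  rewrite -expnMn; apply: leq_trans hsq _.
  apply: (@leq_trans ((2 * (2 * K + 4)) ^ 2 *
     (2 * n * (29 * (K + 3) * (l * ML * Z * a.+1)) * (pp * (4 * MP) * (q * n))))).
    by rewrite leq_mul2l; apply/orP; right; apply: leq_trans CS _; rewrite leq_mul2r leq_mul2l hX !orbT.
  set rest := l * pp * ML * MP * (t * a.+1).
  have -> : 2 * n * (29 * (K + 3) * (l * ML * Z * a.+1)) * (pp * (4 * MP) * (q * n))
      = 464 * (K + 3) * ((q * n) ^ 2 * rest).
    by rewrite /rest /Z expnMn -!mulnn; clear; move: n => n'; ring.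
  have -> : (q * n) ^ 2 * (100 * 100 * (K + 3) ^ 3 * (l * pp * ML * MP) * (t * a.+1))
     = 100 * 100 * (K + 3) ^ 3 * ((q * n) ^ 2 * rest).
    by rewrite /rest; set y := (q * n) ^ 2; set w := (K + 3) ^ 3; clear; move: y w => y w; lia.
  rewrite mulnA leq_mul2r; apply/orP; right.
  rewrite (_ : (2 * (2 * K + 4)) ^ 2 * (464 * (K + 3)) = 16 * 464 * ((K + 2) ^ 2 * (K + 3)));
    last by rewrite -!mulnn; clear; ring.
  apply: (@leq_trans (16 * 464 * (K + 3) ^ 3)); last first.
    by rewrite leq_mul2r; apply/orP; right; clear; lia.
  rewrite leq_mul2l [leqRHS]expnSr leq_mul2r leq_exp2r // leq_add2l.
  by rewrite orbT orbT.
by move: hfin; rewrite leq_pmul2l // expn_gt0 qn0.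
Qed.
End HighLow.

(** Passing from the scale [K * n] to the scale [n] costs a factor [4 * (K + 2)]
    in the number of incidences, unless this number is small in terms of the
    largest numbers [ML] of lines in a tube and [MP] of points in a box. *)
Theorem high_low (I : finType) (A B S : I -> nat) (q g t a K : nat)
    (L P : {set I}) (ML MP : nat) :
  let n := q * g * t in let Z := 2 * q * t in
  0 < q -> 0 < g -> t = 2 ^ a ->
  (forall i, i \in L -> A i < q * t) -> (forall i, i \in P -> A i < q * t) ->
  (forall i, i \in L -> S i < g * t) ->
  (forall p s y, p <= Z -> #|[set i in L | [&& A i <= p, s <= S i < s + g
     & y <= height A B S i p < y + n]]| <= ML) ->
  (forall x y, #|[set j in P | (x <= A j < x + q) && (y <= B j < y + n)]| <= MP) ->
  #|L| <= Z ->
  incidences A B S L P (K * n) (2 * q) <= 4 * (K + 2) * incidences A B S L P (2 * n) q \/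
  incidences A B S L P (K * n) (2 * q) ^ 2 <=
    (100 * 100) * (K + 3) ^ 3 * (#|L| * #|P| * ML * MP) * (t * a.+1).
Proof.
move=> n Z q0 g0 ta hAL hAP hS hML hMP LZ.
have t0 : 0 < t by rewrite ta expn_gt0.
have Bsum i : B i <= \sum_j B j by rewrite (bigD1 i) //= leq_addr.
(* any height that exceeds all strips and all boxes will do *)
pose Y := \sum_j B j + g * t * Z + (2 * K + 5) * n.
apply: (@high_low_aux I A B S q g t Y) => //; rewrite -/n -/Z.
- move=> i p m iL pZ mK; rewrite /height /Y.
  have h1 : S i * (p - A i) <= g * t * Z.
    by apply: leq_mul; [have := hS i iL; lia|lia].
  have h2 : m * n + n <= (2 * K + 5) * n by rewrite -mulSnr leq_mul2r; apply/orP; right; lia.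
  by have := Bsum i; clear -h1 h2; lia.
move=> j jP; have h2 : (K + 2) * n + n <= (2 * K + 5) * n.
  by rewrite -mulSnr leq_mul2r; apply/orP; right; clear; lia.
by have := Bsum j; rewrite /Y; clear -h2; lia.
Qed.

(** * Tiles of the phase space *)

Section Tiles.
Variables (I : finType) (A B S : I -> nat).

(** Each [i] is a point [(A i, B i)] with a slope [S i].  The height of its line
    at the left end of its column of width [u]; together with the column and the
    cell of the slope it describes the sheared box of the Frostman condition. *)
Definition intercept u i := B i - S i * (A i %% u).
Definition tile u w i := (A i %/ u, S i %/ w, intercept u i %/ (u * w)).

Definition tile_bound (Y : {set I}) u w T :=
  forall k, #|[set i in Y | tile u w i == k]| <= T.

(** The third window may depend on the column and on the slope, as the boxes are
    sheared. *)
Lemma card_cover (Y Y0 : {set I}) u w T lo1 c1 lo2 c2 (lo3 : nat -> nat -> nat) c3 :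
  tile_bound Y u w T -> Y0 \subset Y ->
  (forall i, i \in Y0 -> lo1 <= A i %/ u < lo1 + c1) ->
  (forall i, i \in Y0 -> lo2 <= S i %/ w < lo2 + c2) ->
  (forall i, i \in Y0 -> lo3 (A i %/ u) (S i %/ w) <= intercept u i %/ (u * w)
       < lo3 (A i %/ u) (S i %/ w) + c3) ->
  #|Y0| <= c1 * c2 * c3 * T.
Proof.
move=> hT sub h1 h2 h3.
pose k (x : 'I_c1) (y : 'I_c2) (z : 'I_c3) : nat * nat * nat :=
  (lo1 + x, lo2 + y, lo3 (lo1 + x) (lo2 + y) + z).
apply: (@leq_trans (\sum_(i in Y) \sum_(x < c1) \sum_(y < c2) \sum_(z < c3) (tile u w i == k x y z))).
  rewrite -sum1_card [leqRHS](big_setID Y0) /= (setIidPr sub).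
  apply: leq_trans (leq_addr _ _); apply: leq_sum => i iY.
  have /andP[a1 a2] := h1 i iY; have /andP[b1 b2] := h2 i iY; have /andP[d1 d2] := h3 i iY.
  have x0 : A i %/ u - lo1 < c1 by rewrite ltn_subLR.
  have y0 : S i %/ w - lo2 < c2 by rewrite ltn_subLR.
  have z0 : intercept u i %/ (u * w) - lo3 (A i %/ u) (S i %/ w) < c3 by rewrite ltn_subLR.
  rewrite (bigD1 (Ordinal x0)) //= (bigD1 (Ordinal y0)) //= (bigD1 (Ordinal z0)) //=.
  by rewrite /k /tile /= !subnKC // eqxx.
rewrite exchange_big /=.
apply: (@leq_trans (\sum_(x < c1) \sum_(y < c2) \sum_(z < c3) T)); last first.
  by rewrite !sum_nat_const !card_ord !mulnA.
apply: leq_sum => x _; rewrite exchange_big /=; apply: leq_sum => y _.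
rewrite exchange_big /=; apply: leq_sum => z _.
apply: leq_trans (hT (k x y z)); rewrite -sum1_card big_mkcond [leqRHS]big_mkcond /=.
by apply: leq_sum => i _; rewrite inE; case: (i \in Y).
Qed.

Lemma div_window s k u x : 0 < u -> s <= x < s + k * u -> s %/ u <= x %/ u < s %/ u + k.+1.
Proof.
move=> u0 /andP[h1 h2]; rewrite leq_div2r //= ltn_divLR //.
have := ltn_ceil s u0; rewrite mulnDl !mulSn; lia.
Qed.

Lemma div_eq_window x u k : 0 < u -> x %/ u = k -> k * u <= x < k * u + u.
Proof. by move=> u0 <-; rewrite leq_divM /= -mulSnr ltn_ceil. Qed.

Lemma div_eq_le x y u : 0 < u -> x %/ u = y %/ u -> x <= y + u.
Proof.
move=> u0 e; have := ltn_ceil x u0; have := leq_divM y u; rewrite e mulSn.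
by move: (y %/ u * u) => z; clear; lia.
Qed.

Lemma intercept_shift u q i : 0 < q -> q %| u -> S i * (A i %% u) <= B i ->
  intercept u i + S i * (A i %% u - A i %% q) = intercept q i.
Proof.
move=> q0 qu h; have le : A i %% q <= A i %% u by rewrite -(modn_dvdm _ qu) leq_mod.
have h2 : S i * (A i %% q) <= S i * (A i %% u) by rewrite leq_mul2l le orbT.
by rewrite /intercept mulnBr; lia.
Qed.

Lemma mod_sub u q a : 0 < q -> q %| u ->
  a %% u - a %% q = (a %/ q - (a %/ u) * (u %/ q)) * q.
Proof.
move=> q0 /dvdnP[t ->]; rewrite mulnK //.
have e1 := divn_eq a q; have e2 := divn_eq a (t * q).
rewrite mulnBl -mulnA.
move: e1 e2; set x := a %/ q * q; set y := a %/ (t * q) * (t * q).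
by move=> e1 e2; lia.
Qed.

Lemma mod_sub_le u q a : 0 < u -> a %% u - a %% q <= u.
Proof. by move=> u0; have := ltn_pmod a u0; lia. Qed.

Section Refine.
Variables (q g t : nat) (Y : {set I}).
Hypotheses (q0 : 0 < q) (g0 : 0 < g) (t0 : 0 < t).
Hypothesis hB : forall i, i \in Y -> S i * (A i %% (q * t)) <= B i.

Let U := q * t.
Let W := g * t.
Let U0 : 0 < U. Proof. by rewrite muln_gt0 q0. Qed.
Let W0 : 0 < W. Proof. by rewrite muln_gt0 g0. Qed.
Let qU : q %| U. Proof. exact: dvdn_mulr. Qed.
Let UW : U * W = q * W * t. Proof. by rewrite /U mulnAC. Qed.

Let shift i : i \in Y -> intercept U i + S i * (A i %% U - A i %% q) = intercept q i.
Proof. by move=> iY; apply: intercept_shift => //; apply: hB. Qed.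

(** Between the left ends of the columns of widths [q] and [U] that contain
    abscissae of the cell [x]. *)
Let gap x := (x - x %/ t * t) * q.
Let gapE i : A i %% U - A i %% q = gap (A i %/ q).
Proof. by rewrite (@mod_sub U q) // /gap /U mulKn // -divnMA. Qed.
Let gap_le i : gap (A i %/ q) <= U.
Proof. by rewrite -gapE mod_sub_le. Qed.

(** A column splits into [t] columns.  In each of them the slopes of one cell move
    the intercepts by at most [U * W], that is by [t] more tiles. *)
Lemma cover_left_fine T k : tile_bound Y q W T ->
  #|[set i in Y | tile U W i == k]| <= t * (2 * t + 1) * T.
Proof.
move=> hT; case: k => [[k1 k2] k3].
have inv i : i \in [set i in Y | tile U W i == (k1, k2, k3)] ->
    [/\ i \in Y, A i %/ U = k1, S i %/ W = k2 & intercept U i %/ (U * W) = k3].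
  by rewrite inE => /andP[iY /eqP[<- <- <-]].
apply: (@leq_trans (t * 1 * (2 * t + 1) * T)); last by rewrite muln1.
apply: (@card_cover Y _ q W T (k1 * t) t k2 1
   (fun x _ => (k3 * (U * W) + k2 * W * gap x) %/ (q * W)) (2 * t + 1)) => //.
- by apply/subsetP => i /inv[].
- move=> i /inv[_ <- _ _]; rewrite /U divnMA leq_divM /=.
  by rewrite -mulSnr ltn_ceil.
- by move=> i /inv[_ _ <- _]; rewrite addn1 leqnn ltnSn.
move=> i /inv[iY _ s2 l3]; rewrite addn1; apply: div_window; first by rewrite muln_gt0 q0.
have UW0 : 0 < U * W by rewrite muln_gt0 U0.
have /andP[l1 l2] := div_eq_window UW0 l3.
have /andP[s1 s3] := div_eq_window W0 s2.
have sh := shift iY; rewrite gapE in sh.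
have gl := gap_le i; set X := gap _ in sh gl *.
have m1 : k2 * W * X <= S i * X by rewrite leq_mul2r s1 orbT.
have m2 : S i * X <= (k2 * W + W) * X by rewrite leq_mul2r ltnW ?orbT.
have m3 : W * X <= U * W by rewrite mulnC leq_mul2r gl orbT.
have -> : 2 * t * (q * W) = U * W + U * W by rewrite UW -mulnA mul2n -addnn (mulnC t).
by rewrite mulnDl in m2; apply/andP; split; lia.
Qed.

(** The slope cell and the height window both split into [t] parts. *)
Lemma cover_right_fine T k : tile_bound Y U g T ->
  #|[set i in Y | tile U W i == k]| <= t * t * T.
Proof.
move=> hT; case: k => [[k1 k2] k3].
have inv i : i \in [set i in Y | tile U W i == (k1, k2, k3)] ->
    [/\ i \in Y, A i %/ U = k1, S i %/ W = k2 & intercept U i %/ (U * W) = k3].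
  by rewrite inE => /andP[iY /eqP[<- <- <-]].
apply: (@leq_trans (1 * t * t * T)); last by rewrite mul1n.
apply: (@card_cover Y _ U g T k1 1 (k2 * t) t (fun _ _ => k3 * t) t) => //.
- by apply/subsetP => i /inv[].
- by move=> i /inv[_ <- _ _]; rewrite addn1 leqnn ltnSn.
- by move=> i /inv[_ _ <- _]; rewrite /W divnMA leq_divM /= -mulSnr ltn_ceil.
move=> i /inv[_ _ _ <-].
by rewrite /W mulnA divnMA leq_divM /= -mulSnr ltn_ceil.
Qed.

(** Moving the reference abscissa to the wider column spreads a tile over
    boundedly many tiles. *)
Lemma cover_left_coarse T k : tile_bound Y U W T ->
  #|[set i in Y | tile q W i == k]| <= 4 * T.
Proof.
move=> hT; case: k => [[k1 k2] k3].
have inv i : i \in [set i in Y | tile q W i == (k1, k2, k3)] ->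
    [/\ i \in Y, A i %/ q = k1, S i %/ W = k2 & intercept q i %/ (q * W) = k3].
  by rewrite inE => /andP[iY /eqP[<- <- <-]].
apply: (@card_cover Y _ U W T (k1 %/ t) 1 k2 1
   (fun _ _ => (k3 * (q * W) - (k2 * W + W) * gap k1) %/ (U * W)) 4) => //.
- by apply/subsetP => i /inv[].
- by move=> i /inv[_ <- _ _]; rewrite -divnMA addn1 leqnn ltnSn.
- by move=> i /inv[_ _ <- _]; rewrite addn1 leqnn ltnSn.
move=> i /inv[iY e1 s2 l3].
have UW0 : 0 < U * W by rewrite muln_gt0 U0.
have qW0 : 0 < q * W by rewrite muln_gt0 q0.
have /andP[l1 l2] := div_eq_window qW0 l3.
have /andP[s1 s3] := div_eq_window W0 s2.
have sh := shift iY; rewrite gapE in sh.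
have gl := gap_le i; rewrite e1 in sh gl; set X := gap _ in sh gl *.
have m1 : k2 * W * X <= S i * X by rewrite leq_mul2r s1 orbT.
have m2 : S i * X <= (k2 * W + W) * X by rewrite leq_mul2r ltnW ?orbT.
have m3 : W * X <= U * W by rewrite mulnC leq_mul2r gl orbT.
have m4 : q * W <= U * W by rewrite leq_mul2r leq_pmulr ?orbT.
apply: div_window => //; rewrite mulnDl in m2 *.
have -> : 3 * (U * W) = U * W + U * W + U * W by rewrite !mulSn mul0n addn0 addnA.
move: sh l1 l2 m1 m2 m3 m4; move: (S i * X) (k2 * W * X) (W * X) (U * W) (q * W) (k3 * _).
by move: (intercept U i) (intercept q i) => y1 y2 x1 x2 x3 x4 x5 x6; clear; lia.
Qed.

Lemma cover_right_coarse T k : tile_bound Y U W T ->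
  #|[set i in Y | tile U g i == k]| <= T.
Proof.
move=> hT; case: k => [[k1 k2] k3].
apply: leq_trans (hT (k1, k2 %/ t, k3 %/ t)); apply: subset_leq_card.
apply/subsetP => i; rewrite !inE => /andP[-> /eqP[<- <- <-]].
by rewrite /tile /W mulnA -!divnMA eqxx.
Qed.

(** The members of a thin tube that lie in one short column: the tube has height
    [U * g], which is [t] times the height of a tile. *)
Lemma cover_line_piece T k c : tile_bound Y q g T ->
  #|[set i in Y | (tile U g i == k) && (A i %/ q == c)]| <= (2 * t + 1) * T.
Proof.
move=> hT; case: k => [[k1 k2] k3].
set Y0 := [set _ in _ | _].
have inv i : i \in Y0 ->
    [/\ i \in Y, A i %/ q = c, S i %/ g = k2 & intercept U i %/ (U * g) = k3].
  by rewrite inE => /andP[iY /andP[/eqP[_ <- <-] /eqP ->]].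
apply: (@leq_trans (1 * 1 * (2 * t + 1) * T)); last by rewrite !mul1n.
apply: (@card_cover Y _ q g T c 1 k2 1
   (fun x _ => (k3 * (U * g) + k2 * g * gap x) %/ (q * g)) (2 * t + 1)) => //.
- by apply/subsetP => i /inv[].
- by move=> i /inv[_ <- _ _]; rewrite addn1 leqnn ltnSn.
- by move=> i /inv[_ _ <- _]; rewrite addn1 leqnn ltnSn.
move=> i /inv[iY _ s2 l3]; rewrite addn1; apply: div_window; first by rewrite muln_gt0 q0.
have Ug0 : 0 < U * g by rewrite muln_gt0 U0.
have /andP[l1 l2] := div_eq_window Ug0 l3.
have /andP[s1 s3] := div_eq_window g0 s2.
have sh := shift iY; rewrite gapE in sh.
have gl := gap_le i; set X := gap _ in sh gl *.
have m1 : k2 * g * X <= S i * X by rewrite leq_mul2r s1 orbT.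
have m2 : S i * X <= (k2 * g + g) * X by rewrite leq_mul2r ltnW ?orbT.
have m3 : g * X <= U * g by rewrite mulnC leq_mul2r gl orbT.
have -> : 2 * t * (q * g) = U * g + U * g by rewrite -mulnA mul2n -addnn mulnA (mulnC t).
by rewrite mulnDl in m2; apply/andP; split; lia.
Qed.

Variables (a0 s0 : nat).
(** Subtracting the corner [a0 * U], the slope [s0 * W], and the line of that slope
    through the corner: a shear, which maps lines to lines. *)
Definition relA i := A i - a0 * U.
Definition relS i := S i - s0 * W.
Definition relB i := B i - s0 * W * relA i.

Lemma relE i : i \in Y -> A i %/ U = a0 -> S i %/ W = s0 ->
  [/\ A i = a0 * U + relA i, S i = s0 * W + relS i, relA i = A i %% U,
      relA i < U /\ relS i < W & relB i = intercept U i + relS i * relA i].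
Proof.
move=> iY ea es; have eA := divn_eq (A i) U; have eS := divn_eq (S i) W.
rewrite ea in eA; rewrite es in eS.
have rA : relA i = A i %% U by rewrite /relA eA addKn modnMDl modn_mod.
have rS : relS i = S i %% W by rewrite /relS eS addKn modnMDl modn_mod.
split=> //; rewrite ?rA ?rS ?ltn_pmod //.
have e : S i * (A i %% U) = s0 * W * (A i %% U) + S i %% W * (A i %% U).
  by rewrite {1}eS mulnDl.
have := hB iY; rewrite -/U /relB /intercept rA e.
by move: (s0 * W * _) (S i %% W * _) => b1 b2; clear; lia.
Qed.

(** An upright box in the relative coordinates: as relative slopes are below [W],
    shearing moves it by at most its height [q * W]. *)
Lemma cover_points T (P : {set I}) x y : tile_bound Y q W T ->
  P \subset Y -> (forall i, i \in P -> A i %/ U = a0 /\ S i %/ W = s0) ->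
  #|[set j in P | (x <= relA j < x + q) && (y <= relB j < y + q * W)]| <= 6 * T.
Proof.
move=> hT /subsetP PY hP; set Y0 := [set _ in _ | _].
have inv i : i \in Y0 -> [/\ i \in Y, A i %/ U = a0, S i %/ W = s0,
     x <= relA i < x + q & y <= relB i < y + q * W].
  by rewrite inE => /andP[iP /andP[h1 h2]]; have [] := hP _ iP; split=> //; apply: PY.
apply: (@leq_trans (2 * 1 * 3 * T)) => //.
apply: (@card_cover Y _ q W T ((a0 * U + x) %/ q) 2 s0 1
   (fun k _ => (y + s0 * W * gap k - q * W) %/ (q * W)) 3) => //.
- by apply/subsetP => i /inv[].
- move=> i /inv[iY ea es /andP[h1 h2] _]; have [eA _ _ _ _] := relE iY ea es.
  apply: div_window => //; rewrite mul1n; move: eA h1 h2; set r := relA i.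
  by move: (a0 * U) => z; clear; lia.
- by move=> i /inv[_ _ <- _ _]; rewrite addn1 leqnn ltnSn.
move=> i /inv[iY ea es _ /andP[h1 h2]].
have [eA eS rA [rAU rSW] eB] := relE iY ea es.
have sh := shift iY; rewrite gapE in sh.
apply: div_window; first by rewrite muln_gt0 q0.
have rg : relA i = gap (A i %/ q) + A i %% q.
  by rewrite -gapE rA subnK // -(modn_dvdm _ qU) leq_mod.
set X := gap _ in sh rg *.
have e1 : relB i + s0 * W * X = intercept q i + relS i * (A i %% q).
  by rewrite eB -sh eS rg !mulnDl !mulnDr; lia.
have m1 : relS i * (A i %% q) <= q * W.
  by rewrite mulnC leq_mul // ltnW // ltn_pmod.
rewrite mul2n -addnn; apply/andP; split; lia.
Qed.

(** A tube of lines, tested above any abscissa [p] of the doubled column: the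
    slopes of one cell spread the intercepts by at most [2 * U * g]. *)
Lemma cover_lines T (L : {set I}) p s y : tile_bound Y U g T ->
  L \subset Y -> (forall i, i \in L -> A i %/ U = a0 /\ S i %/ W = s0) -> p <= 2 * U ->
  #|[set i in L | [&& relA i <= p, s <= relS i < s + g
     & y <= height relA relB relS i p < y + U * g]]| <= 8 * T.
Proof.
move=> hT /subsetP LY hL pU; set Y0 := [set _ in _ | _].
have inv i : i \in Y0 -> [/\ i \in Y, A i %/ U = a0, S i %/ W = s0,
     s <= relS i < s + g & (relA i <= p) && (y <= height relA relB relS i p < y + U * g)].
  rewrite inE => /andP[iL /andP[h1 /andP[h2 h3]]].
  by have [] := hL _ iL; rewrite h1 h2; split=> //; apply: LY.
apply: (@leq_trans (1 * 2 * 4 * T)) => //.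
apply: (@card_cover Y _ U g T a0 1 ((s0 * W + s) %/ g) 2
   (fun _ _ => (y - s * p - g * p) %/ (U * g)) 4) => //.
- by apply/subsetP => i /inv[].
- by move=> i /inv[iY <- _ _ _]; rewrite addn1 leqnn ltnSn.
- move=> i /inv[iY ea es /andP[h1 h2] _]; have [_ eS _ _ _] := relE iY ea es.
  apply: div_window => //; rewrite mul1n; move: eS h1 h2; set r := relS i.
  by move: (s0 * W) => z; clear; lia.
move=> i /inv[iY ea es /andP[h1 h2] /andP[Ap /andP[h3 h4]]].
have [_ _ _ _ eB] := relE iY ea es.
have e1 : height relA relB relS i p = intercept U i + relS i * p.
  by rewrite /height eB -addnA -mulnDr subnKC.
rewrite e1 in h3 h4.
have m1 : s * p <= relS i * p by rewrite leq_mul2r h1 orbT.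
have m2 : relS i * p <= s * p + g * p by rewrite -mulnDl leq_mul2r ltnW ?orbT.
have m3 : g * p <= U * g + U * g.
  by rewrite -mulnDl mulnC leq_mul2r addnn -mul2n pU orbT.
apply: div_window; first by rewrite muln_gt0 U0.
by rewrite !mulSn mul0n addn0; apply/andP; split; lia.
Qed.
End Refine.
End Tiles.

(** * Uniform subsets and the first incidences *)

(** Inside the most popular colour vector, [Y] minimises the number of discarded
    members plus, with a small weight, the total size of the classes that it
    meets.  Discarding the part of [Y] in one class would save the size of this
    class, so minimality bounds that part from below, for all partitions at
    once. *)
Lemma uniform_subset (I G : finType) (T : eqType) (key : G -> I -> T) (C : nat)
    (col : G -> I -> 'I_C) :
  0 < #|I| -> 0 < #|G| -> let D := C ^ #|G| in
  exists (c : {ffun G -> 'I_C}) (Y : {set I}),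
  [/\ forall i g, i \in Y -> col g i = c g, #|I| <= 2 * D * #|Y| &
    forall g i, i \in Y -> #|[set j | key g j == key g i]|
       <= 2 * #|G| * D * #|[set j in Y | key g j == key g i]|].
Proof.
move=> /card_gt0P[i0 _] G0 D.
pose colv i : {ffun G -> 'I_C} := [ffun g => col g i].
have cardD : #|{: {ffun G -> 'I_C}}| = D by rewrite card_ffun card_ord.
have [c hc] : exists c, #|I| <= D * #|[set i | colv i == c]|.
  have [[c hc]|no] := altP (@existsP _ (fun c => #|I| <= D * #|[set i | colv i == c]|)).
    by exists c.
  exfalso; move: no; rewrite negb_exists => /forallP no.
  have : \sum_(c : {ffun G -> 'I_C}) (D * #|[set i | colv i == c]| + 1)
      <= \sum_(c : {ffun G -> 'I_C}) #|I|.
    by apply: leq_sum => c _; have := no c; rewrite -ltnNge addn1.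
  rewrite big_split /= -big_distrr /= !sum_nat_const cardD muln1.
  have -> : \sum_(c : {ffun G -> 'I_C}) #|[set i | colv i == c]| = #|I|.
    rewrite -sum1_card (partition_big colv xpredT) //=; apply: eq_bigr => c _.
    by rewrite -sum1_card; apply: eq_bigl => i; rewrite inE.
  have D0 : 0 < D by rewrite -cardD; apply/card_gt0P; exists (colv i0).
  by rewrite -[leqRHS]addn0 leq_add2l; lia.
set X1 := [set i | colv i == c] in hc.
pose sat g (Y : {set I}) := [set j | [exists i in Y, key g j == key g i]].
pose phi (Y : {set I}) := 2 * #|G| * D * (#|X1| - #|Y|) + \sum_g #|sat g Y|.
have [Y YX1 Ymin] := @arg_minnP _ X1 (fun Y => Y \subset X1) phi (subxx X1).
exists c, Y; split.
- move=> i g /(subsetP YX1); rewrite inE => /eqP <-.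
  by rewrite ffunE.
- have := Ymin X1 (subxx X1); rewrite /phi subnn muln0 add0n => h.
  have h2 : \sum_g #|sat g X1| <= #|G| * #|I|.
    by rewrite -sum_nat_const; apply: leq_sum => g _; apply: max_card.
  have h3 : #|G| * (2 * D * (#|X1| - #|Y|)) <= #|G| * (D * #|X1|).
    apply: (@leq_trans (#|G| * #|I|)); last by rewrite leq_mul2l hc orbT.
    apply: leq_trans h2; apply: leq_trans h; apply: leq_trans (leq_addr _ _).
    by rewrite !mulnA (mulnC #|G|).
  rewrite leq_pmul2l // in h3; have := subset_leq_card YX1.
  move: hc h3; rewrite mulnBr -!mulnA; set x := D * _; set y := D * _ => hc h3 xy.
  by clear -hc h3; lia.
move=> g i iY; set Ti := [set j | key g j == key g i].
set a := #|[set j in Y | _]|.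
pose Y' := Y :\: Ti.
have YTi : a = #|Y :&: Ti| by congr #|pred_of_set _|; apply/setP => j; rewrite !inE.
have cY : #|Y| = a + #|Y'| by rewrite YTi cardsID.
have Y'X1 : Y' \subset X1 by apply: subset_trans YX1; rewrite subsetDl.
have := Ymin Y' Y'X1; rewrite /phi (bigD1 g) //= [X in _ <= _ + X](bigD1 g) //=.
have s1 : \sum_(h | h != g) #|sat h Y'| <= \sum_(h | h != g) #|sat h Y|.
  apply: leq_sum => h _; apply: subset_leq_card; apply/subsetP => j; rewrite !inE.
  by case/existsP => k /andP[kY' e]; apply/existsP; exists k; move: kY'; rewrite inE => /andP[_ ->].
have s2 : #|sat g Y'| + #|Ti| <= #|sat g Y|.
  have sTi : Ti \subset sat g Y.
    by apply/subsetP => j; rewrite !inE => e; apply/existsP; exists i; rewrite iY.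
  rewrite -(cardsID Ti (sat g Y)) (setIidPr sTi) addnC leq_add2l.
  apply: subset_leq_card; apply/subsetP => j; rewrite !inE.
  case/existsP => k /andP[]; rewrite !inE => /andP[nk kY] /eqP e.
  by rewrite e nk /=; apply/existsP; exists k; rewrite kY eqxx.
have cX := subset_leq_card YX1.
have -> : #|X1| - #|Y'| = (#|X1| - #|Y|) + a by lia.
rewrite mulnDr; set z := 2 * _ * _ * (_ - _); set w := _ * a.
by clear -s1 s2; lia.
Qed.

(** A member [i] of the tile [L] joins every earlier member [j] of its thin tube to
    every member [k] of its small box: the ray of [j] follows the line of [i] and
    so passes close to [k].  A pair of [j] and [k] arises only from members [i] of
    one tube in one short column, hence at most [(2 * t + 1) * T] times. *)
Lemma initial_incidences (I : finType) (A B S : I -> nat) (q g t : nat)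
    (Y : {set I}) (i0 : I) (Lmin Pmin T : nat) :
  0 < q -> 0 < g -> 0 < t -> i0 \in Y ->
  (forall i, i \in Y -> S i * (A i %% (q * t)) <= B i) ->
  let U := q * t in let W := g * t in let n := q * g * t in
  let a0 := A i0 %/ U in let s0 := S i0 %/ W in
  let L := [set i in Y | tile A B S U W i == tile A B S U W i0] in
  let P := [set i in Y | [&& A i %/ U == a0, S i %/ W == s0 &
     nat_near 2 (intercept A B S U i %/ (U * W)) (intercept A B S U i0 %/ (U * W))]] in
  (forall i, i \in Y -> Lmin <= #|[set j in Y | tile A B S U g j == tile A B S U g i]|) ->
  (forall i, i \in Y -> Pmin <= #|[set j in Y | tile A B S q W j == tile A B S q W i]|) ->
  tile_bound A B S Y q g T ->
  6 * ((2 * t + 1) * T) <= Lmin ->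
  #|L| * Lmin * Pmin <= 4 * ((2 * t + 1) * T) *
    incidences (relA A q t a0) (relB A B q g t a0 s0) (relS S g t s0) L P (4 * n) q.
Proof.
move=> q0 g0 t0 i0Y hB U W n a0 s0 L P hL hP hT hC.
set C := (2 * t + 1) * T in hC *.
set Ar := relA A q t a0; set Br := relB A B q g t a0 s0; set Sr := relS S g t s0.
have U0 : 0 < U by rewrite muln_gt0 q0.
have W0 : 0 < W by rewrite muln_gt0 g0.
have nE : n = U * g by rewrite /n /U mulnAC.
have nE' : n = q * W by rewrite /n /W mulnA.
have LY i : i \in L -> [/\ i \in Y, A i %/ U = a0, S i %/ W = s0 &
    intercept A B S U i %/ (U * W) = intercept A B S U i0 %/ (U * W)].
  by rewrite inE => /andP[iY /eqP[-> -> ->]].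
pose line j i := tile A B S U g j == tile A B S U g i.
pose early j i := line j i && (A j %/ q + 2 <= A i %/ q).
pose close j i := line j i && (A i %/ q <= A j %/ q + 1) && (A j %/ q <= A i %/ q + 1).
pose small j i := tile A B S q W j == tile A B S q W i.
have coarsen x : tile A B S U W x =
    ((tile A B S U g x).1.1, (tile A B S U g x).1.2 %/ t, (tile A B S U g x).2 %/ t).
  by rewrite /tile /W mulnA -!divnMA.
have lineL i j : i \in L -> j \in Y -> line j i -> j \in L.
  rewrite !inE => /andP[_ /eqP e] -> /eqP l /=.
  by rewrite -e !coarsen l.
have piece k c : #|[set i in Y | (tile A B S U g i == k) && (A i %/ q == c)]| <= C.
  exact: cover_line_piece.
(* members of the tube in the same or in a neighbouring column are few *)
have Cclose i : \sum_(j in L) close j i <= 3 * C.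
  apply: (@leq_trans (\sum_(j in Y) \sum_(c < 3)
     ((tile A B S U g j == tile A B S U g i) && (A j %/ q == A i %/ q - 1 + c)))).
    rewrite [leqRHS](big_setID L) /=.
    have LsubY : L \subset Y by apply/subsetP => j /LY[].
    rewrite (setIidPr LsubY); apply: leq_trans (leq_addr _ _).
    apply: leq_sum => j jL; rewrite /close /line.
    case: (boolP (_ && _ && _)) => // /andP[/andP[-> c1] c2].
    have c3 : A j %/ q - (A i %/ q - 1) < 3 by move: c1 c2; move: (A i %/ q) (A j %/ q) => x y; clear; lia.
    rewrite (bigD1 (Ordinal c3)) //= subnKC ?eqxx //.
    by move: c1 c2; move: (A i %/ q) (A j %/ q) => x y; clear; lia.
  rewrite exchange_big /=; apply: (@leq_trans (\sum_(c < 3) C)); last first.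
    by rewrite sum_nat_const card_ord.
  apply: leq_sum => c _.
  apply: leq_trans (piece (tile A B S U g i) (A i %/ q - 1 + c)).
  rewrite -sum1_card big_mkcond [leqRHS]big_mkcond /=; apply: leq_sum => j _.
  by rewrite inE; case: (j \in Y).
(* by symmetry half of the remaining pairs are in the right order *)
have manyearly : #|L| * Lmin <= 4 * \sum_(i in L) \sum_(j in L) early j i.
  have sym : \sum_(i in L) \sum_(j in L) early i j = \sum_(i in L) \sum_(j in L) early j i.
    by rewrite exchange_big.
  have split3 : \sum_(i in L) \sum_(j in L) line j i <= \sum_(i in L) \sum_(j in L) early j i
     + \sum_(i in L) \sum_(j in L) early i j + \sum_(i in L) \sum_(j in L) close j i.
    rewrite -!big_split /=; apply: leq_sum => i _; rewrite -!big_split /=.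
    apply: leq_sum => j _; rewrite /early /close [line i j]eq_sym -/(line j i).
    case: (line j i) => //=.
    by case: (leqP (A j %/ q + 2)) => // h1; case: (leqP (A i %/ q + 2)) => // h2;
       rewrite (_ : _ && _ = true) //; apply/andP; split; move: h1 h2; move: (A i %/ q) (A j %/ q) => x y; clear; lia.
  have lo : #|L| * Lmin <= \sum_(i in L) \sum_(j in L) line j i.
    rewrite -sum_nat_const; apply: leq_sum => i iL; have [iY _ _ _] := LY _ iL.
    apply: leq_trans (hL i iY) _; rewrite -sum1_card big_mkcond [leqRHS]big_mkcond /=.
    apply: leq_sum => j _; rewrite inE; case: (boolP (_ && _)) => // /andP[jY jl].
    by rewrite (lineL i j) // /line jl.
  have cl : 2 * \sum_(i in L) \sum_(j in L) close j i <= #|L| * Lmin.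
    rewrite -sum_nat_const big_distrr /=; apply: leq_sum => i _.
    by apply: leq_trans hC; rewrite -/C -[6 * C](mulnA 2 3 C) leq_mul2l Cclose.
  by rewrite sym in split3; clear -split3 lo cl; lia.
have incid i j k : i \in L -> j \in L -> k \in Y -> early j i -> small k i ->
    (k \in P) && ((Ar j + q <= Ar k) && nat_near (4 * n) (Br k) (height Ar Br Sr j (Ar k))).
  move=> iL jL kY /andP[/eqP lji cells] /eqP ski.
  have [iY iA iS il] := LY i iL; have [jY jA jS _] := LY j jL.
  case: ski => kiA kiS kil; case: lji => _ jiS jil.
  have kA : A k %/ U = a0 by rewrite -iA /U !divnMA kiA.
  have kS : S k %/ W = s0 by rewrite kiS.
  have [eAi eSi rAi [rAU rSW] eBi] := relE q0 g0 t0 hB iY iA iS.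
  have [eAj eSj rAj [rAUj rSWj] eBj] := relE q0 g0 t0 hB jY jA jS.
  have [eAk eSk rAk [rAUk rSWk] eBk] := relE q0 g0 t0 hB kY kA kS.
  rewrite -/U -/W -/Ar -/Br -/Sr in eAi eSi rAi rAU rSW eBi eAj eSj rAj rAUj rSWj eBj eAk eSk rAk rAUk rSWk eBk.
  (* [X] separates the left ends of the two columns, the same for i and k *)
  have qU : q %| U by rewrite dvdn_mulr.
  pose X := A i %% U - A i %% q.
  have Xk : A k %% U - A k %% q = X by rewrite /X !(mod_sub _ q0 qU) kiA kA iA.
  have shi : intercept A B S U i + S i * X = intercept A B S q i by apply: intercept_shift => //; apply: hB.
  have shk : intercept A B S U k + S k * X = intercept A B S q k.
    by rewrite -Xk; apply: intercept_shift => //; apply: hB.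
  have qW0 : 0 < q * W by rewrite muln_gt0 q0.
  have UW0 : 0 < U * W by rewrite muln_gt0 U0.
  have XU : X <= U by apply: mod_sub_le.
  have /andP[li1 li2] := div_eq_window qW0 (erefl (intercept A B S q i %/ (q * W))).
  have /andP[lk1 lk2] := div_eq_window qW0 kil.
  set d := _ * (q * W) in li1 li2 lk1 lk2; clearbody d.
  have qWUW : q * W <= U * W by rewrite leq_mul2r leq_pmulr ?orbT.
  have sX1 : Sr i * X <= U * W by rewrite mulnC leq_mul // ltnW.
  have sX2 : Sr k * X <= U * W by rewrite mulnC leq_mul // ltnW.
  rewrite eSi mulnDl in shi; rewrite eSk mulnDl in shk.
  set e := s0 * W * X in shi shk; clearbody e.
  have kP : k \in P.
    rewrite inE kY kA kS !eqxx /= /nat_near -il.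
    have h1 : intercept A B S U k <= intercept A B S U i + 2 * (U * W).
      move: shi shk li1 lk2 qWUW sX1; move: (U * W) (q * W) (Sr i * X) (Sr k * X) => x1 x2 x3 x4.
      by move: (intercept A B S U k) (intercept A B S U i) (intercept A B S q k) (intercept A B S q i) => y1 y2 y3 y4; clear; lia.
    have h2 : intercept A B S U i <= intercept A B S U k + 2 * (U * W).
      move: shi shk li2 lk1 qWUW sX2; move: (U * W) (q * W) (Sr i * X) (Sr k * X) => x1 x2 x3 x4.
      by move: (intercept A B S U k) (intercept A B S U i) (intercept A B S q k) (intercept A B S q i) => y1 y2 y3 y4; clear; lia.
    by rewrite !(addnC _ 2) -!divnMDl // ![2 * _ + _]addnC !leq_div2r.
  have Ajk : Ar j + q <= Ar k.
    rewrite -(leq_add2l (a0 * U)) addnA -eAj -eAk.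
    have c1 : A j < (A j %/ q).+1 * q by rewrite ltn_ceil.
    have c2 : A k %/ q * q <= A k by rewrite leq_divM.
    have c3 : (A j %/ q + 2) * q <= A k %/ q * q by rewrite leq_mul2r kiA cells orbT.
    rewrite mulnDl in c3; rewrite mulSn in c1.
    by move: c1 c2 c3; move: (_ %/ q * q) (A k %/ q * q) => x y; clear; lia.
  rewrite kP Ajk /=.
  have Ajk' : Ar j <= Ar k by apply: leq_trans Ajk; rewrite leq_addr.
  have hj : height Ar Br Sr j (Ar k) = intercept A B S U j + Sr j * Ar k.
    by rewrite /height eBj -addnA -mulnDr subnKC.
  pose r := A k %% q.
  have rq : r < q by rewrite ltn_pmod.
  have ek : Ar k = X + r.
    by rewrite rAk -Xk subnK // -(modn_dvdm _ qU) leq_mod.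
  have sr1 : Sr i * r <= n by rewrite nE' mulnC leq_mul // ltnW.
  have sr2 : Sr k * r <= n by rewrite nE' mulnC leq_mul // ltnW.
  have hi : intercept A B S U i + Sr i * Ar k + e = intercept A B S q i + Sr i * r.
    by rewrite ek mulnDr -shi; clear; lia.
  have hk : Br k + e = intercept A B S q k + Sr k * r.
    by rewrite eBk ek mulnDr -shk; clear; lia.
  have Ug0 : 0 < U * g by rewrite muln_gt0 U0.
  have /andP[mi1 mi2] := div_eq_window Ug0 (erefl (intercept A B S U i %/ (U * g))).
  have /andP[mj1 mj2] := div_eq_window Ug0 jil.
  set d' := _ * (U * g) in mi1 mi2 mj1 mj2; clearbody d'.
  have /andP[si1 si2] := div_eq_window g0 (erefl (S i %/ g)).
  have /andP[sj1 sj2] := div_eq_window g0 jiS.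
  have ds1 : Sr j <= Sr i + g.
    by move: si1 si2 sj1 sj2; rewrite eSi eSj; move: (s0 * W) (_ %/ g * g) => x y; clear; lia.
  have ds2 : Sr i <= Sr j + g.
    by move: si1 si2 sj1 sj2; rewrite eSi eSj; move: (s0 * W) (_ %/ g * g) => x y; clear; lia.
  have gk : g * Ar k <= n by rewrite nE mulnC leq_mul2r ltnW ?orbT.
  have dk1 : Sr j * Ar k <= Sr i * Ar k + n.
    apply: (@leq_trans ((Sr i + g) * Ar k)); first by rewrite leq_mul2r ds1 orbT.
    by rewrite mulnDl leq_add2l.
  have dk2 : Sr i * Ar k <= Sr j * Ar k + n.
    apply: (@leq_trans ((Sr j + g) * Ar k)); first by rewrite leq_mul2r ds2 orbT.
    by rewrite mulnDl leq_add2l.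
  rewrite hj /nat_near; rewrite -nE in mi1 mi2 mj1 mj2; rewrite -nE' in li1 li2 lk1 lk2.
  set Vi := intercept A B S U i + Sr i * Ar k.
  have b1 : Br k <= Vi + (n + n).
    move: hi hk li1 lk2 sr2; rewrite -/Vi; move: (Vi) (Br k) => v b.
    by move: (Sr i * r) (Sr k * r) (intercept _ _ _ _ _) (intercept _ _ _ _ _) (n) => x1 x2 x3 x4 x5; clear; lia.
  have b2 : Vi <= Br k + (n + n).
    move: hi hk li2 lk1 sr1; rewrite -/Vi; move: (Vi) (Br k) => v b.
    by move: (Sr i * r) (Sr k * r) (intercept _ _ _ _ _) (intercept _ _ _ _ _) (n) => x1 x2 x3 x4 x5; clear; lia.
  have b3 : Vi <= intercept A B S U j + Sr j * Ar k + (n + n).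
    rewrite /Vi; move: mi2 mj1 dk2.
    by move: (Sr i * Ar k) (Sr j * Ar k) (intercept _ _ _ _ _) (intercept _ _ _ _ _) (n) => x1 x2 x3 x4 x5; clear; lia.
  have b4 : intercept A B S U j + Sr j * Ar k <= Vi + (n + n).
    rewrite /Vi; move: mi1 mj2 dk1.
    by move: (Sr i * Ar k) (Sr j * Ar k) (intercept _ _ _ _ _) (intercept _ _ _ _ _) (n) => x1 x2 x3 x4 x5; clear; lia.
  rewrite (_ : 4 * n = (n + n) + (n + n)); last by rewrite !mulSn mul0n addn0 !addnA.
  by move: b1 b2 b3 b4; move: (_ + Sr j * _) (n + n) (Vi) (Br k) => x1 x2 x3 x4; clear; lia.
have triples : (\sum_(i in L) \sum_(j in L) early j i) * Pmin <= C * incidences Ar Br Sr L P (4 * n) q.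
  apply: (@leq_trans (\sum_(i in L) \sum_(j in L) \sum_(k in Y) early j i * small k i)).
    rewrite big_distrl /=; apply: leq_sum => i iL.
    rewrite big_distrl /=; apply: leq_sum => j jL.
    rewrite -big_distrr leq_mul2l; apply/orP; right.
    have [iY _ _ _] := LY _ iL; apply: leq_trans (hP i iY) _.
    rewrite -sum1_card big_mkcond [leqRHS]big_mkcond /=.
    by apply: leq_sum => k _; rewrite inE; case: (k \in Y).
  rewrite exchange_big /= /incidences big_distrr /=; apply: leq_sum => j jL.
  rewrite exchange_big /= big_distrr /= big_mkcond [leqRHS]big_mkcond /=.
  apply: leq_sum => k _; have [kY|kY] := boolP (k \in Y); last by [].
  have [ok|nok] := boolP ((k \in P) && ((Ar j + q <= Ar k) && nat_near (4 * n) (Br k) (height Ar Br Sr j (Ar k)))).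
    have /andP[kP ok'] := ok; rewrite kP ok' muln1.
    apply: leq_trans (piece (tile A B S U g j) (A k %/ q)).
    rewrite -sum1_card big_mkcond [leqRHS]big_mkcond /=; apply: leq_sum => i _.
    rewrite inE; case: (boolP (i \in L)) => // /LY[-> _ _ _].
    case: (boolP (early j i)) => // /andP[l _]; case: (boolP (small k i)) => // /eqP[e _ _].
    by rewrite eq_sym -/(line j i) l e eqxx.
  rewrite big1 // => i iL; apply/eqP; rewrite muln_eq0 !eqb0 -negb_and.
  by apply: contra nok => /andP[h1 h2]; apply: incid h1 h2.
apply: (@leq_trans (4 * (\sum_(i in L) \sum_(j in L) early j i) * Pmin)).
  by rewrite leq_mul2r manyearly orbT.
by rewrite -!mulnA leq_mul2l mulnA triples.
Qed.

Local Open Scope ring_scope.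

(** * The branching function of a set *)

(** [pw x] is [2 ^ (m * x)], so that one unit of [x] is one refinement by
    [D = 2 ^ - m]. *)
Record dyadic_power (R : realFieldType) (m : nat) (pw : R -> R) : Prop := DyadicPower {
  pw_gt0 : forall x, 0 < pw x;
  pwD : forall x y, pw (x + y) = pw x * pw y;
  ler_pw : forall x y, (pw x <= pw y) = (x <= y);
  pwn : forall k : nat, pw k%:R = (2 ^ (m * k))%:R }.

Section Power.
Variables (R : realFieldType) (m : nat) (pw : R -> R).
Hypothesis hpw : dyadic_power m pw.

Lemma pw0 : pw 0 = 1.
Proof. by rewrite (pwn hpw 0) muln0 expn0. Qed.

(** Rounding of a mass to a power of [pw kap]; the last level collects all small
    masses. *)
Lemma level_exists (kap x M : R) (C : nat) : x <= M ->
  exists c : 'I_C.+1, x <= pw (- (c%:R * kap)) * M /\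
    ((c < C)%N -> pw (- (c.+1%:R * kap)) * M < x).
Proof.
move=> xM; elim: C => [|C [c [h1 h2]]].
  by exists ord0; rewrite mul0r oppr0 pw0 mul1r.
have [cC|Cc] := ltnP c C.
  by exists (widen_ord (leqnSn C.+1) c); split=> // _; exact: h2.
have ec : c = C :> nat by apply/eqP; rewrite eqn_leq Cc -ltnS ltn_ord.
have [lt|ge] := ltrP (pw (- (C.+1%:R * kap)) * M) x.
  by exists (widen_ord (leqnSn C.+1) c); rewrite /= ec in h1 *; split.
by exists ord_max; split=> //=; rewrite ltnn.
Qed.
End Power.

Lemma min_card_witness (I : finType) (Y : {set I}) (F : I -> nat) (R : realFieldType) (x : R) (i0 : I) :
  i0 \in Y -> (forall i, i \in Y -> x <= (F i)%:R) ->
  exists c : nat, x <= c%:R /\ forall i, i \in Y -> (c <= F i)%N.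
Proof.
move=> i0Y h; have [j jY jmin] := @arg_minnP _ i0 (fun i => i \in Y) F i0Y.
by exists (F j); split=> //; apply: h.
Qed.

Section Profile.
Variables (R : archiRealFieldType) (m H N : nat) (pw : R -> R).
Hypothesis hpw : dyadic_power m pw.
Variables (I : finType) (A B S : I -> nat) (kap : R).
Hypothesis HmN : (m * N <= H)%N.
Hypothesis hA : forall i, (A i < 2 ^ H.+2)%N.
Hypothesis hS : forall i, (S i < 2 ^ H.+2)%N.
Hypothesis hB : forall i, (B i < 2 ^ (2 * H + 4))%N.

(** Lengths are measured in grid steps [2 ^ - H], so this is [D ^ i]. *)
Definition cell_size i := (2 ^ (H - m * i))%N.

Lemma cell_size_gt0 i : (0 < cell_size i)%N. Proof. by rewrite expn_gt0. Qed.

Lemma cell_sizeD i l : (i + l <= N)%N -> cell_size i = (cell_size (i + l) * 2 ^ (m * l))%N.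
Proof.
move=> h; rewrite /cell_size -expnD; congr (_ ^ _)%N.
have : (m * (i + l) <= m * N)%N by rewrite leq_mul2l h orbT.
by rewrite mulnDr; move: HmN; clear; lia.
Qed.

Lemma card_total (Y : {set I}) i j T : (i + j <= N)%N ->
  tile_bound A B S Y (cell_size i) (cell_size j) T ->
  (#|Y| <= 256 * 2 ^ (m * (2 * (i + j))) * T)%N.
Proof.
move=> ij hT.
have mij : (m * i + m * j <= H)%N.
  by rewrite -mulnDr (leq_trans _ HmN) // leq_mul2l ij orbT.
have c1 x k l : (x < 2 ^ k)%N -> (l <= k)%N -> (x %/ 2 ^ l < 2 ^ (k - l))%N.
  by move=> xk lk; rewrite ltn_divLR ?expn_gt0 // -expnD subnK.
apply: (@leq_trans (2 ^ (m * i).+2 * 2 ^ (m * j).+2 * 2 ^ (m * i + m * j + 4) * T)); last first.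
  rewrite leq_mul2r -!expnD; apply/orP; right.
  rewrite (_ : 256 = 2 ^ 8)%N // -expnD leq_exp2l //.
  by rewrite mulnA (mulnC m 2) -mulnA mulnDr; lia.
apply: (@card_cover I A B S Y Y (cell_size i) (cell_size j) T 0 _ 0 _ (fun _ _ => 0%N) _ hT (subxx _)).
- move=> w _; rewrite leq0n /= add0n /cell_size.
  by have := c1 _ _ (H - m * i)%N (hA w) ltac:(lia); congr (_ < 2 ^ _)%N; lia.
- move=> w _; rewrite leq0n /= add0n /cell_size.
  by have := c1 _ _ (H - m * j)%N (hS w) ltac:(lia); congr (_ < 2 ^ _)%N; lia.
move=> w _; rewrite leq0n /= add0n /cell_size -expnD.
have lB : (intercept A B S (cell_size i) w < 2 ^ (2 * H + 4))%N.
  by apply: leq_ltn_trans (hB w); rewrite /intercept leq_subr.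
have := c1 _ _ ((H - m * i) + (H - m * j))%N lB ltac:(lia).
by congr (_ < 2 ^ _)%N; lia.
Qed.

(** [f] records the common logarithmic mass, relative to the whole set, of the
    tiles that [Y] meets. *)
Definition profile (Y : {set I}) (f : nat -> nat -> R) :=
  [/\ #|I|%:R <= pw kap * #|Y|%:R,
    forall i j, (i + j <= N)%N ->
      exists2 T, T%:R <= pw (- f i j) * #|I|%:R & tile_bound A B S Y (cell_size i) (cell_size j) T &
    forall i j, (i + j <= N)%N -> forall w, w \in Y ->
      pw (- f i j - 2 * kap) * #|I|%:R <=
      #|[set v in Y | tile A B S (cell_size i) (cell_size j) v == tile A B S (cell_size i) (cell_size j) w]|%:R].

Hypothesis I0 : (0 < #|I|)%N.

(** The rounded masses of the tiles of all types are the colours of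
    [uniform_subset].  Their number depends on [N] and [kap] only, so the losses
    are below [pw kap] when [m] is large. *)
Lemma profile_exists (C : nat) :
  2 * N%:R + 2 <= C%:R * kap ->
  (512 * (2 * (N.+1 * N.+1) * C.+1 ^ (N.+1 * N.+1)))%:R <= pw kap -> kap <= 1 ->
  exists Y f, profile Y f.
Proof.
move=> hC big kap1.
pose G := ('I_N.+1 * 'I_N.+1)%type.
have cG : #|{: G}| = (N.+1 * N.+1)%N by rewrite card_prod card_ord.
pose key (g : G) := tile A B S (cell_size g.1) (cell_size g.2).
pose num (g : G) i := #|[set j | key g j == key g i]|.
have hx (x : G * I) : exists c : 'I_C.+1,
    (num x.1 x.2)%:R <= pw (- (c%:R * kap)) * #|I|%:R /\
    ((c < C)%N -> pw (- (c.+1%:R * kap)) * #|I|%:R < (num x.1 x.2)%:R).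
  by apply: (level_exists hpw); rewrite ler_nat max_card.
have [col hcol] := fin_all_exists hx.
have G0 : (0 < #|{: G}|)%N by rewrite cG.
have [c [Y [h1 h2 h3]]] := uniform_subset key (fun g i => col (g, i)) I0 G0.
rewrite cG in h2 h3; set D := (C.+1 ^ _)%N in h2 h3 big.
have kap_pw0 : 0 < pw kap := pw_gt0 hpw kap.
have I0R : 0 < #|I|%:R :> R by rewrite ltr0n.
have D0 : (0 < D)%N by rewrite expn_gt0.
have IY : #|I|%:R * 256 <= pw kap * #|Y|%:R.
  apply: (@le_trans _ _ ((512 * (2 * (N.+1 * N.+1) * D))%:R * #|Y|%:R)).
    rewrite -!natrM ler_nat; apply: (@leq_trans (2 * D * #|Y| * 256)%N).
      by rewrite leq_mul2r h2 orbT.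
    have : (1 * (2 * D * #|Y|) <= N.+1 * N.+1 * (2 * D * #|Y|))%N by rewrite leq_mul2r orbT.
    by clear; move: (N.+1 * N.+1)%N => x; nia.
  by rewrite ler_wpM2r.
pose gij i j : G := (inord i, inord j).
pose f i j : R := (c (gij i j))%:R * kap.
have keyE i j : (i + j <= N)%N -> key (gij i j) = tile A B S (cell_size i) (cell_size j).
  by move=> ij; rewrite /key /gij /= !inordK //; move: ij; clear; lia.
have upper i j : (i + j <= N)%N ->
   exists2 T, T%:R <= pw (- f i j) * #|I|%:R & tile_bound A B S Y (cell_size i) (cell_size j) T.
  move=> ij; exists (Num.truncn (pw (- f i j) * #|I|%:R)).
    by rewrite truncn_le mulr_ge0 // ltW // (pw_gt0 hpw).
  move=> k; rewrite truncn_ge_nat; last by rewrite mulr_ge0 // ltW // (pw_gt0 hpw).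
  have [-> |[w]] := set_0Vmem [set v in Y | tile A B S (cell_size i) (cell_size j) v == k].
    by rewrite cards0 mulr_ge0 // ltW // (pw_gt0 hpw).
  rewrite inE => /andP[wY /eqP wk].
  have [g1 _] := hcol (gij i j, w); rewrite /= (h1 w (gij i j) wY) in g1.
  apply: le_trans g1; rewrite ler_nat /num keyE // wk.
  by apply: subset_leq_card; apply/subsetP => v; rewrite !inE => /andP[].
exists Y, f; split=> //.
  by apply: le_trans IY; rewrite ler_peMr // (ler_nat _ 1 256).
move=> i j ij w wY.
have [cC|Cc] := ltnP (c (gij i j)) C; last first.
  (* the last level would make the tiles too small to cover [Y] *)
  exfalso; have [T T1 T2] := upper i j ij.
  have tot := card_total ij T2.
  have cE : c (gij i j) = C :> nat by apply/eqP; rewrite eqn_leq Cc -ltnS ltn_ord.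
  have h : #|Y|%:R <= 256 * (pw (- 2) * #|I|%:R).
    apply: (@le_trans _ _ (256 * 2 ^ (m * (2 * (i + j))) * T)%:R); first by rewrite ler_nat.
    rewrite !natrM -mulrA ler_pM2l // -(pwn hpw).
    apply: (@le_trans _ _ (pw (2 * (i + j))%:R * (pw (- f i j) * #|I|%:R))).
      by rewrite ler_wpM2l // ltW // (pw_gt0 hpw).
    rewrite mulrA -(pwD hpw) ler_pM2r // (ler_pw hpw) /f cE.
    have : (i + j)%:R <= N%:R :> R by rewrite ler_nat.
    by rewrite natrM; move: hC; lra.
  have : #|I|%:R * 256 <= pw kap * (256 * (pw (- 2) * #|I|%:R)).
    by apply: le_trans IY _; rewrite ler_pM2l.
  have -> : pw kap * (256 * (pw (- 2) * #|I|%:R)) = pw (kap - 2) * (#|I|%:R * 256).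
    by rewrite (pwD hpw); ring.
  rewrite -[leLHS]mul1r ler_pM2r; last by rewrite mulr_gt0.
  by rewrite -[leLHS](pw0 hpw) (ler_pw hpw); move: kap1; lra.
have [_ g2] := hcol (gij i j, w); rewrite /= (h1 w (gij i j) wY) in g2.
have {}g2 := g2 cC.
have := h3 (gij i j) w wY; rewrite -/(num (gij i j) w) (keyE _ _ ij).
set cnt := #|[set v in Y | _]| => h4.
have h5 : (num (gij i j) w)%:R <= pw kap * cnt%:R.
  apply: (@le_trans _ _ (2 * (N.+1 * N.+1) * D * cnt)%:R); first by rewrite ler_nat.
  rewrite natrM ler_wpM2r // (le_trans _ big) // ler_nat leq_pmull //.
have h6 : pw (- ((c (gij i j)).+1%:R * kap)) * #|I|%:R <= pw kap * cnt%:R.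
  by apply: le_trans h5; apply: ltW.
rewrite -(ler_pM2l kap_pw0); apply: le_trans h6.
rewrite mulrA -(pwD hpw) ler_pM2r // (ler_pw hpw) /f -natr1 mulrDl mul1r.
lra.
Qed.
End Profile.

Lemma ler_rescale (R : realFieldType) (m : nat) (pw : R -> R) (x y c M : R) :
  dyadic_power m pw -> 0 < M -> 0 <= c ->
  pw x * M <= c * (pw y * M) -> forall z, c <= pw z -> x <= y + z.
Proof.
move=> hpw M0 c0 h z cz; rewrite -(ler_pw hpw) -(ler_pM2r M0); apply: le_trans h _.
rewrite (pwD hpw) mulrA (mulrC (pw y)) ler_pM2r // ler_pM2r //; exact: pw_gt0 hpw _.
Qed.

Section ProfileBranching.
Variables (R : archiRealFieldType) (m H N : nat) (pw : R -> R).
Hypothesis hpw : dyadic_power m pw.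
Variables (I : finType) (A B S : I -> nat) (kap : R).
Hypothesis HmN : (m * N <= H)%N.
Hypothesis I0 : (0 < #|I|)%N.
Hypothesis hA : forall i, (A i < 2 ^ H.+2)%N.
Hypothesis hS : forall i, (S i < 2 ^ H.+2)%N.
Hypothesis hB : forall i, (B i < 2 ^ (2 * H + 4))%N.
Hypothesis hSB : forall i, (S i * 2 ^ H <= B i)%N.
Hypothesis k256 : 256 <= pw kap.
Variables (Y : {set I}) (f : nat -> nat -> R).
Hypothesis prof : profile m H N pw A B S kap Y f.

Let sz := cell_size m H.

Lemma card_gt0R : 0 < #|I|%:R :> R. Proof. by rewrite ltr0n. Qed.

Lemma mod_le_offset j i : (S i * (A i %% sz j) <= B i)%N.
Proof.
apply: leq_trans (hSB i); rewrite leq_mul2l ltnW ?orbT //.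
apply: leq_trans (ltn_pmod _ (cell_size_gt0 m H j)) _.
by rewrite leq_exp2l // leq_subr.
Qed.

Lemma profile_nonempty : exists i, i \in Y.
Proof.
case: prof => h _ _; apply/set0Pn; apply/negP => /eqP Y0; move: h.
by rewrite Y0 cards0 mulr0 leNgt card_gt0R.
Qed.

(** A covering of tiles of one type by those of another compares their masses. *)
Lemma profile_le i j i' j' (c : nat) z :
  (i + j <= N)%N -> (i' + j' <= N)%N ->
  (forall T k, tile_bound A B S Y (sz i) (sz j) T ->
     (#|[set v in Y | tile A B S (sz i') (sz j') v == k]| <= c * T)%N) ->
  c%:R <= pw z -> f i j <= f i' j' + (2 * kap + z).
Proof.
move=> ij ij' hc cz; have [w wY] := profile_nonempty.
case: prof => _ up low; have [T T1 T2] := up _ _ ij.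
have h : pw (- f i' j' - 2 * kap) * #|I|%:R <= c%:R * (pw (- f i j) * #|I|%:R).
  apply: le_trans (low _ _ ij' w wY) _.
  apply: (@le_trans _ _ (c * T)%:R); first by rewrite ler_nat hc.
  by rewrite natrM ler_wpM2l.
have := ler_rescale hpw card_gt0R (ler0n _ c) h cz.
lra.
Qed.

Lemma profile_lipschitz : branching_lipschitz f N (1000 * kap).
Proof.
have mul4 : (2 ^ m * 2 ^ m)%:R = pw 2 by rewrite -expnD addnn -muln2 -(pwn hpw).
have h1 : 0 <= kap.
  by rewrite -(ler_pw hpw) (pw0 hpw) (le_trans _ k256) // (ler_nat _ 1 256).
move=> i j ij; have t0 : (0 < 2 ^ m)%N by rewrite expn_gt0.
have ij1 : (i.+1 + j <= N)%N by rewrite addSn.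
have ij2 : (i + j.+1 <= N)%N by rewrite addnS.
have ij0 : (i + j <= N)%N by apply: ltnW.
have si : sz i = (sz i.+1 * 2 ^ m)%N.
  by rewrite /sz -addn1 (cell_sizeD (l := 1) HmN) ?muln1 // addn1; lia.
have sj : sz j = (sz j.+1 * 2 ^ m)%N.
  by rewrite /sz -addn1 (cell_sizeD (l := 1) HmN) ?muln1 // addn1; lia.
have oi v : v \in Y -> (S v * (A v %% (sz i.+1 * 2 ^ m)) <= B v)%N.
  by rewrite -si => _; apply: mod_le_offset.
have s0 l : (0 < sz l)%N := cell_size_gt0 m H l.
have e1 : f i.+1 j <= f i j + (2 * kap + (2 + kap)).
  apply: (@profile_le _ _ _ _ (2 ^ m * (2 * 2 ^ m + 1))%N) => // [T k hT|].
    rewrite si sj; apply: (cover_left_fine (q := sz i.+1) (g := sz j.+1)) => //.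
    by rewrite -sj.
  apply: (@le_trans _ _ (2 ^ m * 2 ^ m * 3)%N%:R).
    by rewrite ler_nat -mulnA leq_mul2l; apply/orP; right; move: t0; clear; lia.
  rewrite natrM mul4 (pwD hpw _ kap) ler_pM2l ?(pw_gt0 hpw) // (le_trans _ k256) //.
  by rewrite (ler_nat _ 3 256).
have e2 : f i j.+1 <= f i j + (2 * kap + 2).
  apply: (@profile_le _ _ _ _ (2 ^ m * 2 ^ m)%N) => // [T k hT|]; last by rewrite mul4.
  rewrite si sj; apply: (cover_right_fine (q := sz i.+1) (g := sz j.+1)) => //.
  by rewrite -si.
have e3 : f i j <= f i.+1 j + (2 * kap + kap).
  apply: (@profile_le _ _ _ _ 4) => // [T k hT|]; last first.
    by rewrite (le_trans _ k256) // (ler_nat _ 4 256).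
  rewrite sj; apply: (cover_left_coarse (t := (2 ^ m)%N)) => //.
  by rewrite -si -sj.
have e4 : f i j <= f i j.+1 + (2 * kap + kap).
  apply: (@profile_le _ _ _ _ 1) => // [T k hT|]; last first.
    by rewrite (le_trans _ k256) // (ler_nat _ 1 256).
  rewrite mul1n si; apply: (cover_right_coarse (g := sz j.+1)) => //.
  by rewrite -si -sj.
by split; apply/andP; split; lra.
Qed.

Lemma profile_origin : f 0%N 0%N <= 2 * kap.
Proof.
case: prof => h up _; have [T T1 T2] := up 0%N 0%N (leq0n _).
have := card_total HmN hA hS hB (leq0n N : 0 + 0 <= N)%N T2; rewrite muln0 muln1 => h'.
have : pw 0 * #|I|%:R <= pw kap * (pw (kap - f 0%N 0%N) * #|I|%:R).
  rewrite (pw0 hpw) mul1r; apply: le_trans h _; rewrite ler_pM2l ?(pw_gt0 hpw) //.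
  apply: (@le_trans _ _ (256 * T)%N%:R); first by rewrite ler_nat.
  rewrite natrM (pwD hpw) -mulrA; apply: ler_pM => //.
move/(ler_rescale hpw card_gt0R (ltW (pw_gt0 hpw _)))/(_ kap (lexx _)); lra.
Qed.

(** The Frostman condition in exponents. *)
Lemma profile_lower al be :
  (forall i j, (i + j <= N)%N -> forall k,
    #|[set v | tile A B S (sz i) (sz j) v == k]|%:R
      <= pw (kap - al * i%:R - be * j%:R) * #|I|%:R) ->
  forall i j, (i + j <= N)%N -> al * i%:R + be * j%:R - 3 * kap <= f i j.
Proof.
move=> hF i j ij; have [w wY] := profile_nonempty; case: prof => _ _ low.
have h : pw (- f i j - 2 * kap) * #|I|%:R
    <= 1 * (pw (kap - al * i%:R - be * j%:R) * #|I|%:R).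
  rewrite mul1r; apply: le_trans (hF i j ij (tile A B S (sz i) (sz j) w)).
  apply: le_trans (low _ _ ij w wY) _; rewrite ler_nat.
  by apply: subset_leq_card; apply/subsetP => v; rewrite !inE => /andP[].
have := ler_rescale hpw card_gt0R ler01 h (z := 0); rewrite (pw0 hpw) => /(_ (lexx _)).
lra.
Qed.
End ProfileBranching.

(** * Descent through the scales *)

Lemma incidences_mono (I : finType) (A B S : I -> nat) (L P : {set I}) w w' tau tau' :
  (w <= w')%N -> (tau' <= tau)%N ->
  (incidences A B S L P w tau <= incidences A B S L P w' tau')%N.
Proof.
move=> ww tt; rewrite /incidences; apply: leq_sum => i _; apply: leq_sum => j _.
case: (boolP (_ && _)) => // /andP[h1]; rewrite /nat_near => /andP[h2 h3].
have -> : (A i + tau' <= A j)%N by apply: leq_trans h1; rewrite leq_add2l.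
by rewrite (leq_trans h2) ?leq_add2l //= (leq_trans h3) ?leq_add2l.
Qed.

Lemma ler_prod4 (R : realDomainType) (k k' x b b' l l' p p' y z M : R) :
  0 <= k -> 0 <= x -> 0 <= b -> 0 <= l -> 0 <= p -> 0 <= y -> 0 <= z ->
  k <= k' -> b <= b' * M -> l <= l' * M -> p <= p' * M ->
  k * x * b * b * l * p * y * z <= k' * x * b' * b' * l' * p' * y * z * M ^+ 4.
Proof.
move=> k0 x0 b0 l0 p0 y0 z0 hk hb hl hp.
have -> : k' * x * b' * b' * l' * p' * y * z * M ^+ 4
  = k' * x * (b' * M) * (b' * M) * (l' * M) * (p' * M) * y * z by ring.
by rewrite !ler_pM ?mulr_ge0.
Qed.

(** As exponents of [D], the square of the main term is about [4 fB + 2 l] and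
    that of the high-low error at least [4 fB + (3 + p) l - (l + 4)], where [p] is
    [1000 kap].  Since [p l] is at least [8], the error is smaller. *)
Lemma descent_contradiction (R : realFieldType) (kap fB fL fP n l x : R) :
  0 <= n -> kap <= 1 / 100 -> 8 <= 1000 * kap * n -> x <= 17 * kap + 1000 * kap / 8 * n ->
  n <= l -> (3 + 1000 * kap) * l <= fP + fL - 2 * fB ->
  - 2 * fB - l - x + (- 2 * fB - l - x) <= kap + 3 - 2 * fB - fL - fP + l + 1 -> False.
Proof.
move=> n0 k1 h8 hx nl sp h.
have kn : 0 < kap * n by lra.
have k0 : 0 < kap by rewrite ltNge; apply/negP => kn0; have := mulr_le0_ge0 kn0 n0; lra.
have := ler_wpM2l (ltW k0) nl; lra.
Qed.

Section Descent.
Variables (R : archiRealFieldType) (m H N : nat) (pw : R -> R).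
Hypothesis hpw : dyadic_power m pw.
Variables (I : finType) (A B S : I -> nat) (kap : R).
Hypothesis HmN : (m * N + m <= H)%N.
Hypothesis I0 : (0 < #|I|)%N.
Hypothesis Ismall : (#|I| <= 2 ^ (H - m * N))%N.
Hypothesis hSB : forall i, (S i * 2 ^ H <= B i)%N.
Hypothesis kbig : ((100 * 100) * (343 * 240) * (m * N + m).+1)%N%:R <= pw kap.
Hypothesis kap1 : kap <= 1 / 100.
Variables (Y : {set I}) (f : nat -> nat -> R).
Hypothesis prof : profile m H N pw A B S kap Y f.

Let sz := cell_size m H.
Let HmN' : (m * N <= H)%N. Proof. exact: leq_trans (leq_addr _ _) HmN. Qed.
Let IR : 0 < #|I|%:R :> R. Proof. exact: card_gt0R. Qed.

Variables (n B1 B2 : nat) (i0 : I).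
Hypothesis i0Y : i0 \in Y.
Hypothesis gd : good_scale f N (1000 * kap) n B1 B2.
Hypothesis n_large : 8 <= 1000 * kap * n%:R.
Hypothesis BnN : (B1 + n + (B2 + n) <= N)%N.

Let U := sz B1.
Let W := sz B2.
Let a0 := (A i0 %/ U)%N.
Let s0 := (S i0 %/ W)%N.
Let L := [set i in Y | tile A B S U W i == tile A B S U W i0].
Let P := [set i in Y | [&& A i %/ U == a0, S i %/ W == s0 &
  nat_near 2 (intercept A B S U i %/ (U * W)) (intercept A B S U i0 %/ (U * W))]]%N.
Let Ar i := (A i - a0 * U)%N.
Let Sr i := (S i - s0 * W)%N.
Let Br i := (B i - s0 * W * Ar i)%N.
Let J w x := incidences Ar Br Sr L P (w * (x * W)) x.

Let LY : L \subset Y. Proof. by apply/subsetP => i; rewrite inE => /andP[]. Qed.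
Let PY : P \subset Y. Proof. by apply/subsetP => i; rewrite inE => /andP[]. Qed.
Let Lcell i : i \in L -> (A i %/ U = a0 /\ S i %/ W = s0)%N.
Proof. by rewrite inE => /andP[_ /eqP[-> -> _]]. Qed.
Let Pcell i : i \in P -> (A i %/ U = a0 /\ S i %/ W = s0)%N.
Proof. by rewrite inE => /and4P[_ /eqP -> /eqP -> _]. Qed.

Let hYU q t : (q * t)%N = U -> forall i, i \in Y -> (S i * (A i %% (q * t)) <= B i)%N.
Proof. by move=> -> i _; apply: mod_le_offset. Qed.

Let rels q g t : (q * t)%N = U -> (g * t)%N = W ->
  [/\ relA A q t a0 = Ar, relS S g t s0 = Sr & relB A B q g t a0 s0 = Br].
Proof. by move=> e1 e2; rewrite /relA /relS /relB /relA e1 e2. Qed.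

Let rel_lt i : i \in Y -> (A i %/ U = a0)%N -> (S i %/ W = s0)%N ->
  [/\ (A i = a0 * U + Ar i)%N, (S i = s0 * W + Sr i)%N, (Ar i < U)%N, (Sr i < W)%N &
      (B i = s0 * W * Ar i + Br i)%N].
Proof.
move=> iY e1 e2.
have h : (U * 1 = U)%N by rewrite muln1.
have h' : (W * 1 = W)%N by rewrite muln1.
have [h1 h2 h3 [h4 h5] h6] := @relE I A B S U W 1 Y (cell_size_gt0 _ _ _) (cell_size_gt0 _ _ _) isT
  (hYU h) a0 s0 i iY ltac:(by rewrite h) ltac:(by rewrite h').
have [r1 r2 r3] := rels h h'.
rewrite r1 r2 h h' in h1 h2 h3 h4 h5; split=> //.
rewrite /Br subnKC //; apply: leq_trans (mod_le_offset m A hSB B1 i).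
by rewrite h3 leq_mul2r h2 leq_addr orbT.
Qed.

Lemma card_pencil T : tile_bound A B S Y U W T -> (#|L| <= T)%N.
Proof. by apply. Qed.

(** Neighbouring tiles are included in [P], because the points of a small box of a
    member of the tile may leave it. *)
Lemma card_patch T : tile_bound A B S Y U W T -> (#|P| <= 5 * T)%N.
Proof.
move=> hT; have := @card_cover I A B S Y P U W T a0 1 s0 1
  (fun _ _ => intercept A B S U i0 %/ (U * W) - 2)%N 5 hT PY.
rewrite !mul1n; apply.
- by move=> i /Pcell [-> _]; rewrite leqnn addn1 ltnSn.
- by move=> i /Pcell [_ ->]; rewrite leqnn addn1 ltnSn.
move=> i; rewrite inE => /and4P[_ _ _]; rewrite /nat_near.
by move: (_ %/ _)%N (_ %/ _)%N => x y; clear; lia.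
Qed.

(** One application of [high_low], from the cells of level [l] to cells smaller by
    [2 ^ e].  Its second alternative contradicts the bound on [spread] at [l],
    because tubes and boxes have the masses [f B1 (B2 + l)] and
    [f (B1 + l) B2]. *)
Lemma descent_step l q g e x :
  (n <= l)%N -> (B1 + B2 + l <= N)%N -> (0 < e <= m)%N ->
  sz (B1 + l) = (q * 2 ^ e)%N -> sz (B2 + l) = (g * 2 ^ e)%N ->
  x <= 17 * kap + 1000 * kap / 8 * n%:R ->
  pw (- 2 * f B1 B2 - l%:R - x) * #|I|%:R ^+ 2 <= (J 4 (sz (B1 + l)))%:R ->
  (J 4 (sz (B1 + l)) <= 24 * 2 ^ m * J 2 q)%N.
Proof.
move=> nl lN /andP[e0 em] qe ge hx hJ.
have s0' j : (0 < sz j)%N := cell_size_gt0 m H j.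
have q0 : (0 < q)%N by have := s0' (B1 + l)%N; rewrite qe muln_gt0 => /andP[].
have g0 : (0 < g)%N by have := s0' (B2 + l)%N; rewrite ge muln_gt0 => /andP[].
have lB1 : (B1 + l <= N)%N by move: lN; clear; lia.
have lB2 : (B2 + l <= N)%N by move: lN; clear; lia.
have Ue : U = (sz (B1 + l) * 2 ^ (m * l))%N by apply: (cell_sizeD HmN').
have We : W = (sz (B2 + l) * 2 ^ (m * l))%N by apply: (cell_sizeD HmN').
have Uq : (q * 2 ^ (m * l + e))%N = U by rewrite Ue qe addnC expnD mulnA.
have Wg : (g * 2 ^ (m * l + e))%N = W by rewrite We ge addnC expnD mulnA.
case: prof => _ up _.
have [TB TB1 TB2] := up B1 B2 ltac:(move: lN; clear; lia).
have [TL TL1 TL2] := up B1 (B2 + l)%N ltac:(move: lN; clear; lia).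
have [TP TP1 TP2] := up (B1 + l)%N B2 ltac:(move: lN; clear; lia).
have nE : (q * g * 2 ^ (m * l + e) = q * W)%N by rewrite -mulnA Wg.
have Z : (2 * q * 2 ^ (m * l + e) = 2 * U)%N by rewrite -mulnA Uq.
have hl := @high_low I Ar Br Sr q g (2 ^ (m * l + e)) (m * l + e) (4 * 2 ^ e) L P
  (8 * TL) (6 * TP).
rewrite nE Z Uq Wg in hl.
have {}hl := hl q0 g0 erefl.
have tl0 : (0 < 2 ^ (m * l))%N by rewrite expn_gt0.
have e20 : (0 < 2 ^ e)%N by rewrite expn_gt0.
have [r1 r2 r3] := rels (esym Ue) (esym We).
have hL1 i : i \in L -> (Ar i < U)%N.
  by move=> iL; have [h1 h2] := Lcell iL; case: (rel_lt (subsetP LY _ iL) h1 h2).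
have hP1 i : i \in P -> (Ar i < U)%N.
  by move=> iP; have [h1 h2] := Pcell iP; case: (rel_lt (subsetP PY _ iP) h1 h2).
have hL2 i : i \in L -> (Sr i < W)%N.
  by move=> iL; have [h1 h2] := Lcell iL; case: (rel_lt (subsetP LY _ iL) h1 h2).
have q_le : (q <= sz (B1 + l))%N by rewrite qe leq_pmulr.
have g_le : (g <= sz (B2 + l))%N by rewrite ge leq_pmulr.
have {}hl := hl hL1 hP1 hL2.
have hL3 p s y : (p <= 2 * U)%N -> (#|[set i in L | [&& Ar i <= p, s <= Sr i < s + g &
     y <= height Ar Br Sr i p < y + q * W]]| <= 8 * TL)%N.
  move=> pU.
  have := @cover_lines I A B S (sz (B1 + l)) (sz (B2 + l)) (2 ^ (m * l)) Y (s0' _) (s0' _) tl0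
    (hYU (esym Ue)) a0 s0 TL L p s y.
  rewrite r1 r2 r3 -Ue -We => /(_ TL2 LY Lcell pU); apply: leq_trans.
  apply: subset_leq_card; apply/subsetP => i; rewrite !inE => /andP[-> /and3P[-> /andP[-> h1] /andP[-> h2]]].
  rewrite (leq_trans h1) ?leq_add2l //= (leq_trans h2) // leq_add2l -Wg -Uq mulnA mulnAC.
  by rewrite leq_mul2l g_le orbT.
have hP3 y z : (#|[set j in P | (y <= Ar j < y + q) && (z <= Br j < z + q * W)]| <= 6 * TP)%N.
  have := @cover_points I A B S (sz (B1 + l)) (sz (B2 + l)) (2 ^ (m * l)) Y (s0' _) (s0' _) tl0
    (hYU (esym Ue)) a0 s0 TP P y z.
  rewrite r1 r3 -Ue -We => /(_ TP2 PY Pcell); apply: leq_trans.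
  apply: subset_leq_card; apply/subsetP => i; rewrite !inE => /andP[-> /andP[/andP[-> h1] /andP[-> h2]]].
  by rewrite (leq_trans h1) ?leq_add2l //= (leq_trans h2) // leq_add2l leq_mul2r q_le orbT.
have {}hl := hl hL3 hP3.
have LU : (#|L| <= 2 * U)%N.
  apply: leq_trans (max_card _) _; apply: leq_trans Ismall _.
  apply: (@leq_trans U); last by rewrite leq_pmull.
  by rewrite leq_exp2l // leq_sub2l // leq_mul2l; apply/orP; right; move: lN; clear; lia.
have {}hl := hl LU.
have Jle : (J 4 (sz (B1 + l)) <= incidences Ar Br Sr L P (4 * 2 ^ e * (q * W)) (2 * q))%N.
  apply: incidences_mono; first by rewrite qe -!mulnA leq_mul2l; apply/orP; right; rewrite mulnCA mulnA.
  by rewrite qe mulnC leq_mul2l -{1}(expn1 2) leq_exp2l // e0 orbT.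
have em2 : (2 ^ e <= 2 ^ m)%N by rewrite leq_exp2l.
case: hl => [h|h].
  apply: leq_trans Jle _; apply: leq_trans h _; rewrite /J leq_mul2r; apply/orP; right.
  by move: em2 e20; clear; lia.
exfalso.
have h1 : (J 4 (sz (B1 + l)) ^ 2 <= 100 * 100 * (343 * (2 ^ m * 2 ^ m * 2 ^ m)) *
   (240 * (TB * TB * TL * TP)) * (2 ^ (m * l) * 2 ^ m * (m * N + m).+1))%N.
  apply: (@leq_trans (incidences Ar Br Sr L P (4 * 2 ^ e * (q * W)) (2 * q) ^ 2)).
    by rewrite leq_exp2r.
  apply: leq_trans h _; apply: leq_mul; first apply: leq_mul.
  - rewrite leq_mul2l; apply/orP; right.
    apply: (@leq_trans ((7 * 2 ^ m) ^ 3)); last first.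
      by rewrite expnMn leq_mul // !expnS expn0 muln1 mulnA.
    by rewrite leq_exp2r //; move: em2 e20; clear; lia.
  - apply: (@leq_trans (TB * (5 * TB) * (8 * TL) * (6 * TP))); last by clear; nia.
    by rewrite !leq_mul ?card_pencil ?card_patch.
  - apply: leq_mul; last by rewrite ltnS leq_add // leq_mul2l; apply/orP; right; move: lN; clear; lia.
    by rewrite expnD leq_mul2l em2 orbT.
have h2 : (J 4 (sz (B1 + l)))%:R ^+ 2 <=
    pw (kap + 3 - 2 * f B1 B2 - f B1 (B2 + l)%N - f (B1 + l)%N B2 + l%:R + 1) * #|I|%:R ^+ 4.
  have -> : kap + 3 - 2 * f B1 B2 - f B1 (B2 + l)%N - f (B1 + l)%N B2 + l%:R + 1 =
     kap + 3%:R + (- f B1 B2) + (- f B1 B2) + (- f B1 (B2 + l)%N) + (- f (B1 + l)%N B2)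
       + l%:R + 1%:R by clear; ring.
  rewrite (pwD hpw _ 1%:R) (pwD hpw _ l%:R) (pwD hpw _ (- f (B1 + l)%N B2)).
  rewrite (pwD hpw _ (- f B1 (B2 + l)%N)) !(pwD hpw _ (- f B1 B2)) (pwD hpw kap).
  rewrite !(pwn hpw) muln1.
  rewrite -natrX; apply: le_trans (_ : _ <= ((100 * 100) * (343 * 240) * (m * N + m).+1)%N%:R *
    (2 ^ (m * 3))%:R * TB%:R * TB%:R * TL%:R * TP%:R * (2 ^ (m * l))%:R * (2 ^ m)%:R) _.
    rewrite -!natrM ler_nat; apply: leq_trans h1 _.
    rewrite (_ : 2 ^ (m * 3) = 2 ^ m * 2 ^ m * 2 ^ m)%N; last by rewrite -!expnD; congr (_ ^ _)%N; clear; lia.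
    by apply/eq_leq; move: (m * N + m)%N (2 ^ m)%N (2 ^ (m * l))%N; clear => a b c; ring.
  move: (100 * 100 * (343 * 240) * (m * N + m).+1)%N kbig => cst kb.
  by apply: ler_prod4 => //; rewrite ?mulr_ge0 ?ler0n // -?(pwn hpw) ltW // (pw_gt0 hpw).
have h3 : pw (- 2 * f B1 B2 - l%:R - x + (- 2 * f B1 B2 - l%:R - x)) * #|I|%:R ^+ 4 <=
    pw (kap + 3 - 2 * f B1 B2 - f B1 (B2 + l)%N - f (B1 + l)%N B2 + l%:R + 1) * #|I|%:R ^+ 4.
  apply: le_trans h2; rewrite (pwD hpw) (_ : 4 = 2 + 2)%N // exprD mulrACA -expr2.
  by rewrite ler_sqr ?nnegrE ?ler0n // mulr_ge0 ?sqr_ge0 // ltW // (pw_gt0 hpw).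
move: h3; rewrite ler_pM2r ?exprn_gt0 // (ler_pw hpw).
case: gd => _ _ /(_ l nl lN); rewrite /spread.
have : n%:R <= l%:R :> R by rewrite ler_nat.
exact: descent_contradiction (ler0n _ _) kap1 n_large hx.
Qed.

(** Supermodularity at the scale [n] turns the count of triples into the expected
    number of incidences of the tile. *)
Lemma descent_start :
  pw (- 2 * f B1 B2 - n%:R - (7 * kap + 1000 * kap / 8 * n%:R)) * #|I|%:R ^+ 2
    <= (J 4 (sz (B1 + n)))%:R.
Proof.
have s0' j : (0 < sz j)%N := cell_size_gt0 m H j.
have tn0 : (0 < 2 ^ (m * n))%N by rewrite expn_gt0.
have nB1 : (B1 + n <= N)%N by move: BnN; clear; lia.
have nB2 : (B2 + n <= N)%N by move: BnN; clear; lia.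
have Ue : U = (sz (B1 + n) * 2 ^ (m * n))%N by apply: (cell_sizeD HmN').
have We : W = (sz (B2 + n) * 2 ^ (m * n))%N by apply: (cell_sizeD HmN').
have ij1 : (B1 + (B2 + n) <= N)%N by move: BnN; clear; lia.
have ij2 : (B1 + n + B2 <= N)%N by move: BnN; clear; lia.
have ij0 : (B1 + B2 <= N)%N by move: BnN; clear; lia.
case: prof => _ up low.
have [T T1 T2] := up _ _ BnN.
have [Lmin [Lm1 Lm2]] := min_card_witness i0Y (low _ _ ij1).
have [Pmin [Pm1 Pm2]] := min_card_witness i0Y (low _ _ ij2).
have L1 := low _ _ ij0 i0 i0Y; rewrite -/L in L1.
have k18 : 18 <= pw kap.
  apply: le_trans kbig; rewrite (ler_nat _ 18); apply: (@leq_trans (100 * 100 * (343 * 240) * 1)); first by [].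
  by rewrite leq_mul2l orbT.
have p0 x : 0 <= pw x by apply/ltW/(pw_gt0 hpw).
case: gd => g1 g2 _.
have tT : ((2 * 2 ^ (m * n) + 1) * T)%:R <= 3 * (pw (n%:R - f (B1 + n)%N (B2 + n)%N) * #|I|%:R).
  apply: (@le_trans _ _ (3 * 2 ^ (m * n) * T)%N%:R).
    by rewrite ler_nat leq_mul2r; apply/orP; right; move: tn0; clear; lia.
  rewrite (pwD hpw) (pwn hpw) 2!natrM -!mulrA ler_pM2l // ler_wpM2l //.
have cond : (6 * ((2 * 2 ^ (m * n) + 1) * T) <= Lmin)%N.
  rewrite -(ler_nat R); apply: le_trans Lm1; rewrite natrM.
  apply: (@le_trans _ _ (18 * (pw (n%:R - f (B1 + n)%N (B2 + n)%N) * #|I|%:R))).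
    by move: tT; move: (_%:R) (pw _ * _) => y z; lra.
  apply: (@le_trans _ _ (pw kap * (pw (n%:R - f (B1 + n)%N (B2 + n)%N) * #|I|%:R))).
    by rewrite ler_wpM2r // mulr_ge0.
  rewrite mulrA -(pwD hpw) ler_pM2r // (ler_pw hpw).
  by move: n_large g2 kap1; move: (n%:R) => nn; lra.
have := @initial_incidences I A B S (sz (B1 + n)) (sz (B2 + n)) (2 ^ (m * n)) Y i0 Lmin Pmin T
  (s0' _) (s0' _) tn0 i0Y (hYU (esym Ue)).
have [r1 r2 r3] := rels (esym Ue) (esym We).
rewrite -Ue -We /= r1 r2 r3 => /(_ Lm2 Pm2 T2 cond); rewrite -(mulnA (sz (B1 + n))) -We -/(J 4 _) => h.
have h' : (pw (- f B1 B2 - 2 * kap) * #|I|%:R) * (pw (- f B1 (B2 + n)%N - 2 * kap) * #|I|%:R)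
    * (pw (- f (B1 + n)%N B2 - 2 * kap) * #|I|%:R)
    <= 4 * (3 * (pw (n%:R - f (B1 + n)%N (B2 + n)%N) * #|I|%:R)) * (J 4 (sz (B1 + n)))%:R.
  apply: (@le_trans _ _ (#|L| * Lmin * Pmin)%:R).
    by rewrite !natrM !ler_pM ?mulr_ge0.
  by apply: le_trans (_ : _ <= (_ : nat)%:R) _; first (by rewrite ler_nat; exact: h); rewrite natrM natrM ler_wpM2r // ler_wpM2l.
set D := pw (n%:R - f (B1 + n)%N (B2 + n)%N) * #|I|%:R in h'.
have D0 : 0 < D by rewrite mulr_gt0 // (pw_gt0 hpw).
have D12 : 0 < 4 * (3 * D) by rewrite mulr_gt0 ?(ltr0n R 4) // mulr_gt0 ?(ltr0n R 3).
rewrite -(ler_pM2l D12); apply: le_trans h'.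
have -> : pw (- f B1 B2 - 2 * kap) * #|I|%:R * (pw (- f B1 (B2 + n)%N - 2 * kap) * #|I|%:R)
    * (pw (- f (B1 + n)%N B2 - 2 * kap) * #|I|%:R) =
  pw (- f B1 B2 - 2 * kap + (- f B1 (B2 + n)%N - 2 * kap) + (- f (B1 + n)%N B2 - 2 * kap)) * #|I|%:R ^+ 3.
  by rewrite !(pwD hpw _ (_ - 2 * kap)); ring.
apply: (@le_trans _ _ (pw kap * (D * (pw (- 2 * f B1 B2 - n%:R - (7 * kap + 1000 * kap / 8 * n%:R)) * #|I|%:R ^+ 2)))).
  rewrite (mulrA (pw kap) D); apply: ler_wpM2r; first by rewrite mulr_ge0 ?sqr_ge0.
  rewrite mulrA ler_wpM2r ?(ltW D0) //; apply: le_trans k18.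
  by rewrite -natrM ler_nat.
rewrite /D (_ : pw kap * _ = pw (kap + (n%:R - f (B1 + n)%N (B2 + n)%N) +
    (- 2 * f B1 B2 - n%:R - (7 * kap + 1000 * kap / 8 * n%:R))) * #|I|%:R ^+ 3); last first.
  rewrite (pwD hpw (kap + _)) (pwD hpw kap); ring.
rewrite ler_pM2r ?exprn_gt0 // (ler_pw hpw).
by move: g1; move: (n%:R) => nn; lra.
Qed.

Hypothesis k24 : 24 <= pw (kap / N%:R).
Hypothesis m0 : (0 < m)%N.

Let kap0 : 0 < kap.
Proof. by rewrite ltNge; apply/negP => k0; have := mulr_le0_ge0 k0 (ler0n R n); move: n_large; lra. Qed.

(** The loss in the exponent after [r] steps, beyond one unit per step. *)
Let drift r := 7 * kap + 1000 * kap / 8 * n%:R + r%:R * (kap / N%:R).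

Let drift_le r : (r <= N)%N -> drift r <= 17 * kap + 1000 * kap / 8 * n%:R.
Proof.
move=> rN; rewrite /drift addrAC lerD2r.
have : r%:R * (kap / N%:R) <= kap.
  have [->|N0] := posnP N; first by rewrite invr0 !mulr0 ltW.
  by rewrite mulrCA ger_pMr // ler_pdivrMr ?ltr0n // mul1r ler_nat.
move: kap0; lra.
Qed.

Let driftS r : drift r.+1 = drift r + kap / N%:R.
Proof. by rewrite /drift -natr1; ring. Qed.

Let descend_lower (x y : R) (a b : nat) : (a <= 24 * 2 ^ m * b)%N -> y <= x - 1 - kap / N%:R ->
  pw x * #|I|%:R ^+ 2 <= a%:R -> pw y * #|I|%:R ^+ 2 <= b%:R.
Proof.
move=> hab hy ha; have p24 : 0 < 24 * pw 1 by rewrite mulr_gt0 ?(ltr0n R 24) ?(pw_gt0 hpw).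
rewrite -(ler_pM2l p24).
have -> : 24 * pw 1 * b%:R = (24 * 2 ^ m * b)%N%:R by rewrite !natrM (pwn hpw 1) muln1.
apply: le_trans (_ : (a%:R <= _)); last by rewrite ler_nat.
apply: le_trans ha; rewrite mulrA ler_wpM2r ?sqr_ge0 //.
apply: (@le_trans _ _ (pw (kap / N%:R) * pw 1 * pw y)).
  by rewrite !ler_wpM2r // ltW // (pw_gt0 hpw).
by rewrite -!(pwD hpw) (ler_pw hpw); move: hy; lra.
Qed.

Lemma descent r : (B1 + B2 + (n + r) <= N)%N ->
  pw (- 2 * f B1 B2 - (n + r)%:R - drift r) * #|I|%:R ^+ 2 <= (J 4 (sz (B1 + (n + r))))%:R.
Proof.
elim: r => [|r IH] h.
  by rewrite addn0 /drift mul0r addr0; apply: descent_start.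
have h' : (B1 + B2 + (n + r) <= N)%N by move: h; clear; lia.
have rN : (r <= N)%N by move: h; clear; lia.
have e1 j : (j <= B1 + B2)%N -> sz (j + (n + r)) = (sz (j + (n + r.+1)) * 2 ^ m)%N.
  move=> hj; rewrite /sz (cell_sizeD (l := 1) HmN') ?muln1 ?addn1 ?addnS //.
  by move: h hj; clear; lia.
have st := @descent_step (n + r) (sz (B1 + (n + r.+1))) (sz (B2 + (n + r.+1))) m (drift r)
  (leq_addr _ _) h' ltac:(by rewrite m0 leqnn) (e1 _ (leq_addr _ _)) (e1 _ (leq_addl _ _))
  (drift_le rN) (IH h').
have st' : (J 4 (sz (B1 + (n + r))) <= 24 * 2 ^ m * J 4 (sz (B1 + (n + r.+1))))%N.
  apply: leq_trans st _; rewrite leq_mul2l; apply/orP; right.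
  by apply: incidences_mono; rewrite // leq_mul2r orbT.
apply: (descend_lower st' _ (IH h')).
by rewrite driftS addnS -(natr1 (n + r)%N); move: ((n + r)%:R) (f B1 B2) (kap / _) (drift r) => x y z t; lra.
Qed.

(** The last step reaches cells that are smaller than the target scale. *)
Lemma descent_end e (q := (2 ^ (H - m * (N - B2) - e))%N) : (0 < e <= m)%N ->
  pw (- 2 * f B1 B2 - (N - B1 - B2)%:R - 17 * kap - 1000 * kap / 8 * n%:R - 1 - kap / N%:R)
    * #|I|%:R ^+ 2 <= (J 2 q)%:R.
Proof.
move=> he; pose r := (N - B1 - B2 - n)%N.
have rE : (n + r = N - B1 - B2)%N by rewrite /r; move: BnN; clear; lia.
have h : (B1 + B2 + (n + r) <= N)%N by rewrite rE; move: BnN; clear; lia.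
have rN : (r <= N)%N by rewrite /r; clear; lia.
have e1 : (B1 + (n + r) = N - B2)%N by rewrite rE; move: BnN; clear; lia.
have e2 : (B2 + (n + r) = N - B1)%N by rewrite rE; move: BnN; clear; lia.
have sE j : (j <= N)%N -> sz j = (2 ^ (H - m * j - e) * 2 ^ e)%N.
  move=> jN; rewrite /sz /cell_size -expnD subnK //.
  have : (m * j <= m * N)%N by rewrite leq_mul2l jN orbT.
  by move: HmN he; clear; lia.
have st := @descent_step (n + r) q (2 ^ (H - m * (N - B1) - e)) e (drift r)
  (leq_addr _ _) h he _ _ (drift_le rN) (descent h).
rewrite e1 e2 in st.
have {}st := st (sE _ (leq_subr _ _)) (sE _ (leq_subr _ _)).
have := descent h; rewrite e1 => dh; apply: (descend_lower st _ dh).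
rewrite -rE; have := drift_le rN; move: ((n + r)%:R) (f B1 B2) (kap / _) (drift r) => x y z t; lra.
Qed.

(** Undoing the shear. *)
Lemma incidences_pairs q : (0 < q)%N ->
  (J 2 q <= #|[set z : I * I | ((A z.1 < A z.2)
     && nat_near (2 * (q * W)) (B z.2) (B z.1 + S z.1 * (A z.2 - A z.1)))%N]|)%N.
Proof.
move=> q0; rewrite /J /incidences pair_big /= -sum1_card [leqLHS]big_mkcond [leqRHS]big_mkcond /=.
apply: leq_sum => -[i j] _ /=; case: ifP => // /andP[iL jP].
case: (boolP (_ && _)) => // /andP[Aij nr].
have [h1 h2] := Lcell iL; have [h3 h4] := Pcell jP.
have [i1 i2 i3 i4 i5] := rel_lt (subsetP LY _ iL) h1 h2.
have [j1 j2 j3 j4 j5] := rel_lt (subsetP PY _ jP) h3 h4.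
suff -> : (i, j) \in [set z : I * I | ((A z.1 < A z.2)
     && nat_near (2 * (q * W)) (B z.2) (B z.1 + S z.1 * (A z.2 - A z.1)))%N] by [].
have hA : (A j - A i = Ar j - Ar i)%N by rewrite i1 j1 subnDl.
rewrite inE /= {1}i1 {1}j1 ltn_add2l (leq_trans _ Aij) /=; last by rewrite -addn1 leq_add2l.
rewrite hA; move: nr; rewrite -(nat_near_addl _ _ _ (s0 * W * Ar j)) -j5 /height i2 i5.
suff -> : (s0 * W * Ar j + (Br i + Sr i * (Ar j - Ar i)) =
  s0 * W * Ar i + Br i + (s0 * W + Sr i) * (Ar j - Ar i))%N by [].
have ij : (Ar i <= Ar j)%N by apply: leq_trans Aij; rewrite leq_addr.
by rewrite -{1}(subnKC ij) mulnDr mulnDl; clear; move: (_ * _)%N (_ * _)%N (_ * _)%N => x y z; lia.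
Qed.

Lemma descent_pairs : (N + 4 <= m)%N ->
  pw (- 2 * f B1 B2 - (N - B1 - B2)%:R - 17 * kap - 1000 * kap / 8 * n%:R - 1 - kap / N%:R)
    * #|I|%:R ^+ 2 <=
  #|[set z : I * I | ((A z.1 < A z.2) &&
     nat_near (2 ^ (2 * H - m * N - N - 3)) (B z.2) (B z.1 + S z.1 * (A z.2 - A z.1)))%N]|%:R.
Proof.
move=> hm; have e0 : (0 < N + 4 <= m)%N by rewrite hm addnS.
apply: le_trans (descent_end e0) _; rewrite ler_nat.
apply: leq_trans (incidences_pairs _) _; first by rewrite expn_gt0.
rewrite -expnD mulnC -expnSr.
rewrite (_ : (_ + _).+1 = 2 * H - m * N - N - 3)%N //.
have B2N : (B2 <= N)%N by move: BnN; clear; lia.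
have hB2 : (m * B2 <= m * N)%N by rewrite leq_mul2l B2N orbT.
by rewrite mulnBr; move: HmN hm hB2; clear; lia.
Qed.

End Descent.

(** The order of the quantifiers matters: [nmax] comes before [N], so that the loss
    [7 * nmax + 4] becomes negligible against [N], and [c] before [m], so that all
    constants that depend on [N] are absorbed by a small power of [D].  The width
    [2 ^ (2 * H - m * N - N - 3)] is [D ^ N / 2 ^ (N + 3)] in units of the grid
    for heights. *)
Lemma discrete_incidences (R : archiRealFieldType) (p : R) : 0 < p <= 1 / 100 ->
  exists nmax : nat, forall N (al be : R), (3 * nmax <= N)%N -> (0 < N)%N ->
    1 <= al -> 3 + 3 * p <= al + be ->
  exists c : nat, forall m (pw : R -> R), dyadic_power m pw -> (N + 4 <= m)%N ->
    (c * m.+1)%:R <= pw (p / 1000 / N%:R) ->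
  forall H (I : finType) (A B S : I -> nat),
    (m * N + m <= H)%N -> (0 < #|I|)%N -> (#|I| <= 2 ^ (H - m * N))%N ->
    (forall i, A i < 2 ^ H.+2)%N -> (forall i, S i < 2 ^ H.+2)%N ->
    (forall i, B i < 2 ^ (2 * H + 4))%N -> (forall i, S i * 2 ^ H <= B i)%N ->
    (forall i j, (i + j <= N)%N -> forall k,
      #|[set v | tile A B S (cell_size m H i) (cell_size m H j) v == k]|%:R
        <= pw (p / 1000 - al * i%:R - be * j%:R) * #|I|%:R) ->
    pw (- N%:R - 7 * nmax%:R - 4) * #|I|%:R ^+ 2 <=
      #|[set z : I * I | ((A z.1 < A z.2) &&
         nat_near (2 ^ (2 * H - m * N - N - 3)) (B z.2) (B z.1 + S z.1 * (A z.2 - A z.1)))%N]|%:R.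
Proof.
move=> hp; have [p0 p1] := andP hp; pose kap := p / 1000.
have kp : 1000 * kap = p by rewrite /kap mulrC divfK // (pnatr_eq0 R 1000).
have kap0 : 0 < kap by rewrite divr_gt0 // (ltr0n R 1000).
have kap1 : kap <= 1 / 100 by move: kp p1 kap0; clear; lra.
have kap1' : kap <= 1 by move: kap1; clear; lra.
have [nmax branching] := branching_good_scale (Num.truncn (8 / p)).+1 hp.
exists nmax => N al be hN N0 al1 albe.
pose C := (Num.truncn ((2 * N%:R + 2) / kap)).+1.
have hC : 2 * N%:R + 2 <= C%:R * kap.
  rewrite -ler_pdivrMr //; apply/ltW/truncnS_gt.
pose c1 := (512 * (2 * (N.+1 * N.+1) * C.+1 ^ (N.+1 * N.+1)))%N.
pose c2 := (100 * 100 * (343 * 240))%N.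
exists (c1 + c2 * N.+1 + 24)%N => m pw hpw hm cm H I A B S HmN I0 Ismall hA hS hB hSB hF.
have pwkap : pw (kap / N%:R) <= pw kap.
  by rewrite (ler_pw hpw) ler_pdivrMr ?ltr0n // ler_peMr ?ler1n // ltW.
have cm' x : (x <= (c1 + c2 * N.+1 + 24) * m.+1)%N -> x%:R <= pw (kap / N%:R).
  by move=> hx; apply: le_trans cm; rewrite ler_nat.
have b1 : c1%:R <= pw kap.
  apply: le_trans pwkap; apply: cm'; rewrite mulnS -addnA -addnA.
  by rewrite leq_addr.
have b2 : (c2 * (m * N + m).+1)%N%:R <= pw kap.
  apply: le_trans pwkap; apply: cm'; apply: (@leq_trans (c2 * N.+1 * m.+1)).
    by rewrite -mulnA leq_mul2l; apply/orP; right; clear; lia.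
  by rewrite leq_mul2r; apply/orP; right; clear; lia.
have b3 : 24 <= pw (kap / N%:R).
  apply: (cm' 24); rewrite mulnS; apply: leq_trans (leq_addr _ _); exact: leq_addl.
have b4 : 256 <= pw kap.
  apply: le_trans b1; rewrite (ler_nat _ 256) /c1; apply: (@leq_trans (512 * 1)); first by [].
  by rewrite leq_mul2l /= !muln_gt0 expn_gt0.
have HmN' : (m * N <= H)%N by apply: leq_trans HmN; apply: leq_addr.
have [Y [f prof]] := profile_exists hpw HmN' hA hS hB I0 hC b1 kap1'.
have flip := profile_lipschitz hpw HmN' I0 hSB b4 prof.
have f0 := profile_origin hpw HmN' I0 hA hS hB b4 prof.
have flow := profile_lower hpw I0 prof hF.
rewrite kp in flip.
have [n [B1 [B2 [/andP[n1 n2] nB gd]]]] : exists n B1 B2,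
    [/\ (((Num.truncn (8 / p)).+1 <= n <= nmax)%N : bool), (B1 + B2 <= nmax)%N & good_scale f N p n B1 B2].
  apply: (branching N f (al - 5 * kap) (be - 5 * kap)) => //.
  - by apply: leq_trans hN; rewrite leq_pmull.
  - by move: al1 kap1; clear; lra.
  - by move: albe kp kap0; clear; lra.
  move=> i j ij; have [/eqP|ij0] := posnP (i + j)%N.
    by rewrite addn_eq0 => /andP[/eqP-> /eqP->]; rewrite !mulr0 addr0 subrr.
  have ij1 : 1 <= i%:R + j%:R :> R by rewrite -natrD (ler_nat _ 1).
  have := ler_wpM2l (ltW kap0) ij1; have := flow i j ij; move: f0.
  by move: (i%:R) (j%:R) (f i j) (f _ _) => x y z t; clear; lra.
have nR : n%:R <= nmax%:R :> R by rewrite ler_nat.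
have BR : (B1 + B2)%:R <= nmax%:R :> R by rewrite ler_nat.
have n_large : 8 <= 1000 * kap * n%:R.
  rewrite kp mulrC -ler_pdivrMr //; apply: le_trans (ltW (truncnS_gt _)) _.
  by rewrite ler_nat.
have BnN : (B1 + n + (B2 + n) <= N)%N by move: nB n2 hN; clear; lia.
have [i0 i0Y] := profile_nonempty I0 prof.
rewrite -kp in gd.
apply: le_trans (descent_pairs hpw HmN I0 Ismall hSB b2 kap1 prof i0Y gd n_large BnN b3 _ hm); last first.
  by apply: leq_trans hm; rewrite addnS.
rewrite ler_wpM2r ?sqr_ge0 // (ler_pw hpw).
have hf := @branching_increments _ f N p 0 0 B1 B2 flip ltac:(by move: nB hN; clear; lia).
have {}hf : f B1 B2 <= f 0%N 0%N + (2 + p / 100) * (B1 + B2)%:R by case/andP: hf.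
have hNB : (N - B1 - B2)%:R <= N%:R :> R by rewrite ler_nat -subnDA leq_subr.
have kN : kap / N%:R <= kap by rewrite ler_pdivrMr ?ltr0n // ler_peMr ?ler1n // ltW.
have n0 : 0 <= n%:R :> R by [].
have hBB : (2 + p / 100) * (B1 + B2)%:R <= 3 * nmax%:R.
  by apply: ler_pM => //; move: p0 p1; clear; lra.
have hn : p / 8 * n%:R <= 1 * nmax%:R by apply: ler_pM => //; move: p0 p1; clear; lra.
rewrite kp; move: hf hNB kN hBB hn f0 kap1; clear.
move: (nmax%:R) (N%:R) ((N - B1 - B2)%:R) (kap / _) (_ * (B1 + B2)%:R) (p / 8 * _) (f B1 B2) (f _ _).
by move=> x1 x2 x3 x4 x5 x6 x7 x8; lra.
Qed.

(** * Rounding to the grid *)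

Section Rounding.
Variable R : realFieldType.
Implicit Types x y : R.

Lemma normM_le x y a b : `|x| <= a -> `|y| <= b -> `|x * y| <= a * b.
Proof. by move=> xa yb; rewrite normrM ler_pM. Qed.

Lemma norm_diff_le1 x y : 0 <= x <= 1 -> 0 <= y <= 1 -> `|x - y| <= 1.
Proof. by move=> h1 h2; rewrite ler_norml; apply/andP; split; lra. Qed.

(** Slopes and heights are sheared by [s + 1] and [b + a + 2] so that all grid
    coordinates are nonnegative; the shear preserves the vertical distance of a
    point to a line. *)
Lemma rounded_offset (h a1 a2 b1 b2 s A1 A2 B1 B2 S t1 t2 u1 u2 v : R) :
  0 < h <= 1 -> `|a1| <= 1 -> `|a2| <= 1 -> `|s| <= 1 ->
  0 <= t1 <= 1 -> 0 <= t2 <= 1 -> 0 <= u1 <= 1 -> 0 <= u2 <= 1 -> 0 <= v <= 1 ->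
  a1 + 1 = h * (A1 + t1) -> a2 + 1 = h * (A2 + t2) -> s + 1 = h * (S + v) ->
  b1 + a1 + 2 = h ^+ 2 * (B1 + u1) -> b2 + a2 + 2 = h ^+ 2 * (B2 + u2) ->
  `|b2 - b1 - s * (a2 - a1)| <= h ^+ 2 * `|B2 - B1 - S * (A2 - A1)| + 6 * h.
Proof.
move=> /andP[h0 h1] na1 na2 ns ht1 ht2 hu1 hu2 hv ea1 ea2 es eb1 eb2.
have -> : b2 - b1 - s * (a2 - a1) = h ^+ 2 * (B2 - B1 - S * (A2 - A1))
   + h * (h * (u2 - u1) - (s + 1) * (t2 - t1) - v * (a2 - a1) + h * (v * (t2 - t1))).
  have -> : b2 = h ^+ 2 * (B2 + u2) - h * (A2 + t2) - 1 by rewrite -eb2 -ea2; ring.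
  have -> : b1 = h ^+ 2 * (B1 + u1) - h * (A1 + t1) - 1 by rewrite -eb1 -ea1; ring.
  have -> : s = h * (S + v) - 1 by rewrite -es; ring.
  have -> : a2 = h * (A2 + t2) - 1 by rewrite -ea2; ring.
  have -> : a1 = h * (A1 + t1) - 1 by rewrite -ea1; ring.
  ring.
apply: le_trans (ler_normD _ _) _; rewrite [`|h ^+ 2 * _|]normrM (ger0_norm (sqr_ge0 h)).
rewrite lerD2l normrM (gtr0_norm h0) [leRHS]mulrC ler_pM2l //.
have hh : `|h| <= 1 by rewrite gtr0_norm.
have ht := norm_diff_le1 ht2 ht1; have hu := norm_diff_le1 hu2 hu1.
have nv : `|v| <= 1 by rewrite ger0_norm; case/andP: hv.
have k1 := normM_le hh hu.
have k2 : `|(s + 1) * (t2 - t1)| <= 2 * 1.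
  by apply: normM_le => //; apply: le_trans (ler_normD _ _) _; rewrite normr1; move: ns; lra.
have k3 : `|v * (a2 - a1)| <= 1 * 2.
  by apply: normM_le => //; apply: le_trans (ler_normB _ _) _; move: na1 na2; lra.
have k4 := normM_le hh (normM_le nv ht).
apply: le_trans (ler_normD _ _) _; apply: le_trans (lerD (ler_normB _ _) (lexx _)) _.
apply: le_trans (lerD (lerD (ler_normB _ _) (lexx _)) (lexx _)) _.
by move: k1 k2 k3 k4; lra.
Qed.

(** [c] is the left end of a column, [r0] and [r] are positions in it: members of
    one tile lie in one sheared box of the Frostman condition. *)
Lemma rounded_cell (h u w a0 a b0 b s0 s c r0 r B0 B S0 S t0 t y0 y v0 v : R) :
  0 < h <= 1 -> `|a| <= 1 -> `|a0| <= 1 -> `|s| <= 1 -> `|s0| <= 1 ->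
  0 <= t0 <= 1 -> 0 <= t <= 1 -> 0 <= y0 <= 1 -> 0 <= y <= 1 ->  0 <= v0 <= 1 -> 0 <= v <= 1 ->
  0 <= r0 -> 0 <= r -> h * (r0 + 1) <= u -> h * (r + 1) <= u -> u <= 1 ->
  a0 + 1 = h * (c + r0 + t0) -> a + 1 = h * (c + r + t) ->
  s0 + 1 = h * (S0 + v0) -> s + 1 = h * (S + v) ->
  b0 + a0 + 2 = h ^+ 2 * (B0 + y0) -> b + a + 2 = h ^+ 2 * (B + y) ->
  `|s - s0| <= w -> h ^+ 2 * `|(B - S * r) - (B0 - S0 * r0)| <= u * w ->
  `|b - b0 - s0 * (a - a0)| <= 2 * (u * w) + 4 * h.
Proof.
move=> /andP[h0 h1] na na0 ns ns0 ht0 ht hy0 hy hv0 hv hr0 hr ur0 ur u1 ea0 ea es0 es eb0 eb sw lw.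
have -> : b - b0 - s0 * (a - a0) = h ^+ 2 * ((B - S * r) - (B0 - S0 * r0))
   + (s - s0) * (h * r) + h * (h * (y - y0) - (v * (h * r) - v0 * (h * r0)) - (s0 + 1) * (t - t0)).
  have -> : b = h ^+ 2 * (B + y) - h * (c + r + t) - 1 by rewrite -eb -ea; ring.
  have -> : b0 = h ^+ 2 * (B0 + y0) - h * (c + r0 + t0) - 1 by rewrite -eb0 -ea0; ring.
  have -> : s0 = h * (S0 + v0) - 1 by rewrite -es0; ring.
  have -> : s = h * (S + v) - 1 by rewrite -es; ring.
  have -> : a = h * (c + r + t) - 1 by rewrite -ea; ring.
  have -> : a0 = h * (c + r0 + t0) - 1 by rewrite -ea0; ring.
  ring.
have hh : `|h| <= 1 by rewrite gtr0_norm.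
have hr_le (z : R) : 0 <= z -> h * (z + 1) <= u -> 0 <= h * z <= u.
  move=> z0; rewrite mulrDr mulr1 => zu; rewrite mulr_ge0 ?(ltW h0) //=.
  by move: zu h0; lra.
have /andP[hr1 hr2] := hr_le _ hr ur; have /andP[hr3 hr4] := hr_le _ hr0 ur0.
have k1 := normM_le hh (norm_diff_le1 hy hy0).
have hv_le (z z' : R) : 0 <= z <= 1 -> 0 <= z' <= u -> 0 <= z * z' <= 1.
  move=> /andP[z0 z1] /andP[z2 z3]; rewrite mulr_ge0 //=.
  by rewrite -[leRHS]mulr1 ler_pM // (le_trans z3).
have k2 := norm_diff_le1 (hv_le _ _ hv (hr_le _ hr ur)) (hv_le _ _ hv0 (hr_le _ hr0 ur0)).
have k3 : `|(s0 + 1) * (t - t0)| <= 2 * 1.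
  apply: normM_le; last exact: norm_diff_le1.
  by apply: le_trans (ler_normD _ _) _; rewrite normr1; move: ns0; lra.
have k4 : `|(s - s0) * (h * r)| <= w * u by apply: normM_le => //; rewrite ger0_norm.
apply: le_trans (ler_normD _ _) _; apply: le_trans (lerD (ler_normD _ _) (lexx _)) _.
rewrite [`|h ^+ 2 * _|]normrM (ger0_norm (sqr_ge0 h)).
apply: (@le_trans _ _ (u * w + w * u + h * 4)); last by lra.
apply: lerD; first by apply: lerD.
rewrite normrM (gtr0_norm h0) ler_pM2l //.
apply: le_trans (ler_normB _ _) _; apply: le_trans (lerD (ler_normB _ _) (lexx _)) _.
by move: k1 k2 k3; lra.
Qed.
End Rounding.

Require Import Defs.
From mathcomp Require Import finmap.
From mathcomp Require Import all_classical all_reals all_analysis.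

Local Open Scope ring_scope.

(** * From the phase space to the grid *)

Lemma powR2_expR (R : realType) (x : R) : 2 `^ x = expR (x * ln 2).
Proof. by rewrite /powR (negbTE (_ : (2 : R) != 0)) // pnatr_eq0. Qed.

Lemma ln2_gt0 (R : realType) : 0 < ln 2 :> R.
Proof. by rewrite ln_gt0 // (ltr_nat _ 1 2). Qed.

Lemma powR2_le (R : realType) (x y : R) : (2 `^ x <= 2 `^ y) = (x <= y).
Proof. by rewrite !powR2_expR ler_expR ler_pM2r ?ln2_gt0. Qed.

Lemma powR2D (R : realType) (x y : R) : 2 `^ (x + y) = 2 `^ x * 2 `^ y.
Proof. by rewrite powRD // pnatr_eq0 implybT. Qed.

Lemma powR2N (R : realType) (n : nat) : (2 ^- n : R) = 2 `^ (- n%:R).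
Proof. by rewrite powRN powR_mulrn. Qed.

Lemma powR2_dyadic (R : realType) m : (0 < m)%N -> dyadic_power m (fun x : R => 2 `^ (m%:R * x)).
Proof.
move=> m0; split=> [x|x y|x y|k]; first by rewrite powR_gt0.
- by rewrite mulrDr powR2D.
- by rewrite powR2_le ler_pM2l // ltr0n.
- by rewrite -natrM powR_mulrn // natrX.
Qed.

Lemma card_le_fset_set (K : choiceType) (I : finType) (f : I -> K) (S : {set I})
    (E : set K) : finite_set E -> {in S &, injective f} -> (forall i, i \in S -> E (f i)) ->
  (#|S| <= #|` fset_set E|)%N.
Proof.
move=> finE injf hE; rewrite cardE -(size_map f) cardfE -cardfE.
apply: uniq_leq_size.
  by rewrite map_inj_in_uniq ?enum_uniq // => i j; rewrite !mem_enum; apply: injf.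
by move=> x /mapP[i]; rewrite mem_enum => iS ->; rewrite in_fset_set // inE; apply: hE.
Qed.

(** The point of the ray with the abscissa of [z] is close enough. *)
Lemma dist_to_ray_le (R : realType) (omega : R * R * R) (z : R * R) (d : R) :
  omega.1.1 <= z.1 -> `|z.2 - omega.1.2 - omega.2 * (z.1 - omega.1.1)| <= d ->
  dist_to_set z (forward_ray omega) <= d.
Proof.
move=> h1 h2; apply: le_trans h2; rewrite /dist_to_set; apply: ge_inf.
  by exists 0 => _ [q _ <-]; rewrite sqrtr_ge0.
exists (omega.1.1 + (z.1 - omega.1.1), omega.1.2 + omega.2 * (z.1 - omega.1.1)).
  by exists (z.1 - omega.1.1) => //=; rewrite subr_ge0.
rewrite /eucl_dist /= [omega.1.1 + _]addrC subrK subrr expr0n /= add0r sqrtr_sqr.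
by rewrite opprD addrA.
Qed.

Section Grid.
Variables (R : realType) (H : nat).

Definition grid_pos (w : R * R * R) := Num.truncn ((w.1.1 + 1) * 2 ^+ H).
Definition grid_slope (w : R * R * R) := Num.truncn ((w.2 + 1) * 2 ^+ H).
(** The offset [2 ^ (2 * H + 2)] keeps the intercepts nonnegative at every column. *)
Definition grid_height (w : R * R * R) :=
  (Num.truncn ((w.1.2 + w.1.1 + 2) * 2 ^+ (2 * H)) + 2 ^ (2 * H + 2))%N.

Lemma truncn_frac (x : R) n : 0 <= x ->
  exists2 t, 0 <= t <= 1 & x = 2 ^- n * ((Num.truncn (x * 2 ^+ n))%:R + t).
Proof.
move=> x0; have y0 : 0 <= x * 2 ^+ n by rewrite mulr_ge0 // exprn_ge0.
exists (x * 2 ^+ n - (Num.truncn (x * 2 ^+ n))%:R).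
  rewrite subr_ge0 truncn_le // y0 /= lerBlDl natr1.
  by rewrite ltW // truncnS_gt.
by rewrite addrC subrK mulrC mulfK // expf_neq0 // pnatr_eq0.
Qed.

Lemma phase_norm (w : R * R * R) : @phase_space R w ->
  [/\ `|w.1.1| <= 1, `|w.1.2| <= 1 & `|w.2| <= 1].
Proof.
by case=> -[/= h1 h2] h3; split; rewrite ler_norml -?(mem_setE, in_itv); move: h1 h2 h3; rewrite /= !in_itv.
Qed.

Lemma truncn_lt2 (x : R) n c : 0 <= x -> x < (2 ^ c)%:R ->
  (Num.truncn (x * 2 ^+ n) < 2 ^ (n + c))%N.
Proof.
move=> x0 xc; rewrite -(ltr_nat R); apply: (@le_lt_trans _ _ (x * 2 ^+ n)).
  by rewrite truncn_le // mulr_ge0 // exprn_ge0.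
by rewrite addnC expnD natrM (natrX _ 2 n) ltr_pM2r ?exprn_gt0.
Qed.

Lemma grid_bounds w : @phase_space R w ->
  [/\ (grid_pos w < 2 ^ H.+2)%N, (grid_slope w < 2 ^ H.+2)%N,
      (grid_height w < 2 ^ (2 * H + 4))%N & (grid_slope w * 2 ^ H <= grid_height w)%N].
Proof.
case/phase_norm; rewrite !ler_norml => /andP[a1 a2] /andP[b1 b2] /andP[s1 s2].
have hs : (grid_slope w < 2 ^ H.+2)%N.
  by rewrite -(addn2 H) /grid_slope; apply: truncn_lt2; rewrite ?natrX; lra.
split=> //.
- by rewrite -(addn2 H) /grid_pos; apply: truncn_lt2; rewrite ?natrX; lra.
- rewrite /grid_height; have : (Num.truncn ((w.1.2 + w.1.1 + 2) * 2 ^+ (2 * H)) < 2 ^ (2 * H + 3))%N.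
    by apply: truncn_lt2; rewrite ?natrX; lra.
  by rewrite !expnD; move: (2 ^ (2 * H))%N (Num.truncn _) => x y; lia.
apply: (@leq_trans (2 ^ (2 * H + 2))); last exact: leq_addl.
apply: (@leq_trans (2 ^ H.+2 * 2 ^ H)); first by rewrite leq_mul2r (ltnW hs) orbT.
by rewrite -expnD leq_exp2l //; lia.
Qed.
End Grid.

Section GridGeometry.
Variables (R : realType) (H : nat) (w0 w : R * R * R).
Hypotheses (h0 : @phase_space R w0) (h : @phase_space R w).

Let A := grid_pos H w. Let A0 := grid_pos H w0.
Let S := grid_slope H w. Let S0 := grid_slope H w0.
Let B := grid_height H w. Let B0 := grid_height H w0.

Let hh : 0 < (2 ^- H : R) <= 1.
Proof. by rewrite invr_gt0 exprn_gt0 //= invf_le1 ?exprn_gt0 // exprn_ege1 // (ler_nat _ 1). Qed.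

Let pos_ge0 (z : R * R * R) : @phase_space R z ->
  [/\ 0 <= z.1.1 + 1, 0 <= z.2 + 1 & 0 <= z.1.2 + z.1.1 + 2].
Proof.
by case/phase_norm; rewrite !ler_norml => /andP[a1 a2] /andP[b1 b2] /andP[s1 s2]; split; lra.
Qed.

Let h2E : (2 ^- (2 * H) : R) = (2 ^- H) ^+ 2.
Proof. by rewrite -exprVn mulnC exprM exprVn. Qed.

Let height_frac (z : R * R * R) : @phase_space R z -> exists2 t : R, 0 <= t <= 1 &
  z.1.2 + z.1.1 + 2 = (2 ^- H) ^+ 2 * ((grid_height H z)%:R - (2 ^ (2 * H + 2))%:R + t).
Proof.
case/pos_ge0 => _ _ /(truncn_frac (2 * H)); rewrite h2E => -[t t1 t2]; exists t => //.
by rewrite /grid_height natrD addrK.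
Qed.

(** Strict inequality of the grid abscissae orders the true ones, so that the
    second point is ahead of the first one. *)
Lemma grid_offset d : (A0 < A)%N -> nat_near d B (B0 + S0 * (A - A0)) ->
  w0.1.1 <= w.1.1 /\
  `|w.1.2 - w0.1.2 - w0.2 * (w.1.1 - w0.1.1)| <= 2 ^- (2 * H) * d%:R + 6 * 2 ^- H.
Proof.
move=> AA nr; have [hp0 hq0 _] := pos_ge0 h0; have [hp _ _] := pos_ge0 h.
have [t0 ht0 et0] := truncn_frac H hp0; have [t ht et] := truncn_frac H hp.
have [v hv ev] := truncn_frac H hq0.
have [y0 hy0 ey0] := height_frac h0; have [y hy ey] := height_frac h.
have [na0 _ ns0] := phase_norm h0; have [na _ _] := phase_norm h.
split.
  rewrite -(lerD2r 1) et et0 ler_pM2l; last by case/andP: hh.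
  apply: (@le_trans _ _ A0.+1%:R); first by rewrite -(natr1 A0) lerD2l; case/andP: ht0.
  apply: (@le_trans _ _ A%:R); first by rewrite ler_nat.
  by rewrite lerDl; case/andP: ht.
apply: le_trans (rounded_offset hh na0 na ns0 ht0 ht hy0 hy hv et0 et ev ey0 ey) _.
rewrite lerD2r h2E ler_pM2l; last by rewrite exprn_gt0 //; case/andP: hh.
rewrite -/(grid_pos H w) -/(grid_pos H w0) -/(grid_slope H w0) -/A -/A0 -/S0 -/B -/B0 -(natrB _ (ltnW AA)) -natrM opprB addrA subrK.
move: nr; rewrite /nat_near -!(ler_nat R) !natrD ler_norml => /andP[n1 n2].
by apply/andP; split; move: n1 n2; lra.
Qed.

Let same_cell_le (x x0 t t0 u : R) (X X0 U : nat) : (0 < U)%N ->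
  (X %/ U = X0 %/ U)%N -> 0 <= t <= 1 -> 0 <= t0 <= 1 -> 2 ^- H * U%:R = u ->
  x + 1 = 2 ^- H * (X%:R + t) -> x0 + 1 = 2 ^- H * (X0%:R + t0) -> `|x - x0| <= u.
Proof.
move=> U0 e /andP[t1 t2] /andP[t3 t4] eu ex ex0; have /andP[hgt0 _] := hh.
have -> : x - x0 = 2 ^- H * ((X %% U)%N%:R + t - ((X0 %% U)%N%:R + t0)).
  have -> : x - x0 = (x + 1) - (x0 + 1) by ring.
  rewrite ex ex0 {1}(divn_eq X U) {1}(divn_eq X0 U) e !natrD; ring.
rewrite normrM (gtr0_norm hgt0) -eu ler_pM2l // ler_norml.
have k (Y : nat) : ((Y %% U)%N%:R : R) + 1 <= U%:R by rewrite natr1 ler_nat ltn_pmod.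
have := k X; have := k X0; have := ler0n R (X %% U); have := ler0n R (X0 %% U).
by move: (_%:R) (_%:R) (_%:R) => x1 x2 x3 g1 g2 g3 g4; apply/andP; split; lra.
Qed.

Lemma same_tile_offset m i j : (m * i + m * j + 1 <= H)%N ->
  (A %/ cell_size m H i = A0 %/ cell_size m H i)%N -> (S %/ cell_size m H j = S0 %/ cell_size m H j)%N ->
  ((B - S * (A %% cell_size m H i)) %/ (cell_size m H i * cell_size m H j)
     = (B0 - S0 * (A0 %% cell_size m H i)) %/ (cell_size m H i * cell_size m H j))%N ->
  let u := 2 ^- (m * i) in let v := 2 ^- (m * j) in
  [/\ `|w.1.1 - w0.1.1| <= u, `|w.2 - w0.2| <= v &
     `|w.1.2 - w0.1.2 - w0.2 * (w.1.1 - w0.1.1)| <= 4 * (u * v)].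
Proof.
move=> mH eA eS eB u v.
have [hp0 hq0 _] := pos_ge0 h0; have [hp hq _] := pos_ge0 h.
have [t0 ht0 et0] := truncn_frac H hp0; have [t ht et] := truncn_frac H hp.
have [v0 hv0 ev0] := truncn_frac H hq0; have [v1 hv1 ev1] := truncn_frac H hq.
have [y0 hy0 ey0] := height_frac h0; have [y hy ey] := height_frac h.
have [na0 _ ns0] := phase_norm h0; have [na _ ns] := phase_norm h.
have szE (j' : nat) : (m * j' <= H)%N -> (2 ^- H : R) * (cell_size m H j')%:R = 2 ^- (m * j').
  move=> hj; have -> : (2 ^- H : R) = 2 ^- (m * j') * 2 ^- (H - m * j').
    by rewrite -invfM -exprD subnKC.
  by rewrite /cell_size natrX divfK // expf_neq0 // pnatr_eq0.
have uE := szE i ltac:(by move: mH; clear; lia).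
have vE := szE j ltac:(by move: mH; clear; lia).
have sz0 j' : (0 < cell_size m H j')%N := cell_size_gt0 m H j'.
have du := same_cell_le (sz0 i) eA ht ht0 uE et et0.
have dv := same_cell_le (sz0 j) eS hv1 hv0 vE ev1 ev0.
split=> //; rewrite -/u -/v in uE vE.
have le_u (Y : nat) : (2 ^- H : R) * ((Y %% cell_size m H i)%N%:R + 1) <= u.
  by rewrite -uE ler_pM2l ?natr1 ?ler_nat ?ltn_pmod //; case/andP: hh.
have u1 : u <= 1 by rewrite invf_le1 ?exprn_gt0 // exprn_ege1 // (ler_nat _ 1).
have cE (Y : nat) : Y%:R = (Y %/ cell_size m H i * cell_size m H i)%N%:R + (Y %% cell_size m H i)%N%:R :> R.
  by rewrite -natrD -divn_eq.
rewrite -/(grid_pos H w0) -/A0 (cE A0) -eA in et0; rewrite -/(grid_pos H w) -/A (cE A) in et.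
have lamE (z : R * R * R) : @phase_space R z ->
  ((grid_height H z - grid_slope H z * (grid_pos H z %% cell_size m H i))%N%:R : R)
   = (grid_height H z)%:R - (grid_slope H z)%:R * (grid_pos H z %% cell_size m H i)%N%:R.
  move=> /(grid_bounds H)[_ _ _ k]; rewrite natrB ?natrM //; apply: leq_trans k.
  by rewrite leq_mul2l ltnW ?orbT // (leq_trans (ltn_pmod _ (sz0 i))) // leq_exp2l // leq_subr.
have lw : (2 ^- H) ^+ 2 * `|(B%:R - (2 ^ (2 * H + 2))%:R - S%:R * (A %% cell_size m H i)%N%:R) -
    (B0%:R - (2 ^ (2 * H + 2))%:R - S0%:R * (A0 %% cell_size m H i)%N%:R)| <= u * v.
  have -> : (B%:R - (2 ^ (2 * H + 2))%:R - S%:R * (A %% cell_size m H i)%N%:R) -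
    (B0%:R - (2 ^ (2 * H + 2))%:R - S0%:R * (A0 %% cell_size m H i)%N%:R) =
    (B - S * (A %% cell_size m H i))%N%:R - (B0 - S0 * (A0 %% cell_size m H i))%N%:R :> R.
    by rewrite (lamE w h) (lamE w0 h0) -/B -/B0 -/S -/S0 -/A -/A0; ring.
  have -> : u * v = (2 ^- H) ^+ 2 * (cell_size m H i * cell_size m H j)%N%:R.
    by rewrite -uE -vE natrM; ring.
  rewrite ler_pM2l; last by rewrite exprn_gt0 //; case/andP: hh.
  have UW0 : (0 < cell_size m H i * cell_size m H j)%N by rewrite muln_gt0 !sz0.
  set x := (B - _)%N; set x0 := (B0 - _)%N.
  have k5 : (x <= x0 + cell_size m H i * cell_size m H j)%N by apply: div_eq_le UW0 eB.
  have k6 : (x0 <= x + cell_size m H i * cell_size m H j)%N by apply: div_eq_le UW0 (esym eB).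
  move: k5 k6; rewrite -!(ler_nat R) !natrD ler_norml.
  by move: (_%:R) (_%:R) (_%:R) => z1 z2 z3 g1 g2; apply/andP; split; lra.
have r_ge0 (Y : nat) : 0 <= (Y %% cell_size m H i)%N%:R :> R by [].
apply: le_trans (rounded_cell hh na na0 ns ns0 ht0 ht hy0 hy hv0 hv1 (r_ge0 A0) (r_ge0 A)
  (le_u _) (le_u _) u1 et0 et ev0 ev1 ey0 ey dv lw) _.
have h2 : 2 * (2 ^- H) <= u * v.
  rewrite /u /v -invfM -exprD.
  have -> : (2 ^- H : R) = 2 ^- (m * i + m * j) * 2 ^- (H - (m * i + m * j)).
    by rewrite -invfM -exprD subnKC //; move: mH; clear; lia.
  rewrite mulrCA ger_pMr ?invr_gt0 ?exprn_gt0 // ler_pdivrMr ?exprn_gt0 // mul1r.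
  by rewrite -[leLHS]expr1 ler_weXn2l ?(ler_nat _ 1) //; move: mH; clear; lia.
by move: h2; move: (u * v) (2 ^- H) => x y'; lra.
Qed.
End GridGeometry.

(** A tile fits into a box that is four times too high, and four times too wide
    in one of the two other directions; that direction must be a refined one for
    the box to be admissible, whence the case distinction. *)
Lemma Frostman_tile (R : realType) (delta alpha beta C : R) (X : {fset R * R * R})
    (H m i j : nat) k :
  0 <= C -> alpha <= 2 -> beta <= 2 -> Frostman delta alpha beta C X ->
  (0 < i + j)%N -> (2 <= m)%N -> (m * i + m * j + 1 <= H)%N ->
  delta <= 2 ^- (m * i) * 2 ^- (m * j) ->
  #|[set v : X | tile (fun v => grid_pos H (val v)) (fun v => grid_height H (val v))
     (fun v => grid_slope H (val v)) (cell_size m H i) (cell_size m H j) v == k]|%:R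
   <= C * 16 * ((2 ^- (m * i)) `^ alpha * (2 ^- (m * j)) `^ beta) * #|` X|%:R.
Proof.
move=> C0 al2 be2 [_ Xphase hF] ij m2 mH hdelta.
set T := [set v : X | _]%SET; set u := 2 ^- (m * i); set v := 2 ^- (m * j).
have [T0|[v0 v0T]] := set_0Vmem T.
  by rewrite T0 cards0 !mulr_ge0 ?powR_ge0.
have inX (x : X) : @phase_space R (val x) by apply: Xphase; apply: valP.
have pw_le1 n : 0 < (2 ^- n : R) <= 1.
  by rewrite invr_gt0 exprn_gt0 //= invf_le1 ?exprn_gt0 // exprn_ege1 // (ler_nat _ 1).
have small l : (0 < l)%N -> 4 * (2 ^- (m * l) : R) <= 1.
  move=> l0; rewrite mulrC ler_pdivrMl ?exprn_gt0 // mulr1.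
  rewrite (_ : 4 = 2 ^+ 2 :> R); last by rewrite -natrX.
  by rewrite ler_weXn2l ?(ler_nat _ 1) // (leq_trans m2) // leq_pmulr.
have /andP[u0 u1] : 0 < u <= 1 := pw_le1 _; have /andP[w0 w1] : 0 < v <= 1 := pw_le1 _.
have close x : x \in T -> [/\ `|(val x).1.1 - (val v0).1.1| <= u, `|(val x).2 - (val v0).2| <= v &
     `|(val x).1.2 - (val v0).1.2 - (val v0).2 * ((val x).1.1 - (val v0).1.1)| <= 4 * (u * v)].
  rewrite inE => /eqP xk; move: v0T; rewrite inE -xk => /eqP[e1 e2 e3].
  by apply: (same_tile_offset (inX v0) (inX x) mH).
have cover u' v' : u <= u' -> v <= v' -> 4 * (u * v) <= u' * v' -> 0 < u' <= 1 -> 0 < v' <= 1 ->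
    #|T|%:R <= C * u' `^ alpha * v' `^ beta * #|` X|%:R.
  move=> uu vv uv hu' hv'.
  apply: le_trans (hF (val v0).1.1 (val v0).1.2 (val v0).2 u' v' hu' hv' _); last first.
    apply: le_trans hdelta _; apply: le_trans uv; rewrite ler_peMl ?(ler_nat _ 1) // mulr_ge0 //; exact: ltW.
  rewrite ler_nat; apply: (card_le_fset_set (f := val)).
  - by apply: sub_finite_set (finite_fset X); apply: subIset; left.
  - by move=> x y _ _; apply: val_inj.
  move=> x /close[c1 c2 c3]; split; first exact: valP.
  exists ((val x).1.1 - (val v0).1.1, (val x).1.2 - (val v0).1.2 - (val v0).2 * ((val x).1.1 - (val v0).1.1), (val x).2 - (val v0).2).
    split; [split|] => /=; rewrite in_itv /= -ler_norml //.
    - exact: le_trans c1 uu.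
    - exact: le_trans c3 uv.
    - exact: le_trans c2 vv.
  case: (val x) => -[a b] s /=; congr (_, _, _); ring.
have four (a x : R) : a <= 2 -> 0 < x -> (4 * x) `^ a <= 16 * x `^ a.
  move=> a2 x0; rewrite powRM ?(ltW x0) // ler_wpM2r ?powR_ge0 //.
  apply: (@le_trans _ _ (4 `^ 2)); first by apply: ler_powR; rewrite ?(ler_nat _ 1).
  by rewrite powR_mulrn // -natrX ler_nat.
have uv0 : 0 <= u * v by rewrite mulr_ge0 // ltW.
have le4 (x : R) : 0 < x -> x <= 4 * x by move=> x0; lra.
have c0 : 0 <= C * (u `^ alpha * v `^ beta) by rewrite !mulr_ge0 ?powR_ge0.
rewrite [leRHS]mulrAC -mulrA -[leRHS]mulrA; apply: (@le_trans _ _ (C * (16 * (u `^ alpha * v `^ beta)) * #|` X|%:R)); last first.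
  by rewrite le_eqVlt; apply/orP; left; apply/eqP; ring.
have [i0|i0] := posnP i.
  have j0 : (0 < j)%N by move: ij; rewrite i0.
  apply: le_trans (cover u (4 * v) _ _ _ _ _) _; rewrite ?u0 ?u1 ?le4 ?small ?mulr_gt0 //.
    by rewrite mulrCA.
  rewrite ler_wpM2r // -mulrA ler_wpM2l // mulrCA ler_wpM2l ?powR_ge0 //; exact: four.
apply: le_trans (cover (4 * u) v _ _ _ _ _) _; rewrite ?w0 ?w1 ?le4 ?small ?mulr_gt0 //.
  by rewrite mulrA.
rewrite ler_wpM2r // -mulrA ler_wpM2l // mulrA ler_wpM2r ?powR_ge0 //; exact: four.
Qed.

(** Exponential growth, from [1 + x <= expR x] alone. *)
Lemma powR2_growth (R : realType) (t : R) (c : nat) : 0 < t ->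
  exists m0 : nat, forall m, (m0 <= m)%N -> (c * m.+1)%N%:R <= 2 `^ (m%:R * t).
Proof.
move=> t0; pose r := t * ln 2; have r0 : 0 < r by rewrite mulr_gt0 ?ln2_gt0.
exists (Num.truncn (8 * c%:R / r ^+ 2)).+1 => m hm.
have m0 : (0 < m)%N by apply: leq_ltn_trans hm.
have hc : 8 * c%:R <= m%:R * r ^+ 2.
  rewrite -ler_pdivrMr ?exprn_gt0 //; apply: le_trans (ltW (truncnS_gt _)) _.
  by rewrite ler_nat.
have y0 : 0 <= m%:R * r by rewrite mulr_ge0 // ltW.
rewrite powR2_expR -mulrA -/r; set y := m%:R * r in y0 *.
have -> : y = y / 2 + y / 2 by lra.
have h1 : 1 + y / 2 <= expR (y / 2) by exact: expR_ge1Dx.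
have h2 : (y / 2) * (y / 2) <= expR (y / 2) * expR (y / 2) by apply: ler_pM; lra.
rewrite expRD; apply: le_trans h2.
apply: (@le_trans _ _ (2 * c * m)%N%:R); first by rewrite ler_nat; move: m0; clear; nia.
have := ler_wpM2r (ler0n R m) hc; rewrite /y !natrM.
by move: (m%:R : R) (c%:R : R) => a b; clear; lra.
Qed.

Lemma halve_exponent (R : realFieldType) (x z a b i j : R) :
  x * (z - a * i - b * j) = x * (z / 2) + x * (z / 2) + (- (x * i) * a + - (x * j) * b).
Proof. by field. Qed.

Theorem theoremC (R : realType) (alpha beta epsilon : R)
    (halpha : 1 < alpha <= 2) (hbeta : 1 < beta <= 2)
    (hab : 3 < alpha + beta) (hepsilon : 0 < epsilon) :
  exists eta delta0 : R, [/\ 0 < eta, 0 < delta0 &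
    forall (k : nat) (delta : R),
      delta = 2 ^- k -> delta <= delta0 ->
      forall X : {fset R * R * R},
        Frostman delta alpha beta (delta `^ (- eta)) X ->
        delta `^ (1 + epsilon) * (#|` X|%:R) ^+ 2
          <= (ray_incidences delta X)%:R].
Proof.
have [/andP[al1 al2] /andP[be1 be2]] := (halpha, hbeta).
pose p := Num.min (1 / 100) ((alpha + beta - 3) / 3).
have p0 : 0 < p by rewrite /p lt_min; apply/andP; split; lra.
have p1 : p <= 1 / 100 by rewrite /p ge_min lexx.
have p2 : 3 + 3 * p <= alpha + beta.
  have : p <= (alpha + beta - 3) / 3 by rewrite /p ge_min lexx orbT.
  by clear; lra.
have [nmax disc] := discrete_incidences (introT andP (conj p0 p1)).
(* large against [nmax / epsilon], so that the loss at the first scale is paid *)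
pose N := (3 * nmax + (Num.truncn ((7 * nmax%:R + 4) / epsilon)).+1 + 2)%N.
have N2 : (2 <= N)%N by rewrite leq_addl.
have N0 : (0 < N)%N by apply: leq_trans N2.
have NR : 0 < N%:R :> R by rewrite ltr0n.
have Neps : 7 * nmax%:R + 4 <= N%:R * epsilon.
  rewrite -ler_pdivrMr //; apply: le_trans (ltW (truncnS_gt _)) _.
  by rewrite ler_nat /N addnAC leq_addl.
have nN : (3 * nmax <= N)%N by rewrite /N -addnA leq_addr.
have [c hc] := disc N alpha beta nN N0 (ltW al1) p2.
pose kap := p / 1000; have kap0 : 0 < kap by move: p0; rewrite /kap; clear; lra.
have [m0 hm0] := powR2_growth (c + 16) (divr_gt0 kap0 NR).
pose m1 := maxn m0 (N + 4).
exists (kap / (4 * N%:R)), (2 ^- (N * m1)); split.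
- by rewrite divr_gt0 // mulr_gt0.
- by rewrite invr_gt0 exprn_gt0.
move=> k delta dE dle X frost.
have km : (N * m1 <= k)%N.
  move: dle; rewrite dE lef_pV2 ?posrE ?exprn_gt0 // ler_eXn2l // (ltr_nat _ 1 2) //.
pose m := (k %/ N)%N.
have m1m : (m1 <= m)%N by rewrite leq_divRL // mulnC.
have mm0 : (m0 <= m)%N by apply: leq_trans m1m; apply: leq_maxl.
have mN4 : (N + 4 <= m)%N by apply: leq_trans m1m; apply: leq_maxr.
have mN0 : (0 < m)%N by apply: leq_trans mN4; rewrite addnS.
have kE : k = (m * N + k %% N)%N by rewrite -divn_eq.
have kN : (k %% N < N)%N by rewrite ltn_mod.
pose pw (x : R) := 2 `^ (m%:R * x).
have hpw : dyadic_power m pw by apply: powR2_dyadic.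
have big := hm0 m mm0; rewrite -/(pw _) in big.
have X0 : (0 < #|` X|)%N by case: frost => h _ _; rewrite cardfs_gt0.
have Xphase (x : X) : @phase_space R (val x) by case: frost => _ h _; apply: h; apply: valP.
(* a grid much finer than [delta], and with more cells than [X] has points *)
pose H := (m * N + m + N + 3 + #|` X|)%N.
pose A (x : X) := grid_pos H (val x); pose B (x : X) := grid_height H (val x).
pose S (x : X) := grid_slope H (val x).
have XI : #|{: X}| = #|` X| by rewrite cardfE.
have main : pw (- N%:R - 7 * nmax%:R - 4) * #|` X|%:R ^+ 2 <=
      #|[set z : X * X | ((A z.1 < A z.2) &&
         nat_near (2 ^ (2 * H - m * N - N - 3)) (B z.2) (B z.1 + S z.1 * (A z.2 - A z.1)))%N]%SET|%:R.
  rewrite -XI; apply: (hc m pw hpw mN4 _ H X A B S).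
  - by apply: le_trans big; rewrite ler_nat leq_mul2r leq_addr orbT.
  - by rewrite /H -!addnA leq_add2l leq_addr.
  - by rewrite XI.
  - rewrite XI (leq_trans (ltnW (ltn_expl #|` X| (ltnSn 1)))) // leq_exp2l //.
    by rewrite /H; move: (m * N)%N (#|` X|) => x y; clear; lia.
  - by move=> x; have [] := grid_bounds H (Xphase x).
  - by move=> x; have [] := grid_bounds H (Xphase x).
  - by move=> x; have [] := grid_bounds H (Xphase x).
  - by move=> x; have [] := grid_bounds H (Xphase x).
  move=> i j ij key; rewrite XI.
  have big16 : 16 <= pw (kap / N%:R).
    apply: le_trans big; rewrite (ler_nat _ 16); apply: (@leq_trans (16 * 1)); first by [].
    by apply: leq_mul; rewrite // leq_addl.
  have kapN : kap / N%:R <= kap / 2.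
    by rewrite ler_pM2l // lef_pV2 ?posrE // (ler_nat _ 2).
  have [ij0|ij0] := posnP (i + j)%N.
    move: ij0 => /eqP; rewrite addn_eq0 => /andP[/eqP-> /eqP->]; rewrite !mulr0 !subr0.
    apply: (@le_trans _ _ #|` X|%:R); first by rewrite ler_nat -XI max_card.
    have pw1 : 1 <= pw kap by rewrite -[leLHS](pw0 hpw) (ler_pw hpw) ltW.
    by apply: ler_peMl.
  have mij : (m * i + m * j <= m * N)%N by rewrite -mulnDr leq_mul2l ij orbT.
  apply: le_trans (Frostman_tile key (powR_ge0 _ _) al2 be2 frost ij0 _ _ _) _.
  - by apply: leq_trans mN4; rewrite addnC.
  - by move: mij; rewrite /H; move: (m * i)%N (m * j)%N (m * N)%N => x y z; clear; lia.
  - rewrite dE -invfM -exprD lef_pV2 ?posrE ?exprn_gt0 // ler_weXn2l ?(ler_nat _ 1) //.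
    by apply: leq_trans mij _; rewrite [leqRHS]kE leq_addr.
  rewrite ler_wpM2r // dE !powR2N -!powRrM.
  have -> : pw (kap - alpha * i%:R - beta * j%:R) = pw (kap / 2) * pw (kap / 2) *
      (2 `^ (- (m * i)%:R * alpha) * 2 `^ (- (m * j)%:R * beta)).
    by rewrite /pw -!powR2D !natrM; rewrite -halve_exponent.
  rewrite ler_wpM2r ?mulr_ge0 ?powR_ge0 //; apply: ler_pM; rewrite ?powR_ge0 //; last first.
    by apply: le_trans big16 _; rewrite (ler_pw hpw).
  rewrite powR2_le mulrNN.
  have k2 : k%:R <= 2 * (m%:R * N%:R) :> R.
    rewrite -!natrM ler_nat [leqLHS]kE; move: kN mN0; move: (k %% N)%N => r; clear; nia.
  apply: (@le_trans _ _ (2 * (m%:R * N%:R) * (kap / (4 * N%:R)))).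
    by rewrite ler_wpM2r // ltW // divr_gt0 // mulr_gt0.
  by rewrite le_eqVlt; apply/orP; left; apply/eqP; field; rewrite pnatr_eq0 -lt0n.
apply: (@le_trans _ _ (pw (- N%:R - 7 * nmax%:R - 4) * #|` X|%:R ^+ 2)).
  rewrite ler_wpM2r ?sqr_ge0 // dE powR2N -powRrM /pw powR2_le.
  have : m%:R * (7 * nmax%:R + 4) <= m%:R * (N%:R * epsilon) by rewrite ler_wpM2l.
  have : m%:R * N%:R * (1 + epsilon) <= k%:R * (1 + epsilon).
    rewrite ler_wpM2r //; first by rewrite ltW // addr_gt0.
    by rewrite -natrM ler_nat [leqRHS]kE leq_addr.
  by move: (k%:R) (nmax%:R) (N%:R) (m%:R) => x1 x2 x3 x4; clear; lra.
apply: le_trans main _; rewrite ler_nat /ray_incidences.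
apply: (card_le_fset_set (f := fun z : X * X => (val z.1, val z.2))).
- apply: sub_finite_set (finite_setX (finite_fset X) (finite_fset X)).
  by move=> z [z1 z2 _]; split.
- by move=> [x1 x2] [y1 y2] _ _ /= [/val_inj -> /val_inj ->].
move=> [x y]; rewrite inE /= => /andP[lt nr].
have [h1 h2] := grid_offset (Xphase x) (Xphase y) lt nr.
split; rewrite /= ?valP //; apply: dist_to_ray_le h1 _; apply: le_trans h2 _.
rewrite dE natrX; set e : R := 2 ^- (m * N + N + 3).
have cancel2 a b d : a = (b + d)%N -> 2 ^- a * 2 ^+ d = 2 ^- b :> R.
  by move=> ->; rewrite exprD invfM divfK // expf_neq0 // pnatr_eq0.
rewrite (cancel2 _ (m * N + N + 3)%N); last first.
  by rewrite /H; move: (m * N)%N => z; clear; lia.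
rewrite -/e.
have e1 : 2 ^- H <= e.
  rewrite lef_pV2 ?posrE ?exprn_gt0 // ler_weXn2l ?(ler_nat _ 1) //.
  by rewrite /H; move: (m * N)%N => z; clear; lia.
have e2 : 8 * e <= 2 ^- k.
  rewrite /e mulrC (_ : 8 = 2 ^+ 3 :> R); last by rewrite -natrX.
  rewrite (cancel2 _ (m * N + N)%N) // lef_pV2 ?posrE ?exprn_gt0 // ler_weXn2l ?(ler_nat _ 1) //.
  by rewrite {1}kE leq_add2l ltnW.
have e3 : 0 < e by rewrite invr_gt0 exprn_gt0.
by move: e1 e2 e3; move: (2 ^- H) (2 ^- k) e => x1 x2 x3; clear; lra.
Qed.
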